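(* Let $G$ be a second-countable compact group, let $A$ be a unital simple separable infinite-dimensional C*-algebra, and let $\alpha\colon G\to \mathrm{Aut}(A)$ be an action with the weak tracial Rokhlin property with comparison. For every $\varepsilon>0$, every compact set $F_1\subseteq A$, every compact set $F_2\subseteq A^\alpha$, every $x\in A_+$ with $\|x\|=1$, and every $y\in(A^\alpha)_+\setminus\{0\}$, there exist a positive contraction $d\in A^\alpha$ and a completely positive contractive map $\varphi\colon A\to \overline{dA^\alpha d}$ such that the following hold: (1) $\varphi(1)=d$. (2) $\|\varphi(a)\varphi(b)-d\varphi(ab)\|<\varepsilon$ for all $a,b\in F_1\cup F_2$. (3) $\|da-ad\|<\varepsilon$ for all $a\in F_1\cup F_2$. (4) $\|\varphi(a)-d^{1/2}ad^{1/2}\|<\varepsilon$ for all $a\in F_2$. (5) $\|\varphi(a)\|\geq\|a\|-\varepsilon$ for all $a\in F_1\cup F_2$. (6) $(1-d-\varepsilon)_+\precsim_A x$. (7) $(1-d-\varepsilon)_+\precsim_{A^\alpha} y$. (8) $(1-d-\varepsilon)_+\precsim_{A^\alpha} d$. (9) $\|dxd\|>1-\varepsilon$.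
   Context: Conventions. An action $\alpha\colon G\to\mathrm{Aut}(A)$ is a group homomorphism such that $g\mapsto\alpha_g(a)$ is norm continuous for every $a\in A$; $A^\alpha=\{a\in A:\alpha_g(a)=a\ \forall g\in G\}$. For a positive element $a$ and $\varepsilon>0$, $(a-\varepsilon)_+=f(a)$ with $f(t)=\max\{0,t-\varepsilon\}$. For a C*-algebra $B$ and $a,b\in (B\otimes K)_+$ ($K$ the compact operators on $\ell^2$, with $B\subset M_n(B)\subset B\otimes K$ as usual), $a\precsim_B b$ means there is a sequence $(r_n)$ in $B\otimes K$ with $\|r_n^*br_n-a\|\to 0$. On $C(G)$, $\mathrm{Lt}_g(f)(h)=f(g^{-1}h)$. Definition (weak tracial Rokhlin property with comparison). Let $G$ be a second-countable compact group, $A$ a unital simple infinite-dimensional C*-algebra, $\alpha\colon G\to\mathrm{Aut}(A)$ an action. $\alpha$ has the weak tracial Rokhlin property with comparison if for every $\varepsilon>0$, every finite set $F\subseteq A$, every finite set $S\subseteq C(G)$, every $x\in A_+$ with $\|x\|=1$, and every $y\in(A^\alpha)_+\setminus\{0\}$, there exist a positive contraction $d\in A^\alpha$ and a contractive completely positive map $\psi\colon C(G)\to\overline{dAd}$ such that: (i) $\|\psi(1)\psi(f_1f_2)-\psi(f_1)\psi(f_2)\|<\varepsilon$ for all $f_1,f_2\in S$; $\|\psi(f)a-a\psi(f)\|<\varepsilon$ for all $f\in S$, $a\in F$; and $\sup_{g\in G}\|\psi(\mathrm{Lt}_g(f))-\alpha_g(\psi(f))\|<\varepsilon$ for all $f\in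 S$; (ii) $\psi(1)=d$; (iii) $(1-d-\varepsilon)_+\precsim_A x$; (iv) $(1-d-\varepsilon)_+\precsim_{A^\alpha} y$; (v) $(1-d-\varepsilon)_+\precsim_{A^\alpha} d$; (vi) $\|dxd\|>1-\varepsilon$. *)

(* Defs.v *)
From HB Require Import structures.
From mathcomp Require Import all_boot all_order all_algebra.
From mathcomp Require Import all_classical all_reals all_analysis.
From mathcomp Require Import complex.

Set Implicit Arguments.
Unset Strict Implicit.
Unset Printing Implicit Defensive.

Import Order.TTheory GRing.Theory Num.Theory.
Import numFieldNormedType.Exports.

Local Open Scope classical_set_scope.
Local Open Scope ring_scope.
Local Open Scope complex_scope.

HB.mixin Record isTopologicalGroup G & Topological G & Group G := {
  mulg_continuous : continuous (fun p : G * G => (p.1 * p.2)%g);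
  invg_continuous : continuous (fun g : G => g^-1%g)
}.

#[short(type="topologicalGroupType")]
HB.structure Definition TopologicalGroup :=
  {G of Topological G & Group G & isTopologicalGroup G}.

(* The norm of a normed module over R[i] is R[i]-valued; nrm is the same
   number, read in R. *)
Definition nrm (R : realType) (V : normedModType R[i]) (v : V) : R :=
  complex.Re `|v|.

(* Laws of a possibly non-unital algebra whose product is mul. *)
Record is_algebra (R : realType) (S : normedModType R[i])
    (mul : S -> S -> S) : Prop := {
  alg_mulA : forall a b c, mul a (mul b c) = mul (mul a b) c;
  alg_mulDl : forall (k : R[i]) a b c,
    mul (k *: a + b) c = k *: mul a c + mul b c;
  alg_mulDr : forall (k : R[i]) a b c,
    mul a (k *: b + c) = k *: mul a b + mul a c
}.

Record is_cstar (R : realType) (S : normedModType R[i])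
    (mul : S -> S -> S) (st : S -> S) : Prop := {
  cstar_lin : forall (k : R[i]) a b, st (k *: a + b) = conjc k *: st a + st b;
  cstar_mul : forall a b, st (mul a b) = mul (st b) (st a);
  cstar_inv : forall a, st (st a) = a;
  cstar_le : forall a b, nrm (mul a b) <= nrm a * nrm b;
  cstar_id : forall a, nrm (mul (st a) a) = nrm a ^+ 2
}.

(* Nonzero unital C*-algebras. These are bundled by hand, the ring structure
   being declared as an instance afterwards, because Hierarchy Builder does not
   accept a common extension of its rings and of its normed modules. *)
Record cstarAlgType (R : realType) := CStarAlgType {
  cs_mod : completeNormedModType R[i];
  cs_mul : cs_mod -> cs_mod -> cs_mod;
  cs_one : cs_mod;
  cs_star : cs_mod -> cs_mod;
  cs_algebra : is_algebra cs_mul;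
  cs_mul1l : left_id cs_one cs_mul;
  cs_mul1r : right_id cs_one cs_mul;
  cs_one_neq0 : cs_one != 0;
  cs_cstar : is_cstar cs_mul cs_star
}.

Definition cs_sort (R : realType) (A : cstarAlgType R) : Type := cs_mod A.
Coercion cs_sort : cstarAlgType >-> Sortclass.

HB.instance Definition _ (R : realType) (A : cstarAlgType R) :=
  CompleteNormedModule.copy (cs_sort A) (cs_mod A).

Fact cs_mulA (R : realType) (A : cstarAlgType R) :
  associative (@cs_mul R A : cs_sort A -> cs_sort A -> cs_sort A).
Proof. exact: (alg_mulA (cs_algebra A)). Qed.

Fact cs_mulDl (R : realType) (A : cstarAlgType R) :
  left_distributive (@cs_mul R A : cs_sort A -> cs_sort A -> cs_sort A) +%R.
Proof.
by move=> a b c; have := alg_mulDl (cs_algebra A) 1 a b c; rewrite !scale1r.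
Qed.

Fact cs_mulDr (R : realType) (A : cstarAlgType R) :
  right_distributive (@cs_mul R A : cs_sort A -> cs_sort A -> cs_sort A) +%R.
Proof.
by move=> a b c; have := alg_mulDr (cs_algebra A) 1 a b c; rewrite !scale1r.
Qed.

HB.instance Definition _ (R : realType) (A : cstarAlgType R) :=
  GRing.Zmodule_isNzRing.Build (cs_sort A) (@cs_mulA R A)
    (@cs_mul1l R A) (@cs_mul1r R A) (@cs_mulDl R A) (@cs_mulDr R A)
    (@cs_one_neq0 R A).

Fact cs_scaleAl (R : realType) (A : cstarAlgType R) (k : R[i]) (a b : A) :
  k *: (a * b) = (k *: a) * b.
Proof.
have m0 : cs_mul (0 : cs_mod A) b = 0 by exact: (mul0r (b : cs_sort A)).
have := alg_mulDl (cs_algebra A) k a 0 b.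
by rewrite m0 !addr0 => /esym.
Qed.

HB.instance Definition _ (R : realType) (A : cstarAlgType R) :=
  GRing.Lmodule_isLalgebra.Build R[i] (cs_sort A) (@cs_scaleAl R A).

Fact cs_scaleAr (R : realType) (A : cstarAlgType R) (k : R[i]) (a b : A) :
  k *: (a * b) = a * (k *: b).
Proof.
have m0 : cs_mul a (0 : cs_mod A) = 0 by exact: (mulr0 (a : cs_sort A)).
have := alg_mulDr (cs_algebra A) k a b 0.
by rewrite m0 !addr0 => /esym.
Qed.

HB.instance Definition _ (R : realType) (A : cstarAlgType R) :=
  GRing.Lalgebra_isAlgebra.Build R[i] (cs_sort A) (@cs_scaleAr R A).

Definition star (R : realType) (A : cstarAlgType R) : A -> A := @cs_star R A.
Arguments star {R A} a.

(* Topological simplicity: only trivial closed two-sided ideals. A is unital,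
   so an ideal is automatically stable under scaling. *)
Definition simple_cstar (R : realType) (A : cstarAlgType R) : Prop :=
  forall I : set A, closed I -> I 0 ->
    (forall a b, I a -> I b -> I (a + b)) ->
    (forall a b, I b -> I (a * b)) ->
    (forall a b, I a -> I (a * b)) ->
    I = [set 0] \/ I = setT.

Definition infinite_dim (R : realType) (A : cstarAlgType R) : Prop :=
  ~ exists (n : nat) (v : 'I_n -> A),
      forall a : A, exists c : 'I_n -> R[i], a = \sum_i c i *: v i.

Definition separable_space (T : topologicalType) : Prop :=
  exists2 D : set T, countable D & dense D.

(* B_+, for a C*-subalgebra B of A. *)
Definition pos (R : realType) (A : cstarAlgType R) (B : set A) : set A :=
  [set a | exists2 b, B b & a = star b * b].

(* M_n(D)_+, for a *-subring D of the ring T with involution st. *)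
Definition mxpos (T : pzRingType) (st : T -> T) (D : set T) (n : nat) :
    set 'M[T]_n :=
  [set X | exists2 Y : 'M[T]_n, (forall i j, D (Y i j))
                              & X = (map_mx st Y)^T *m Y].

Definition completely_positive (T U : pzRingType) (stT : T -> T)
    (stU : U -> U) (D : set T) (E : set U) (f : T -> U) : Prop :=
  forall (n : nat) (X : 'M[T]_n),
    mxpos stT D X -> mxpos stU E (map_mx f X).

Definition linear_on (C : pzRingType) (V W : lmodType C) (D : set V)
    (f : V -> W) : Prop :=
  forall (k : C) u v, D u -> D v -> f (k *: u + v) = k *: f u + f v.

Definition spectrum (R : realType) (A : cstarAlgType R) (a : A) : set R[i] :=
  [set z | ~ exists b, b * (z%:A - a) = 1 /\ (z%:A - a) * b = 1].

(* Continuous functional calculus f(a), for a self-adjoint (so with real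
   spectrum) and f continuous on the spectrum of a: the common limit of p(a)
   for polynomials p tending to f uniformly on the spectrum. *)
Definition cfc (R : realType) (A : cstarAlgType R) (f : R -> R) (a : A) : A :=
  xget 0 [set b | forall e : R, 0 < e -> exists p : {poly R},
    (forall t : R, spectrum a t%:C -> `|p.[t] - f t| <= e) /\
    nrm (horner_alg a (map_poly (fun t : R => t%:C) p) - b) <= e].

Definition cutdown (R : realType) (A : cstarAlgType R) (a : A) (e : R) : A :=
  cfc (fun t => Num.max 0 (t - e)) a.

(* The C*-algebra S (product mul, involution st), with e i j b in the role of
   b (x) e_ij, is the stabilization B (x) K: it is the closure of the union of
   the increasing copies of the matrix algebras M_n(B) spanned by the e i j b,
   and e 0 0 is the usual inclusion of B. As each M_n(B) has only one C*-norm,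
   this determines (S, e) up to isomorphism. *)
Record stabilization (R : realType) (A : cstarAlgType R) (B : set A)
    (S : completeNormedModType R[i]) (mul : S -> S -> S) (st : S -> S)
    (e : nat -> nat -> A -> S) : Prop := {
  stab_algebra : is_algebra mul;
  stab_cstar : is_cstar mul st;
  stab_lin : forall i j, linear_on B (e i j);
  stab_mul : forall i j k l a b, B a -> B b ->
    mul (e i j a) (e k l b) = if j == k then e i l (a * b) else 0;
  stab_star : forall i j a, B a -> st (e i j a) = e j i (star a);
  stab_nrm : forall i j a, B a -> nrm (e i j a) = nrm a;
  stab_dense : closure [set s | exists (n : nat) (X : 'M[A]_n),
      (forall i j, B (X i j)) /\ s = 
          \sum_(i < n) \sum_(j < n) e i j (X i j)] = setT
}.

Definition cuntz_sub (R : realType) (A : cstarAlgType R) (B : set A)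
    (a b : A) : Prop :=
  exists (S : completeNormedModType R[i]) (mul : S -> S -> S) (st : S -> S)
         (e : nat -> nat -> A -> S),
    stabilization B mul st e /\
    exists r : nat -> S,
      (fun n => nrm (mul (mul (st (r n)) (e 0%N 0%N b)) (r n) - e 0%N 0%N a))
        @ \oo --> (0 : R).

Record is_action (R : realType) (G : topologicalGroupType)
    (A : cstarAlgType R) (alpha : G -> A -> A) : Prop := {
  act_lin : forall g (k : R[i]) a b,
    alpha g (k *: a + b) = k *: alpha g a + alpha g b;
  act_mul : forall g a b, alpha g (a * b) = alpha g a * alpha g b;
  act_star : forall g a, alpha g (star a) = star (alpha g a);
  act_1 : forall a, alpha 1%g a = a;
  act_M : forall g h a, alpha (g * h)%g a = alpha g (alpha h a);
  act_continuous : forall a, continuous (fun g => alpha g a)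
}.

Definition fixed_alg (R : realType) (G : topologicalGroupType)
    (A : cstarAlgType R) (alpha : G -> A -> A) : set A :=
  [set a | forall g, alpha g a = a].

Definition corner (R : realType) (A : cstarAlgType R) (B : set A) (d : A) :
    set A :=
  closure [set d * b * d | b in B].

(* C(G), inside the algebra of all functions from G to the complex numbers. *)
Definition CG (R : realType) (G : topologicalGroupType) : set (G -> R[i]) :=
  [set f | continuous (f : G -> R[i]^o)].

Definition Lt (R : realType) (G : topologicalGroupType) (g : G)
    (f : G -> R[i]) : G -> R[i] :=
  fun h => f (g^-1 * h)%g.

(* psi restricts to a contractive completely positive map from C(G) to the
   C*-subalgebra E of A; its values outside C(G) are irrelevant. *)
Definition cpc_CG (R : realType) (G : topologicalGroupType)
    (A : cstarAlgType R) (E : set A) (psi : (G -> R[i]) -> A) : Prop :=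
  [/\ linear_on (@CG R G) psi,
      completely_positive (fun f : G -> R[i] => fun g => conjc (f g)) star
        (@CG R G) E psi,
      (forall f, CG f ->
        ((nrm (psi f))%:E <= ereal_sup [set (nrm (f g : R[i]^o))%:E | g in setT])%E) &
      (forall f, CG f -> E (psi f))].

Definition cpc (R : realType) (A : cstarAlgType R) (E : set A)
    (phi : A -> A) : Prop :=
  [/\ linear phi,
      completely_positive star star setT E phi,
      (forall a, nrm (phi a) <= nrm a) &
      (forall a, E (phi a))].

Definition wtrp_comparison (R : realType) (G : topologicalGroupType)
    (A : cstarAlgType R) (alpha : G -> A -> A) : Prop :=
  forall (eps : R) (F : set A) (S : set (G -> R[i])) (x y : A),
    0 < eps -> finite_set F -> finite_set S -> S `<=` @CG R G ->
    pos setT x -> nrm x = 1 ->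
    pos (fixed_alg alpha) y -> y <> 0 ->
    exists (d : A) (psi : (G -> R[i]) -> A),
      (pos (fixed_alg alpha) d /\ nrm d <= 1) /\
      cpc_CG (corner setT d) psi /\
      (forall f1 f2, S f1 -> S f2 ->
        nrm (psi 1 * psi (f1 * f2) - psi f1 * psi f2) < eps) /\
      (forall f a, S f -> F a -> nrm (psi f * a - a * psi f) < eps) /\
      (forall f, S f ->
        (ereal_sup [set (nrm (psi (Lt g f) - alpha g (psi f)))%:E | g in setT]
         < eps%:E)%E) /\
      psi 1 = d /\
      cuntz_sub setT (cutdown (1 - d) eps) x /\
      cuntz_sub (fixed_alg alpha) (cutdown (1 - d) eps) y /\
      cuntz_sub (fixed_alg alpha) (cutdown (1 - d) eps) d /\
      1 - eps < nrm (d * x * d).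

(* Main.v *)
Require Import Defs.
From mathcomp Require Import all_boot all_order all_algebra.
From mathcomp Require Import all_classical all_reals all_analysis.
From mathcomp Require Import complex ring lra zify.

(* Given finitely many elements a, let (f_j) be a partition of unity of G with
   alpha_g(a) close to alpha_(g_j)(a) whenever f_j(g) <> 0. With psi_n the maps
   of the weak tracial Rokhlin property for the tolerance 1/(n+1), put
   s_j = psi_n(f_j)^(1/2) and
     phi_n(a) = E(sum_j s_j alpha_(g_j)(a) s_j),
   where E is the conditional expectation onto the fixed point algebra. Haar
   measure is avoided: E is a limit of averages over finite nets of orbits.
   As the psi_n are asymptotically equivariant, central and multiplicative, the
   sum is asymptotically fixed, and phi_n satisfies (2)-(4) up to o(1).
   For (5), simplicity gives c_i with sum_i c_i^* c_i = 1 and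
   sum_i c_i^* a^* a c_i >= |a|^2 - e. Then sum_i phi_n(c_i)^* phi_n(c_i) is
   close to d_n^2 and sum_i phi_n(a c_i)^* phi_n(a c_i) to an element above
   (|a|^2 - e) d_n^2, so that (2) and |d_n| -> 1, a consequence of (9), give
   |phi_n(a)|^2 >= |a|^2 - e - o(1).
   The Cuntz relations pass from the tolerance t = 1/(n+1) to any e > t because
   (h - e)_+ = w (h - t)_+ w for some w. *)

Set Implicit Arguments.
Unset Strict Implicit.
Unset Printing Implicit Defensive.

Import Order.TTheory GRing.Theory Num.Theory.
Import numFieldNormedType.Exports.

Local Open Scope classical_set_scope.
Local Open Scope ring_scope.
Local Open Scope complex_scope.

(** * Square roots by iteration *)

(** Two forms of the sum over j are needed. With p_j = psi(f_j), the sum of the p_j alpha_(g_j)(a)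
    suits algebraic computation and the sum with the roots s_j gives complete positivity; they
    differ by commutators that vanish with n. The error that does not vanish with n must not grow
    with the number of indices, which depends on the tolerance: a sum of s_j b_j s_j with sum s_j^2
    <= 1 is bounded by the largest |b_j|, whatever their number. Complete positivity into the corner
    asks for square roots of matrices with entries in the corner, which need not contain 1. No
    C*-norm on matrices is used: their positivity is tested through forms, and roots come from an
    iteration that uses only the ring structure, a complete norm and bounded powers. The same
    iteration gives roots in A, and from these the positive cone, the spectrum and the functional
    calculus are developed. The c_i of (5) depend only on a and the tolerance, so they can join the
    finite set of test elements before the maps are chosen. *)

Definition ncvg (R : realType) (T : zmodType) (N : T -> R) (u : nat -> T)
    (l : T) : Prop :=
  forall e : R, 0 < e -> exists n0, forall n, (n0 <= n)%N -> N (u n - l) <= e.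

Definition ncauchy (R : realType) (T : zmodType) (N : T -> R)
    (u : nat -> T) : Prop :=
  forall e : R, 0 < e -> exists n0, forall m n,
    (n0 <= m)%N -> (n0 <= n)%N -> N (u m - u n) <= e.

Lemma inv_nat_small (R : realType) (c e : R) : 0 < e ->
  exists n0, forall n, (n0 <= n)%N -> c / n.+1%:R <= e.
Proof.
move=> e0; exists (Num.bound (`|c| / e)) => n hn.
rewrite ler_pdivrMr ?ltr0Sn// mulrC -ler_pdivrMr//.
apply: (@le_trans _ _ (`|c| / e)).
  by rewrite ler_pM2r ?invr_gt0// ler_norm.
apply: (le_trans (ltW (archi_boundP _))); first by rewrite divr_ge0// ltW.
by rewrite ler_nat (leq_trans hn).
Qed.

Section SquareRootIteration.
Variables (R : realType) (T : pzRingType) (N : T -> R) (hf K : T) (B : R).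
Hypothesis N_eq0 : forall x, N x = 0 -> x = 0.
Hypothesis N_ge0 : forall x, 0 <= N x.
Hypothesis ND : forall x y, N (x + y) <= N x + N y.
Hypothesis NN : forall x, N (- x) = N x.
Hypothesis NM : forall x y, N (x * y) <= N x * N y.
Hypothesis hfC : forall x, hf * x = x * hf.
Hypothesis hfN : forall x, N (hf * x) <= N x / 2.
Hypothesis hf2 : hf + hf = 1.
Hypothesis complN : forall u, ncauchy N u -> exists l, ncvg N u l.
Hypothesis NK : forall j, N (K ^+ j) <= B.

(** Iterates of y = (K + y^2) / 2, an equation equivalent to (1 - y)^2 = 1 - K. The half is a
    central ring element [hf], so that one iteration serves for A and for matrices over A. *)
Fixpoint sqit (n : nat) : T :=
  if n is m.+1 then hf * (K + sqit m * sqit m) else 0.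

(** The iteration in the reals with K = 1: the sum of the coefficients of [sqit n] as a polynomial
    in K. It increases to 1. *)
Fixpoint sqitR (n : nat) : R :=
  if n is m.+1 then (1 + sqitR m ^+ 2) / 2 else 0.

(* Combinations of the powers of K with coefficients of sum c, all of them
   nonnegative: the norm of such an element is at most B c. *)
Inductive conic : T -> R -> Prop :=
| conic0 : conic 0 0
| conicX j : conic (K ^+ j) 1
| conicD x y c c' : conic x c -> conic y c' -> conic (x + y) (c + c')
| conicH x c : conic x c -> conic (hf * x) (c / 2).

Lemma conicM x y c c' : conic x c -> conic y c' -> conic (x * y) (c * c').
Proof.
move=> hx hy; elim: hx => {x c} [|j|x y' c c1 _ h1 _ h2|x c _ h].
- by rewrite !mul0r; apply: conic0.
- rewrite mul1r; elim: hy => {y c'} [|i|x y c c1 _ h1 _ h2|x c _ h].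
  + by rewrite mulr0; apply: conic0.
  + by rewrite -exprD; apply: conicX.
  + by rewrite mulrDr; apply: conicD.
  + by rewrite mulrA -hfC -mulrA; apply: conicH.
- by rewrite !mulrDl; apply: conicD.
- by rewrite -mulrA mulrAC; apply: conicH.
Qed.

Lemma conic_norm x c : conic x c -> N x <= B * c.
Proof.
elim=> {x c} [|j|x y c c1 _ h1 _ h2|x c _ h].
- have h0 := hfN 0; rewrite mulr0 in h0 *.
  by have := N_ge0 0; lra.
- by rewrite mulr1.
- by rewrite mulrDr (le_trans (ND _ _))// lerD.
- by rewrite (le_trans (hfN _))// mulrA ler_pM2r ?invr_gt0.
Qed.

Lemma sqit_conic n : conic (sqit n) (sqitR n).
Proof.
elim: n => [|n IHn] /=; first exact: conic0.
by apply/conicH/conicD; [rewrite -[K]expr1; exact: conicX|rewrite expr2; exact: conicM].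
Qed.

(** The increment after y0, y1 is ((y1 - y0) y1 + y0 (y1 - y0)) / 2, which has nonnegative
    coefficients if y1 - y0 has. *)
Lemma sqit_incr n : conic (sqit n.+1 - sqit n) (sqitR n.+1 - sqitR n).
Proof.
elim: n => [|n IHn].
  by rewrite !subr0; exact: sqit_conic.
set y1 := sqit n.+1; set y0 := sqit n.
have -> : sqit n.+2 - y1 = hf * ((y1 - y0) * y1 + y0 * (y1 - y0)).
  rewrite /= -/y1 -[y1 in X in X = _]/(hf * (K + y0 * y0)) -mulrBr; congr (hf * _).
  rewrite mulrBl mulrBr addrA addrNK opprD addrACA subrr add0r.
  by [].
set u1 := sqitR n.+1; set u0 := sqitR n.
have -> : sqitR n.+2 - u1 = ((u1 - u0) * u1 + u0 * (u1 - u0)) / 2.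
  have hu : u1 = (1 + u0 ^+ 2) / 2 by [].
  rewrite (_ : sqitR n.+2 = (1 + u1 ^+ 2) / 2)//.
  by move: hu; move: (u1) (u0) => a b ->; field.
by apply/conicH/conicD; apply: conicM => //; apply: sqit_conic.
Qed.

(** With v = 1 - u one step is v - v^2 / 2, which increases with v up to v = 1. The first step is
    separate because 2 / x <= 1 requires x >= 2. *)
Lemma sqitR_bound n : 0 <= sqitR n <= 1 /\ 1 - sqitR n <= 2 / n.+1%:R.
Proof.
elim: n => [|n [/andP[u0 u1] h]] /=; first by split; [lra|rewrite divr1; lra].
set u := sqitR n in u0 u1 h *; split; first by apply/andP; split; nra.
case: n => [|n] in u u0 u1 h *; first by rewrite (_ : u = 0)// expr0n addr0 divff//; lra.
have n0 : 0 < n.+2%:R :> R by rewrite ltr0Sn.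
rewrite [n.+3%:R]mulrS; move: n0 h.
have : 2 <= n.+2%:R :> R by rewrite ler_nat.
set x : R := n.+2%:R => x2 x0 h.
have hc : 2 / x <= 1 by rewrite ler_pdivrMr// mul1r.
apply: (@le_trans _ _ (2 / x - (2 / x) ^+ 2 / 2)).
  move: (2 / x) hc h => c hc h.
  have : 0 <= (c - (1 - u)) * (2 - c - (1 - u)) by apply: mulr_ge0; lra.
  lra.
rewrite -subr_ge0.
have -> : 2 / (1 + x) - (2 / x - (2 / x) ^+ 2 / 2) = 2 / (x ^+ 2 * (1 + x)).
  by field; rewrite !gt_eqF//; lra.
by rewrite divr_ge0// mulr_ge0 ?exprn_ge0//; lra.
Qed.

Lemma sqit_sub n k :
  conic (sqit (n + k) - sqit n) (sqitR (n + k) - sqitR n).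
Proof.
elim: k => [|k IHk]; first by rewrite addn0 !subrr; exact: conic0.
rewrite addnS.
have -> : sqit (n + k).+1 - sqit n =
    (sqit (n + k).+1 - sqit (n + k)) + (sqit (n + k) - sqit n).
  by rewrite addrA addrNK.
have -> : sqitR (n + k).+1 - sqitR n =
    (sqitR (n + k).+1 - sqitR (n + k)) + (sqitR (n + k) - sqitR n) by ring.
exact: conicD (sqit_incr _) IHk.
Qed.

Lemma sqit_cauchy : ncauchy N sqit.
Proof.
have B0 : 0 <= B by rewrite (le_trans (N_ge0 1))// -(expr0 K).
move=> e e0; have [n0 h0] := inv_nat_small (B * 2) e0.
have key m n : (n0 <= n)%N -> (n <= m)%N -> N (sqit m - sqit n) <= e.
  move=> hn /subnKC <-; apply: (le_trans (conic_norm (sqit_sub n _))).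
  apply: (le_trans _ (h0 n hn)); rewrite -mulrA ler_wpM2l//.
  have [_ h] := sqitR_bound n.
  have [/andP[_ h1] _] := sqitR_bound (n + (m - n)).
  by apply: le_trans h; rewrite lerD2r.
exists n0 => m n hm hn; case/orP: (leq_total n m) => h; first exact: key.
by rewrite -NN opprB; apply: key.
Qed.

Lemma ncvg_unique (u : nat -> T) l l' : ncvg N u l -> ncvg N u l' -> l = l'.
Proof.
move=> ul ul'; apply/eqP; rewrite -subr_eq0; apply/eqP/N_eq0/eqP.
rewrite eq_le N_ge0 andbT; apply/ler_addgt0Pl => e e0; rewrite addr0.
have e20 : 0 < e / 2 by rewrite divr_gt0.
have [n h] := ul _ e20; have [n' h'] := ul' _ e20.
pose m := maxn n n'.
have -> : l - l' = - (u m - l) + (u m - l') by rewrite opprB addrA addrNK.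
rewrite (le_trans (ND _ _))// NN [leRHS]splitr lerD//.
  by apply: h; rewrite leq_maxl.
by apply: h'; rewrite leq_maxr.
Qed.

Lemma ncvgM (u v : nat -> T) l k :
  ncvg N u l -> ncvg N v k -> ncvg N (fun n => u n * v n) (l * k).
Proof.
move=> ul vk e e0.
pose c := N l + N k + 1.
have c1 : 1 <= c by rewrite /c; have := N_ge0 l; have := N_ge0 k; lra.
have c0 : 0 < c by lra.
pose d := Num.min 1 (e / (3 * c)).
have d0 : 0 < d by rewrite lt_min ltr01 divr_gt0// mulr_gt0.
have [n h] := ul _ d0; have [n' h'] := vk _ d0.
exists (maxn n n') => m; rewrite geq_max => /andP[/h hu /h' hv].
have -> : u m * v m - l * k =
    (u m - l) * (v m - k) + ((u m - l) * k + l * (v m - k)).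
  by rewrite addrA -mulrDr addrNK mulrBl mulrBr addrA addrNK.
have d1 : d <= 1 by rewrite ge_min lexx.
have dc : d * (3 * c) <= e.
  by rewrite -ler_pdivlMr ?mulr_gt0// ge_min lexx orbT.
have [p0 q0] := (N_ge0 (u m - l), N_ge0 (v m - k)).
have [l0 k0] := (N_ge0 l, N_ge0 k).
have := ND ((u m - l) * (v m - k)) ((u m - l) * k + l * (v m - k)).
have := ND ((u m - l) * k) (l * (v m - k)).
have := NM (u m - l) (v m - k); have := NM (u m - l) k; have := NM l (v m - k).
have : N (u m - l) * N (v m - k) <= d * c by apply: ler_pM => //; lra.
have : N (u m - l) * N k <= d * c by apply: ler_pM => //; rewrite /c; lra.
have : N l * N (v m - k) <= d * c by rewrite mulrC; apply: ler_pM => //; rewrite /c; lra.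
nra.
Qed.

Lemma sqrt_iteration :
  exists2 y, (1 - y) * (1 - y) = 1 - K & ncvg N sqit y.
Proof.
have [y hy] := complN sqit_cauchy; exists y => //.
have e1 : y = hf * (K + y * y).
  have h1 : ncvg N (fun n => sqit n.+1) y.
    by move=> e /hy[n h]; exists n => m hm; apply: h; rewrite (leq_trans hm).
  apply: ncvg_unique h1 _ => e e0 /=.
  have e20 : 0 < 2 * e by rewrite mulr_gt0.
  have [n h] := ncvgM hy hy e20; exists n => m /h {}h.
  rewrite -mulrBr opprD addrACA subrr add0r (le_trans (hfN _))//; lra.
have e2 : y + y = K + y * y.
  by rewrite -[RHS]mul1r -hf2 mulrDl -e1.
have -> : K = y + y - y * y by rewrite e2 addrK.
by rewrite mulrBl mul1r mulrBr mulr1 !opprB opprD -addrA; congr (1 + _); rewrite addrCA.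
Qed.

End SquareRootIteration.

(** * Norm and involution *)

Section Norm.
Variables (R : realType) (V : normedModType R[i]).
Implicit Types (v w : V) (r : R).

Lemma nrmE v : `|v| = (nrm v)%:C.
Proof. by rewrite /nrm RRe_real// ger0_real. Qed.

Lemma nrm_ge0 v : 0 <= nrm v.
Proof. by rewrite -ler0c -nrmE. Qed.

Lemma nrm0 : nrm (0 : V) = 0.
Proof. by apply: complexI; rewrite -nrmE normr0. Qed.

Lemma nrm_eq0 v : nrm v = 0 -> v = 0.
Proof. by move=> h; apply/eqP; rewrite -normr_eq0 nrmE h. Qed.

Lemma nrmD v w : nrm (v + w) <= nrm v + nrm w.
Proof. by rewrite -lecR rmorphD/= -!nrmE ler_normD. Qed.

Lemma nrmN v : nrm (- v) = nrm v.
Proof. by rewrite /nrm normrN. Qed.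

Lemma nrmBC v w : nrm (v - w) = nrm (w - v).
Proof. by rewrite /nrm distrC. Qed.

Lemma nrmB v w : nrm (v - w) <= nrm v + nrm w.
Proof. by rewrite (le_trans (nrmD _ _))// nrmN. Qed.

Lemma nrm_tri w v u : nrm (v - u) <= nrm (v - w) + nrm (w - u).
Proof. by rewrite (le_trans _ (nrmD _ _))// addrA addrNK. Qed.

Lemma nrm_dist v w : nrm v <= nrm w + nrm (v - w).
Proof. by rewrite (le_trans _ (nrmD _ _))// addrC addrNK. Qed.

Lemma nrmZ (k : R[i]) v : nrm (k *: v) = complex.Re `|k| * nrm v.
Proof.
by apply: complexI; rewrite -nrmE normrZ rmorphM/= -nrmE; congr (_ * _).
Qed.

Lemma nrmZr r v : nrm (r%:C *: v) = `|r| * nrm v.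
Proof. by rewrite nrmZ normc_def/= expr0n addr0 sqrtr_sqr. Qed.

Lemma nrmZp r v : 0 <= r -> nrm (r%:C *: v) = r * nrm v.
Proof. by move=> r0; rewrite nrmZr ger0_norm. Qed.

Lemma nrm_sum (I : Type) (s : seq I) (P : pred I) (F : I -> V) :
  nrm (\sum_(i <- s | P i) F i) <= \sum_(i <- s | P i) nrm (F i).
Proof.
elim/big_rec2: _ => [|i y x _ h]; first by rewrite nrm0.
by rewrite (le_trans (nrmD _ _))// lerD2l.
Qed.

Lemma nbhs_nrmP v (A : set V) :
  nbhs v A <-> exists2 e : R, 0 < e & forall w, nrm (v - w) < e -> A w.
Proof.
split=> [/nbhs_ballP[e /= e0 h]|[e e0 h]].
  have [e1 e2] : e = (complex.Re e)%:C /\ 0 < complex.Re e.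
    have h1 : e = (complex.Re e)%:C by rewrite RRe_real// gtr0_real.
    by split=> //; move: e0; rewrite h1 ltcR.
  exists (complex.Re e) => // w hw; apply: h.
  by rewrite -ball_normE /= e1 nrmE ltcR.
apply/nbhs_ballP; exists e%:C; first by rewrite /= ltcR.
by move=> w; rewrite -ball_normE /= nrmE ltcR => /h.
Qed.

Lemma closure_nrmP (S : set V) v :
  closure S v <-> forall e : R, 0 < e -> exists2 s, S s & nrm (v - s) < e.
Proof.
split=> [h e e0|h B /nbhs_nrmP[e e0 hB]]; last first.
  by have [s Ss hs] := h e e0; exists s; split => //; apply: hB.
have [] := h [set w | nrm (v - w) < e].
  by apply/nbhs_nrmP; exists e.
by move=> s [Ss hs]; exists s.
Qed.

Lemma cvg_nrmP (u : nat -> V) l : u @ \oo --> l <-> ncvg (@nrm R V) u l.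
Proof.
split=> [h e e0|h].
  have /h[n _ hn] : nbhs l [set w | nrm (l - w) < e].
    by apply/nbhs_nrmP; exists e.
  by exists n => m /hn /ltW; rewrite nrmBC.
move=> B /nbhs_nrmP[e e0 hB].
have [|n hn] := h (e / 2); first by rewrite divr_gt0.
exists n => // m /hn hm; apply: hB; rewrite nrmBC (le_lt_trans hm)//.
by rewrite ltr_pdivrMr// mulr_natr mulr2n ltrDl.
Qed.

End Norm.

Lemma ncauchy_nrm_cvg (R : realType) (V : completeNormedModType R[i])
    (u : nat -> V) : ncauchy (@nrm R V) u -> exists l, ncvg (@nrm R V) u l.
Proof.
move=> cu; suff /cvg_ex[l /cvg_nrmP] : cvgn u by exists l.
apply/cauchy_cvgP/cauchy_exP => e e0.
have h1 : e = (complex.Re e)%:C by rewrite RRe_real// gtr0_real.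
have h2 : 0 < complex.Re e by move: e0; rewrite h1 ltcR.
have h3 : 0 < complex.Re e / 2 by rewrite divr_gt0.
have [n hn] := cu _ h3.
exists (u n), n => // m /= hm; rewrite -ball_normE /= h1 nrmE ltcR.
rewrite (le_lt_trans (hn n m _ _))//.
by rewrite ltr_pdivrMr// mulr_natr mulr2n ltrDl.
Qed.

Section CStarBasics.
Variables (R : realType) (A : cstarAlgType R).
Implicit Types (a b c h k : A) (r : R).

Let starP : is_cstar (@cs_mul R A) (@cs_star R A) := cs_cstar A.

Lemma starZD (z : R[i]) a b : star (z *: a + b) = conjc z *: star a + star b.
Proof. exact: (cstar_lin starP). Qed.

Lemma starD a b : star (a + b) = star a + star b.
Proof. by have := starZD 1 a b; rewrite conjc1 !scale1r. Qed.

Lemma star0 : star 0 = 0 :> A.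
Proof. by apply: (addrI (star 0)); rewrite -starD !addr0. Qed.

Lemma starZ (z : R[i]) a : star (z *: a) = conjc z *: star a.
Proof. by have := starZD z a 0; rewrite star0 !addr0. Qed.

Lemma starZr r a : star (r%:C *: a) = r%:C *: star a.
Proof. by rewrite starZ conjc_real. Qed.

Lemma starN a : star (- a) = - star a.
Proof. by apply: (addrI (star a)); rewrite -starD !subrr star0. Qed.

Lemma starB a b : star (a - b) = star a - star b.
Proof. by rewrite starD starN. Qed.

Lemma starM a b : star (a * b) = star b * star a.
Proof. exact: (cstar_mul starP). Qed.

Lemma starK a : star (star a) = a.
Proof. exact: (cstar_inv starP). Qed.

Lemma star1 : star 1 = 1 :> A.
Proof.
have : star (star 1 * 1) = star 1 :> A by rewrite starM starK mulr1.
by rewrite mulr1 starK.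
Qed.

Lemma star_sum (I : Type) (s : seq I) (P : pred I) (F : I -> A) :
  star (\sum_(i <- s | P i) F i) = \sum_(i <- s | P i) star (F i).
Proof. exact: (big_morph _ starD star0). Qed.

Lemma starX a n : star (a ^+ n) = star a ^+ n.
Proof. by elim: n => [|n IH]; rewrite ?star1// exprS starM IH -exprSr. Qed.

Lemma nrmM a b : nrm (a * b) <= nrm a * nrm b.
Proof. exact: (cstar_le starP). Qed.

Lemma nrm_starM a : nrm (star a * a) = nrm a ^+ 2.
Proof. exact: (cstar_id starP). Qed.

Lemma nrm_star a : nrm (star a) = nrm a.
Proof.
suff h b : nrm b <= nrm (star b).
  by apply/eqP; rewrite eq_le h -{2}[a]starK h.
have [->|b0] := eqVneq (nrm b) 0; first exact: nrm_ge0.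
have bp : 0 < nrm b by rewrite lt_neqAle eq_sym b0 nrm_ge0.
by rewrite -(ler_pM2r bp) -expr2 -nrm_starM nrmM.
Qed.

Lemma nrm1 : nrm (1 : A) = 1.
Proof.
have h := nrm_starM 1; rewrite star1 mulr1 expr2 in h.
have h0 : nrm (1 : A) != 0.
  by apply/eqP => /nrm_eq0/eqP; rewrite oner_eq0.
by apply: (mulfI h0); rewrite mulr1 -h.
Qed.

Lemma nrmX a n : nrm a <= 1 -> nrm (a ^+ n) <= 1.
Proof.
move=> a1; elim: n => [|n IH]; first by rewrite nrm1.
by rewrite exprS (le_trans (nrmM _ _))// mulr_ile1// nrm_ge0.
Qed.

Lemma nrm_sa_sqr a : star a = a -> nrm (a * a) = nrm a ^+ 2.
Proof. by move=> h; rewrite -nrm_starM h. Qed.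

Lemma scalerMM (z w : R[i]) a b : (z *: a) * (w *: b) = (z * w) *: (a * b).
Proof. by rewrite -scalerAl -scalerAr scalerA. Qed.

(** Closedness of S, in terms of [nrm]. *)
Definition clim (S : set A) : Prop :=
  forall l, (forall e : R, 0 < e -> exists2 s, S s & nrm (l - s) < e) -> S l.

Lemma ncvgA_unique (u : nat -> A) l l' :
  ncvg (@nrm R A) u l -> ncvg (@nrm R A) u l' -> l = l'.
Proof.
apply: ncvg_unique; [exact: nrm_eq0|exact: nrm_ge0|exact: nrmD|exact: nrmN].
Qed.

End CStarBasics.

Lemma sqrtrM_self (R : realType) (r : R) : 0 <= r -> Num.sqrt r * Num.sqrt r = r.
Proof. by move=> r0; rewrite -expr2 sqr_sqrtr. Qed.

Lemma subr_sub2 (V : zmodType) (x y z : V) : x - y - (x - z) = z - y.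
Proof. by rewrite opprB addrC addrA addrNK. Qed.

(** * The positive cone *)

Section Positive.
Variables (R : realType) (A : cstarAlgType R).
Implicit Types (a b c h k s x y : A) (r M : R).

Lemma ncvg_star (u : nat -> A) l :
  ncvg (@nrm R A) u l -> ncvg (@nrm R A) (star \o u) (star l).
Proof.
move=> h e /h[n hn]; exists n => m /hn.
by rewrite /= -starB nrm_star.
Qed.

Lemma ncvgMl c (u : nat -> A) l :
  ncvg (@nrm R A) u l -> ncvg (@nrm R A) (fun n => c * u n) (c * l).
Proof.
move=> h e e0; have c0 : 0 < nrm c + 1 by rewrite ltr_wpDl ?nrm_ge0.
have [n hn] := h _ (divr_gt0 e0 c0); exists n => m /hn.
rewrite ler_pdivlMr// -mulrBr => h1; apply: le_trans h1.
rewrite (le_trans (nrmM _ _))// mulrC ler_wpM2l ?nrm_ge0//.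
by rewrite lerDl.
Qed.

Lemma ncvgMr c (u : nat -> A) l :
  ncvg (@nrm R A) u l -> ncvg (@nrm R A) (fun n => u n * c) (l * c).
Proof.
move=> h e e0; have c0 : 0 < nrm c + 1 by rewrite ltr_wpDl ?nrm_ge0.
have [n hn] := h _ (divr_gt0 e0 c0); exists n => m /hn.
rewrite ler_pdivlMr// -mulrBl => h1; apply: le_trans h1.
rewrite (le_trans (nrmM _ _))// ler_wpM2l ?nrm_ge0//.
by rewrite lerDl.
Qed.

Lemma addr_scale2 a : a + a = (2 : R)%:C *: a.
Proof. by rewrite mulr2n rmorphD/= rmorph1 scalerDl scale1r. Qed.

Lemma scaleRA r r' a : r%:C *: (r'%:C *: a) = (r * r')%:C *: a.
Proof. by rewrite scalerA -rmorphM. Qed.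

Lemma scaleRMM r r' a b : (r%:C *: a) * (r'%:C *: b) = (r * r')%:C *: (a * b).
Proof. by rewrite scalerMM -rmorphM. Qed.

Lemma nrm_one_scale r : nrm (r%:C%:A : A) = `|r|.
Proof. by rewrite nrmZr nrm1 mulr1. Qed.

(** Self-adjointness and commutation hold for every iterate, a polynomial in x, and pass to the
    limit. *)
Lemma sqrt_one_sub x : star x = x -> nrm x <= 1 ->
  exists k, [/\ star k = k, k * k = 1 - x & forall c, c * x = x * c -> c * k = k * c].
Proof.
move=> sx x1; pose hf : A := (2^-1)%:C%:A.
have hfM y : hf * y = (2^-1)%:C *: y by rewrite /hf -scalerAl mul1r.
have hfMr y : y * hf = (2^-1)%:C *: y by rewrite /hf -scalerAr mulr1.
have [||||||||||y ye yl] := @sqrt_iteration R A (@nrm R A) hf x 1.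
- exact: nrm_eq0.
- exact: nrm_ge0.
- exact: nrmD.
- exact: nrmN.
- exact: nrmM.
- by move=> y; rewrite hfM hfMr.
- by move=> y; rewrite hfM nrmZp ?invr_ge0// mulrC.
- by rewrite /hf -scalerDl -rmorphD/= (_ : 2^-1 + 2^-1 = 1) ?scale1r//; lra.
- exact: ncauchy_nrm_cvg.
- by move=> j; exact: nrmX.
exists (1 - y); split => //.
- rewrite starB star1; congr (1 - _).
  apply: (ncvgA_unique (ncvg_star yl)).
  rewrite (_ : star \o _ = sqit hf x)//; apply/funext => n /=.
  elim: n => [|n IH] /=; first exact: star0.
  by rewrite hfM starZr starD starM sx IH.
- move=> c cx; rewrite mulrBr mulrBl mulr1 mul1r; congr (_ - _).
  apply: (ncvgA_unique (ncvgMl c yl)).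
  rewrite (_ : (fun n => _) = (fun n => sqit hf x n * c)); first exact: ncvgMr.
  apply/funext => n; elim: n => [|n IH] /=; first by rewrite mulr0 mul0r.
  rewrite hfM -scalerAr -scalerAl mulrDr mulrDl cx; congr (_ *: (_ + _)).
  by rewrite mulrA IH -!mulrA IH.
Qed.

(* [|h|^2 <= |h + ik|^2 = |h^2 + k^2|], the C*-identity giving the equality. *)
Lemma nrm_sqr_le_add h k : star h = h -> star k = k -> h * k = k * h ->
  nrm (h * h) <= nrm (h * h + k * k).
Proof.
move=> sh sk hk; pose z : R[i] := 0 +i* 1; pose w := h + z *: k.
have zz : z * z = -1 by rewrite /z; simpc.
have sw : star w = h - z *: k.
  rewrite starD starZ sh sk -scaleNr; congr (_ + _ *: _).
  by rewrite /z; simpc.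
have -> : h * h + k * k = star w * w.
  rewrite sw /w mulrDr !mulrBl scalerMM zz -!scalerAl -!scalerAr hk.
  by rewrite scaleN1r opprK addrA addrNK.
rewrite nrm_starM nrm_sa_sqr// lerXn2r ?nnegrE ?nrm_ge0//.
have : nrm (w + star w) <= nrm w + nrm w by rewrite -{2}[nrm w]nrm_star nrmD.
rewrite sw {1 2}/w addrACA subrr addr0 addr_scale2 nrmZp//; lra.
Qed.

(** Squares of self-adjoint elements. That every [star b * b] is one of them is the later theorem
    [psd_starM], whose proof rests on the properties of this cone. *)
Definition psd h := exists2 s, star s = s & h = s * s.

Lemma psd_sqr s : star s = s -> psd (s * s). Proof. by exists s. Qed.

Lemma psd_sa h : psd h -> star h = h.
Proof. by move=> [s ss ->]; rewrite starM ss. Qed.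

Lemma psd0 : psd 0. Proof. by exists 0; rewrite ?star0 ?mul0r. Qed.

Lemma psdZ r h : 0 <= r -> psd h -> psd (r%:C *: h).
Proof.
move=> r0 [s ss ->]; exists ((Num.sqrt r)%:C *: s); first by rewrite starZr ss.
by rewrite scaleRMM sqrtrM_self.
Qed.

Lemma psd1 : psd 1. Proof. by exists 1; rewrite ?star1 ?mul1r. Qed.

Lemma psdr r : 0 <= r -> psd (r%:C%:A).
Proof. by move=> r0; apply: psdZ => //; exact: psd1. Qed.

(** For t = s / M^(1/2) and a root k of 1 - t^2 commuting with t, |k^2| <= |k^2 + t^2| = 1. With the
    converse [dist_psd], positivity becomes a condition on the norm, and sums and limits of positive
    elements are seen to be positive. *)
Lemma psd_dist h M : psd h -> nrm h <= M -> nrm (M%:C%:A - h) <= M.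
Proof.
move=> [s ss ->] hM.
have : 0 <= M by rewrite (le_trans (nrm_ge0 _) hM).
rewrite le_eqVlt => /predU1P[M0|M0].
  rewrite -M0 in hM *; have /nrm_eq0 -> : nrm (s * s) = 0.
    by apply/eqP; rewrite eq_le hM nrm_ge0.
  by rewrite scale0r subr0 nrm0.
pose t := (Num.sqrt M)^-1%:C *: s.
have st : star t = t by rewrite starZr ss.
have sM : (Num.sqrt M)^-1 * (Num.sqrt M)^-1 = M^-1.
  by rewrite -invfM sqrtrM_self ?ltW.
have tt : t * t = M^-1%:C *: (s * s) by rewrite scaleRMM sM.
have stt : star (t * t) = t * t by rewrite starM st.
have tt1 : nrm (t * t) <= 1.
  by rewrite tt nrmZp ?invr_ge0 ?(ltW M0)// ler_pdivrMl// mulr1.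
have [k [sk kk kc]] := sqrt_one_sub stt tt1.
have := @nrm_sqr_le_add k t sk st (esym (kc t (mulrA t t t))).
rewrite kk subrK nrm1 => h1.
have -> : M%:C%:A - s * s = M%:C *: (1 - t * t).
  by rewrite scalerBr tt scaleRA mulfV ?gt_eqF// scale1r.
by rewrite nrmZp ?(ltW M0)// ger_pMr.
Qed.

(** h / M = 1 - x where x = 1 - h / M has norm at most 1, so [sqrt_one_sub] provides the root. *)
Lemma dist_psd h M : star h = h -> nrm (M%:C%:A - h) <= M ->
  exists s, [/\ star s = s, h = s * s & forall c, c * h = h * c -> c * s = s * c].
Proof.
move=> sh hM.
have : 0 <= M by rewrite (le_trans (nrm_ge0 _) hM).
rewrite le_eqVlt => /predU1P[M0|M0].
  rewrite -M0 scale0r sub0r in hM; exists 0; split; first exact: star0.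
    rewrite mul0r; apply: nrm_eq0; apply/eqP.
    by rewrite eq_le nrm_ge0 -nrmN hM.
  by move=> c _; rewrite mulr0 mul0r.
pose x := 1 - M^-1%:C *: h.
have sx : star x = x by rewrite starB star1 starZr sh.
have xe : x = M^-1%:C *: (M%:C%:A - h).
  by rewrite scalerBr scaleRA mulVf ?gt_eqF// scale1r.
have x1 : nrm x <= 1.
  by rewrite xe nrmZp ?invr_ge0 ?(ltW M0)// ler_pdivrMl// mulr1.
have [k [sk kk kc]] := sqrt_one_sub sx x1.
exists ((Num.sqrt M)%:C *: k); split; first by rewrite starZr sk.
  rewrite scaleRMM sqrtrM_self ?(ltW M0)// kk /x opprB addrC addrNK.
  by rewrite scaleRA mulfV ?gt_eqF// scale1r.
move=> c ch; rewrite -scalerAr -scalerAl kc// /x mulrBr mulrBl mulr1 mul1r.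
by rewrite -scalerAr ch -scalerAl.
Qed.

Lemma psd_sqrt h : psd h ->
  exists s, [/\ star s = s, h = s * s & forall c, c * h = h * c -> c * s = s * c].
Proof. by move=> ph; exact: dist_psd (psd_sa ph) (psd_dist ph (lexx _)). Qed.

Lemma dist_is_psd h M : star h = h -> nrm (M%:C%:A - h) <= M -> psd h.
Proof. by move=> sh /(dist_psd sh)[s [ss hs _]]; exists s. Qed.

Lemma psdD h k : psd h -> psd k -> psd (h + k).
Proof.
move=> ph pk; apply: (@dist_is_psd _ (nrm h + nrm k)).
  by rewrite starD (psd_sa ph) (psd_sa pk).
rewrite rmorphD/= scalerDl opprD addrACA (le_trans (nrmD _ _))//.
by rewrite lerD// psd_dist.
Qed.

Lemma psd_sum (I : Type) (s : seq I) (P : pred I) (F : I -> A) :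
  (forall i, P i -> psd (F i)) -> psd (\sum_(i <- s | P i) F i).
Proof. by move=> h; elim/big_rec: _ => [|i x Pi hx]; [exact: psd0|apply: psdD => //; exact: h]. Qed.

Lemma psd_clim : clim psd.
Proof.
move=> l hl.
have sl : star l = l.
  apply/eqP; rewrite -subr_eq0; apply/eqP/nrm_eq0/eqP; rewrite eq_le nrm_ge0 andbT.
  apply/ler_addgt0Pl => e e0; rewrite addr0.
  have [s ps hs] := hl (e / 2) (divr_gt0 e0 (ltr0Sn _ _)).
  have -> : star l - l = star (l - s) - (l - s).
    by rewrite starB (psd_sa ps) opprB addrA addrNK.
  by rewrite (le_trans (nrmB _ _))// nrm_star [leRHS]splitr lerD// ltW.
(* The radius [nrm l + 1] bounds the norm of every approximant at distance less than 1 from l. *)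
apply: (@dist_is_psd _ (nrm l + 1)) => //.
apply/ler_addgt0Pl => e e0.
have m0 : 0 < Num.min e 1 by rewrite lt_min e0 ltr01.
have [s ps] := hl _ m0; rewrite lt_min => /andP[hs hs1].
rewrite [leRHS]addrC (le_trans (nrm_dist _ ((nrm l + 1)%:C%:A - s)))// lerD//.
  apply: psd_dist => //; rewrite (le_trans (nrm_dist _ l))// lerD2l.
  by rewrite nrmBC ltW.
by rewrite subr_sub2 nrmBC ltW.
Qed.

Lemma psd_sqrt_le M h : star h = h -> nrm h <= M -> psd (M%:C%:A - h).
Proof.
move=> sh hM; apply: (@dist_is_psd _ M).
  by rewrite starB sh starZr star1.
by rewrite opprB addrC addrNK.
Qed.

Lemma psdM_comm h k : psd h -> psd k -> h * k = k * h -> psd (h * k).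
Proof.
move=> /psd_sqrt[s [ss -> sc]] /psd_sqrt[t [st -> tc]] hk.
have sk : s * (t * t) = t * t * s by rewrite sc.
have ts : s * t = t * s by exact: tc.
exists (s * t); first by rewrite starM ss st ts.
by rewrite -!mulrA; congr (s * _); rewrite !mulrA ts.
Qed.

(** If r < 0, then r = s^2 and - r = t^2 with s and t commuting; as s^2 + t^2 = 0, [nrm_sqr_le_add]
    forces t^2 = 0. *)
Lemma psd_real r : psd (r%:C%:A) -> 0 <= r.
Proof.
move=> [s ss rs]; rewrite leNgt; apply/negP => r0.
have p1 : psd ((- r)%:C%:A) by apply: psdr; rewrite oppr_ge0 ltW.
have [t [st te tc]] := psd_sqrt p1.
have ct : s * t = t * s by rewrite tc// -scalerAr -scalerAl mulr1 mul1r.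
have := nrm_sqr_le_add st ss (esym ct).
rewrite -te -rs -scalerDl -rmorphD/= addNr scale0r nrm0 nrm_one_scale normrN.
by rewrite normr_le0 => /eqP r00; rewrite r00 ltxx in r0.
Qed.

(** The roots s of h and t of M - h commute, so |s^2| <= |s^2 + t^2| = M. *)
Lemma psd_nrm_le M h : psd h -> psd (M%:C%:A - h) -> nrm h <= M.
Proof.
move=> ph pk.
have M0 : 0 <= M by apply: psd_real; rewrite -[X in psd X](subrK h); exact: psdD.
have [s [ss hs _]] := psd_sqrt ph; have [t [st te tc]] := psd_sqrt pk.
have ct : s * t = t * s.
  apply: tc; rewrite mulrBr mulrBl -scalerAr -scalerAl mulr1 mul1r.
  by congr (_ - _); rewrite hs mulrA.
have := nrm_sqr_le_add ss st ct.
by rewrite -te -hs addrC subrK nrm_one_scale ger0_norm.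
Qed.

Lemma psd_trans k h l : psd (k - h) -> psd (l - k) -> psd (l - h).
Proof.
move=> p1 p2; have -> : l - h = (l - k) + (k - h) by rewrite addrA addrNK.
exact: psdD.
Qed.

Lemma psd_mono h k : psd h -> psd (k - h) -> nrm h <= nrm k.
Proof.
move=> ph pk; have pk0 : psd k by rewrite -[k](subrK h); exact: psdD.
apply: psd_nrm_le => //; apply: psd_trans pk _.
by apply: psd_sqrt_le => //; exact: psd_sa.
Qed.

End Positive.

Lemma mulDB_comm (T : pzRingType) (x y : T) : x * y = y * x ->
  (x + y) * (x - y) = x * x - y * y /\ (x - y) * (x + y) = x * x - y * y.
Proof.
move=> xy; split; first by rewrite mulrBr !mulrDl xy addrKA.
by rewrite mulrBl !mulrDr xy addrKA.
Qed.

(** * Spectrum *)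

Section Spectrum.
Variables (R : realType) (A : cstarAlgType R).
Implicit Types (a b c h k s x y : A) (r M : R).

Definition ainv x := exists y, y * x = 1 /\ x * y = 1.

Lemma ainv_lr l x x' : l * x = 1 -> x * x' = 1 -> ainv x.
Proof.
move=> lx xr; exists l; split => //.
by have -> : l = x' by rewrite -[l]mulr1 -xr mulrA lx mul1r.
Qed.

Lemma ainvM x y : ainv x -> ainv y -> ainv (x * y).
Proof.
move=> [x' [h1 h2]] [y' [h3 h4]]; exists (y' * x'); split.
  by rewrite mulrA -[y' * x' * x]mulrA h1 mulr1.
by rewrite mulrA -[x * y * y']mulrA h4 mulr1.
Qed.

Lemma ainv_fst x y : x * y = y * x -> ainv (x * y) -> ainv x.
Proof.
move=> xy [z [h1 h2]]; apply: (@ainv_lr (z * y) x (y * z)).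
  by rewrite -mulrA -xy.
by rewrite mulrA.
Qed.

Lemma ainvN x : ainv x -> ainv (- x).
Proof. by move=> [y [h1 h2]]; exists (- y); rewrite !mulrNN. Qed.

Lemma ainvZ (z : R[i]) x : z != 0 -> ainv x -> ainv (z *: x).
Proof.
move=> z0 [y [h1 h2]]; exists (z^-1 *: y).
by rewrite !scalerMM h1 h2 mulVf// mulfV// scale1r.
Qed.

Lemma neumann x : nrm x < 1 -> ainv (1 - x).
Proof.
move=> x1; pose q := nrm x; have q0 : 0 <= q by exact: nrm_ge0.
have q1 : 0 < 1 - q by rewrite subr_gt0.
have nX n : nrm (x ^+ n) <= q ^+ n.
  elim: n => [|n IH]; first by rewrite nrm1.
  by rewrite !exprS (le_trans (nrmM _ _))// ler_wpM2l.
pose S n := \sum_(i < n) x ^+ i.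
have Sd (n k : nat) : nrm (S (n + k)%N - S n) <= q ^+ n / (1 - q) * (1 - q ^+ k).
  elim: k => [|k IH]; first by rewrite addn0 subrr nrm0 expr0 subrr mulr0.
  rewrite addnS /S big_ord_recr /= -/(S _) addrAC (le_trans (nrmD _ _))//.
  apply: (le_trans (lerD IH (nX _))).
  rewrite le_eqVlt; apply/orP; left; apply/eqP.
  by rewrite exprD exprS; field; rewrite gt_eqF.
have qn e : 0 < e -> exists n0, forall n, (n0 <= n)%N -> q ^+ n <= e.
  move=> e0; have /cvgrPdist_le/(_ _ e0)[n0 _ h] : (q ^+ n @[n --> \oo] --> 0).
    by apply: cvg_expr; rewrite ger0_norm// -subr_gt0.
  by exists n0 => n /h; rewrite sub0r normrN ger0_norm// exprn_ge0.
have [l hl] : exists l, ncvg (@nrm R A) S l.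
  apply: ncauchy_nrm_cvg => e e0.
  have [n0 h0] := qn _ (mulr_gt0 e0 q1); exists n0.
  have key m n : (n0 <= n)%N -> (n <= m)%N -> nrm (S m - S n) <= e.
    move=> hn /subnKC <-; apply: (le_trans (Sd _ _)).
    have /h0 := hn; rewrite -ler_pdivrMr// => h1; apply: le_trans h1.
    rewrite ler_piMr// ?divr_ge0 ?exprn_ge0//; first exact: ltW.
    by rewrite gerBl exprn_ge0.
  move=> m n hm hn; case/orP: (leq_total n m) => h; first exact: key.
  by rewrite nrmBC; apply: key.
have cS (n : nat) : (1 - x) * S n = 1 - x ^+ n by rewrite /S -[1 - x]opprB mulNr -subrX1 opprB.
have Sc (n : nat) : S n * (1 - x) = 1 - x ^+ n.
  by rewrite -cS; apply/commrB; [exact: commr1|apply/commr_sym/commr_sum => i _; exact: commrX].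
have l1 : ncvg (@nrm R A) (fun n => 1 - x ^+ n) 1.
  move=> e /qn[n0 h]; exists n0 => n /h; apply: le_trans.
  by rewrite addrAC subrr sub0r nrmN.
exists l; split; apply: ncvgA_unique l1.
  by have := ncvgMr (1 - x) hl; rewrite (_ : (fun n => _) = (fun n => 1 - x ^+ n))//; apply/funext.
by have := ncvgMl (1 - x) hl; rewrite (_ : (fun n => _) = (fun n => 1 - x ^+ n))//; apply/funext.
Qed.

Lemma oner_scale_comm (z : R[i]) x : z%:A * x = x * z%:A.
Proof. by rewrite -scalerAl -scalerAr mul1r mulr1. Qed.

(** h = M (1 - (M - h) / M) with |M - h| <= M - r < M, a case of the Neumann series. *)
Lemma psd_ge_ainv h r : 0 < r -> psd (h - r%:C%:A) -> ainv h.
Proof.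
move=> r0 hr.
have ph : psd h by rewrite -[h](subrK r%:C%:A); apply: psdD => //; apply/psdr/ltW.
pose M := nrm h + r.
have M0 : 0 < M by rewrite ltr_wpDl ?nrm_ge0.
have pM : psd (M%:C%:A - h).
  by apply: psd_sqrt_le; [exact: psd_sa|rewrite lerDl ltW].
have nM : nrm (M%:C%:A - h) <= M - r.
  apply: psd_nrm_le => //; rewrite rmorphB/= scalerBl.
  by rewrite subr_sub2.
have -> : h = M%:C *: (1 - M^-1%:C *: (M%:C%:A - h)).
  rewrite [in RHS]scalerBr scaleRA mulfV ?gt_eqF// scale1r.
  by rewrite opprB addrC addrNK.
apply: ainvZ; first by rewrite eq_complex /= gt_eqF.
apply: neumann; rewrite nrmZp ?invr_ge0 ?(ltW M0)// ltr_pdivrMl// mulr1.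
by rewrite (le_lt_trans nM)// gtrBl.
Qed.

(** If g is the inverse of h, then h - 1/|g| = (|g| - g) h / |g|, a product of commuting positive
    elements. *)
Lemma psd_ainv_ge h : psd h -> ainv h -> exists2 r, 0 < r & psd (h - r%:C%:A).
Proof.
move=> ph [g [gh hg]]; have sh := psd_sa ph.
have sg : star g = g.
  have h1 : star g * h = 1 by rewrite -{1}sh -starM hg star1.
  by rewrite -[LHS]mulr1 -hg mulrA h1 mul1r.
have g0 : 0 < nrm g.
  rewrite lt_neqAle nrm_ge0 andbT eq_sym; apply/eqP => /nrm_eq0 g0.
  by move/eqP: gh; rewrite g0 mul0r eq_sym oner_eq0.
exists (nrm g)^-1; first by rewrite invr_gt0.
have p1 : psd ((nrm g)%:C%:A - g) by exact: psd_sqrt_le.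
have -> : h - (nrm g)^-1%:C%:A = (nrm g)^-1%:C *: (((nrm g)%:C%:A - g) * h).
  rewrite mulrBl gh scalerBr -scalerAl mul1r scaleRA mulVf ?gt_eqF//.
  by rewrite scale1r.
apply: psdZ; first by rewrite invr_ge0 ltW.
by apply: psdM_comm => //; rewrite mulrBl mulrBr gh hg oner_scale_comm.
Qed.

(** If neither sign of M = |b| were in the spectrum, M^2 - b^2 would be invertible and positive,
    hence at least some r > 0, and |b^2| <= M^2 - r. *)
Lemma spectrum_nrm b : star b = b ->
  spectrum b (nrm b)%:C \/ spectrum b (- nrm b)%:C.
Proof.
move=> sb; set M := nrm b; apply: contrapT => /not_orP[/contrapT i1 /contrapT i2].
have hh : (M%:C%:A - b) * (M%:C%:A + b) = (M ^+ 2)%:C%:A - b * b.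
  have [_ ->] := mulDB_comm (oner_scale_comm M%:C b).
  by rewrite scaleRMM mulr1 expr2.
have ic : ainv ((M ^+ 2)%:C%:A - b * b).
  rewrite -hh; apply: ainvM => //.
  by have := ainvN i2; rewrite opprB rmorphN/= scaleNr opprK addrC.
have pc : psd ((M ^+ 2)%:C%:A - b * b).
  apply: psd_sqrt_le; first by rewrite starM sb.
  by rewrite nrm_sa_sqr.
have [r r0] := psd_ainv_ge pc ic; rewrite addrAC -scalerBl -rmorphB/=.
move=> /(psd_nrm_le (psd_sqr sb)); rewrite nrm_sa_sqr// -/M.
by rewrite lerBrDr gerDl leNgt r0.
Qed.

(** If v <> 0, then with s = u - a one has (s + iv)(s - iv) = s^2 + v^2 >= v^2 > 0, which is
    invertible; hence so is the factor s + iv. *)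
Lemma spectrum_sa_real a (z : R[i]) : star a = a -> spectrum a z ->
  z = (complex.Re z)%:C.
Proof.
case: z => u v sa hz; rewrite /=; suff -> : v = 0 by [].
apply/eqP; apply: contrapT => /negP v0; apply: hz.
pose s := u%:C%:A - a; pose w : R[i] := 0 +i* v.
have ss : star s = s by rewrite starB sa starZr star1.
have -> : (u +i* v)%:A - a = s + w%:A.
  rewrite /s addrAC -scalerDl; congr (_ *: _ - _).
  by rewrite /w; simpc.
have ww : s * s - w%:A * w%:A = s * s + (v ^+ 2)%:C%:A.
  rewrite scalerMM mulr1 -scaleNr; congr (_ + _ *: _).
  by rewrite /w expr2; simpc.
have [e1 e2] := mulDB_comm (esym (oner_scale_comm w s)).
apply: (@ainv_fst _ (s - w%:A)); first by rewrite e1 e2.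
rewrite e1 ww; apply: (@psd_ge_ainv _ (v ^+ 2)); first by rewrite exprn_even_gt0.
by rewrite addrK; exact: psd_sqr.
Qed.

Lemma spectrum_psd_ge0 a r : psd a -> spectrum a r%:C -> 0 <= r.
Proof.
move=> pa hr; rewrite leNgt; apply/negP => r0; apply: hr.
rewrite -opprB; apply/ainvN/(@psd_ge_ainv _ (- r)); first by rewrite oppr_gt0.
by rewrite rmorphN scaleNr opprK addrNK.
Qed.

Lemma spectrum_psd_nrm a : psd a -> spectrum a (nrm a)%:C.
Proof.
move=> pa; have [//|h] := spectrum_nrm (psd_sa pa).
have := spectrum_psd_ge0 pa h; rewrite oppr_ge0 => h1.
have a0 : nrm a = 0 by apply/eqP; rewrite eq_le nrm_ge0 h1.
by move: h; rewrite a0 oppr0.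
Qed.

End Spectrum.

(** * Polynomial approximation *)

Section Bernstein.
Variable R : realType.
Implicit Types (f g : R -> R) (a b c d e s t M : R) (n k : nat).

(* The expectation of g(K), K binomial of parameters n and 'X. *)
Fixpoint bern n (g : nat -> R) : {poly R} :=
  if n is m.+1 then (1 - 'X) * bern m g + 'X * bern m (fun k => g k.+1)
  else (g 0)%:P.

Lemma bernS n (g : nat -> R) t : (bern n.+1 g).[t] =
  (1 - t) * (bern n g).[t] + t * (bern n (fun k => g k.+1)).[t].
Proof. by rewrite /= hornerD !hornerM hornerD hornerN !hornerX hornerC. Qed.

Lemma bern_le n (g h : nat -> R) t : 0 <= t <= 1 ->
  (forall k, (k <= n)%N -> g k <= h k) -> (bern n g).[t] <= (bern n h).[t].
Proof.
move=> /andP[t0 t1]; elim: n g h => [|n IH] g h gh; first by rewrite !hornerC gh.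
rewrite !bernS lerD// ler_wpM2l ?subr_ge0// IH// => k kn; apply: gh => //.
exact: leqW.
Qed.

Lemma bernD n (g h : nat -> R) t :
  (bern n (fun k => g k + h k)).[t] = (bern n g).[t] + (bern n h).[t].
Proof.
elim: n g h => [|n IH] g h; first by rewrite !hornerC.
by rewrite !bernS !IH; ring.
Qed.

Lemma bernZ n c (g : nat -> R) t :
  (bern n (fun k => c * g k)).[t] = c * (bern n g).[t].
Proof.
elim: n g => [|n IH] g; first by rewrite !hornerC.
by rewrite !bernS !IH; ring.
Qed.

Lemma bern_const n c t : (bern n (fun=> c)).[t] = c.
Proof. by elim: n => [|n IH]; [exact: hornerC|rewrite bernS !IH; ring]. Qed.

(** The variance of the binomial law. The shift c is general because the recursion replaces c by 1 +
    c. *)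
Lemma bern_sqr n c t :
  (bern n (fun k => (k%:R + c) ^+ 2)).[t] = n%:R * t * (1 - t) + (n%:R * t + c) ^+ 2.
Proof.
elim: n c => [|n IH] c; first by rewrite /= hornerC; ring.
rewrite bernS IH.
rewrite (_ : (fun k => _) = (fun k => (k%:R + (1 + c)) ^+ 2)); last first.
  by apply/funext => k; rewrite -natr1 addrA.
by rewrite IH -[n.+1%:R]natr1; ring.
Qed.

Lemma unif_cont_segment f a b e : continuous f -> 0 < e ->
  exists2 d : R, 0 < d & forall s t, a <= s <= b -> `|s - t| < d -> `|f s - f t| <= e.
Proof.
move=> cf e0.
have /compact_near_coveringP/near_covering_withinP := @segment_compact R a b.
move=> /(_ _ \oo (fun n s => forall t, `|s - t| < n.+1%:R^-1 -> `|f s - f t| <= e)).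
case.
  move=> x _; have e20 : 0 < e / 2 by rewrite divr_gt0.
  have /cvgrPdist_le/(_ _ e20)/nbhs_ballP[d /= d0 hd] := cf x.
  have d20 : 0 < d / 2 by rewrite divr_gt0.
  have [n0 hn0] := @inv_nat_small R 1 _ d20.
  exists (ball x (d / 2), [set n | (n0 <= n)%N]).
    by split; [exact: nbhsx_ballx|exists n0].
  move=> [s n] [/= xs nn] _ t st.
  have h1 : `|f x - f s| <= e / 2.
    by apply: hd; apply: le_ball xs; rewrite ler_pdivrMr// ler_peMr ?ler1n// ltW.
  have h2 : `|f x - f t| <= e / 2.
    apply: hd; rewrite /ball/= -(subrK s x) -addrA (le_lt_trans (ler_normD _ _))//.
    rewrite [ltRHS]splitr ltr_leD//; apply: (le_trans (ltW st)).
    by have := hn0 n nn; rewrite div1r.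
  rewrite -(subrK (f x) (f s)) -addrA (le_trans (ler_normD _ _))//.
  by rewrite [leRHS]splitr lerD// distrC.
move=> n _ /(_ n (leqnn n)) h; exists n.+1%:R^-1; first by rewrite invr_gt0.
by move=> s t sab; apply: h; rewrite /= in_itv.
Qed.

Lemma bounded_segment f a b : continuous f ->
  exists2 C : R, 0 <= C & forall t, a <= t <= b -> `|f t| <= C.
Proof.
move=> cf; have /compact_bounded[M [_ hM]] : compact (f @` `[a, b]).
  by apply: continuous_compact (@segment_compact _ a b); exact: continuous_subspaceT.
exists (`|M| + 1); first by rewrite addr_ge0.
move=> t tab; apply: (hM (`|M| + 1)); first by rewrite (le_lt_trans (ler_norm M))// ltrDl.
by exists t => //=; rewrite in_itv.
Qed.

(** Bernstein's proof: uniform continuity for |s - t| < d and the bound 2 C otherwise combine into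
    |f s - f t| <= e/2 + (2 C / d^2) (s - t)^2, and the binomial mean of the square is at most
    1/n. *)
Lemma weierstrass01 f e : continuous f -> 0 < e ->
  exists p : {poly R}, forall t, 0 <= t <= 1 -> `|p.[t] - f t| <= e.
Proof.
move=> cf e0; have e20 : 0 < e / 2 by rewrite divr_gt0.
have [d d0 hd] := unif_cont_segment 0 1 cf e20.
have [C C0 hC] := bounded_segment 0 1 cf.
pose K := (C + C) / d ^+ 2.
have K0 : 0 <= K by rewrite divr_ge0 ?addr_ge0// exprn_ge0// ltW.
have key s t : 0 <= s <= 1 -> 0 <= t <= 1 -> `|f s - f t| <= e / 2 + K * (s - t) ^+ 2.
  move=> s01 t01; have [st|st] := ltP `|s - t| d.
    by rewrite (le_trans (hd s t s01 st))// lerDl mulr_ge0// sqr_ge0.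
  rewrite (le_trans (ler_normB _ _))// (le_trans (lerD (hC _ s01) (hC _ t01)))//.
  rewrite -[leLHS]add0r lerD ?(ltW e20)// /K mulrAC ler_pdivlMr ?exprn_gt0//.
  rewrite ler_wpM2l ?addr_ge0// -[leRHS]real_normK ?num_real//.
  by rewrite lerXn2r ?nnegrE// ltW.
have [n hn] := @inv_nat_small R K _ e20; have {}hn := hn n (leqnn n).
have n0 : 0 < n.+1%:R :> R by rewrite ltr0Sn.
exists (bern n.+1 (fun k => f (k%:R / n.+1%:R))) => t t01.
have k01 k : (k <= n.+1)%N -> 0 <= (k%:R / n.+1%:R : R) <= 1.
  by move=> kn; rewrite divr_ge0//= ler_pdivrMr// mul1r ler_nat.
pose Q k : R := e / 2 + K / n.+1%:R ^+ 2 * (k%:R - n.+1%:R * t) ^+ 2.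
have QE k : Q k = e / 2 + K * (k%:R / n.+1%:R - t) ^+ 2.
  by rewrite /Q; congr (_ + _); field; rewrite gt_eqF.
have bQ : (bern n.+1 Q).[t] <= e.
  rewrite bernD bern_const bernZ bern_sqr subrr expr0n addr0.
  rewrite [leRHS]splitr lerD2l; apply: (le_trans _ hn).
  have -> : K / n.+1%:R ^+ 2 * (n.+1%:R * t * (1 - t)) = K / n.+1%:R * (t * (1 - t)).
    by field; rewrite gt_eqF.
  have /andP[t0 t1] := t01.
  apply: ler_piMr; first by apply: divr_ge0 => //; exact: ltW.
  by apply: mulr_ile1; rewrite ?subr_ge0// gerBl.
have up : (bern n.+1 (fun k => f (k%:R / n.+1%:R))).[t] <= f t + (bern n.+1 Q).[t].
  rewrite -(bern_const n.+1 (f t) t) -bernD; apply: bern_le => // k /k01 kk.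
  by rewrite QE -lerBlDl (le_trans (ler_norm _))//; exact: key.
have lo : f t <= (bern n.+1 (fun k => f (k%:R / n.+1%:R))).[t] + (bern n.+1 Q).[t].
  rewrite -(bern_const n.+1 (f t) t) -bernD; apply: bern_le => // k /k01 kk.
  by rewrite QE -lerBlDl (le_trans (ler_norm _))// distrC; exact: key.
rewrite ler_norml; apply/andP; split.
  by rewrite lerBrDl lerBlDr (le_trans lo)// lerD2l.
by rewrite lerBlDl (le_trans up)// lerD2l.
Qed.

Lemma weierstrass f M e : continuous f -> 0 < e -> 0 <= M ->
  exists p : {poly R}, forall t, `|t| <= M -> `|p.[t] - f t| <= e.
Proof.
move=> cf e0 M0; pose L := M + 1.
have L0 : 0 < L by rewrite ltr_wpDl.
have cg : continuous (fun s : R => f ((2 * s - 1) * L)).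
  move=> s; apply: (@continuous_comp _ _ _ (fun s : R => (2 * s - 1) * L) f); last exact: cf.
  apply: cvgM; last exact: cvg_cst.
  by apply: cvgB; [apply: cvgM; [exact: cvg_cst|exact: cvg_id]|exact: cvg_cst].
have [p hp] := weierstrass01 cg e0.
exists (p \Po ((2 * L)^-1 *: 'X + (2^-1)%:P)) => t tM.
rewrite horner_comp !hornerE.
set s := (X in p.[X]).
have -> : t = (2 * s - 1) * L by rewrite /s; field; rewrite gt_eqF.
apply: hp; rewrite /s.
have : `|t| <= L by rewrite (le_trans tM)// lerDl.
rewrite ler_norml => /andP[h1 h2]; apply/andP; split.
  have -> : (2 * L)^-1 * t + 2^-1 = (2 * L)^-1 * (t + L) by field; rewrite gt_eqF.
  by rewrite mulr_ge0 ?invr_ge0 ?mulr_ge0 ?(ltW L0)//; lra.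
rewrite -lerBrDr (_ : 1 - 2^-1 = (2 * L)^-1 * L); last by field; rewrite gt_eqF.
by rewrite ler_wpM2l// invr_ge0 mulr_ge0// ltW.
Qed.

End Bernstein.

(** * Continuous functional calculus *)

Section FunctionalCalculus.
Variables (R : realType) (A : cstarAlgType R).
Implicit Types (a b c h k : A) (e r t M : R) (f g : R -> R) (p q : {poly R}).

Definition pev p a : A := horner_alg a (map_poly (fun t : R => t%:C) p).

Lemma pevE p a : pev p a = horner_alg a (map_poly (real_complex R) p).
Proof. by []. Qed.

Lemma pevD p q a : pev (p + q) a = pev p a + pev q a.
Proof. by rewrite !pevE !rmorphD. Qed.

Lemma pevB p q a : pev (p - q) a = pev p a - pev q a.
Proof. by rewrite !pevE !rmorphB. Qed.

Lemma pevM p q a : pev (p * q) a = pev p a * pev q a.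
Proof. by rewrite !pevE !rmorphM. Qed.

Lemma pevC r a : pev r%:P a = r%:C%:A.
Proof. by rewrite pevE map_polyC horner_algC. Qed.

Lemma pevX a : pev 'X a = a.
Proof. by rewrite pevE map_polyX horner_algX. Qed.

Lemma pev_ind (P : A -> Prop) a : (forall r, P (r%:C%:A)) ->
  (forall b r, P b -> P (b * a + r%:C%:A)) -> forall p, P (pev p a).
Proof.
move=> hC hS; elim/poly_ind => [|p r IH]; last by rewrite pevD pevM pevX pevC; exact: hS.
by have := hC 0; rewrite -(pevC 0 a).
Qed.

Lemma pev_comm c a p : c * a = a * c -> c * pev p a = pev p a * c.
Proof.
move=> ca; apply: (@pev_ind (fun b => c * b = b * c)) => [r|b r IH].
  by rewrite oner_scale_comm.
by rewrite mulrDr mulrDl oner_scale_comm mulrA IH -!mulrA ca.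
Qed.

Lemma pev_sa a p : star a = a -> star (pev p a) = pev p a.
Proof.
move=> sa; elim/poly_ind: p => [|p r IH].
  by rewrite -[0]/(0%:P) pevC starZr star1.
rewrite pevD pevM pevX pevC starD starM starZr star1 sa IH.
by rewrite (@pev_comm a a).
Qed.

(** q splits over the complex numbers; if no root were in the spectrum, every factor would be
    invertible and so would the product. *)
Lemma spectrum_horner_alg a (q : {poly R[i]}) : q != 0 ->
  ~ ainv (horner_alg a q) -> exists2 z, root q z & spectrum a z.
Proof.
move=> q0 hq; have [s qs] := closed_field_poly_normal q.
apply: contrapT => hn; apply: hq.
have lq : lead_coef q != 0 by rewrite lead_coef_eq0.
rewrite qs -mul_polyC rmorphM/= horner_algC; apply: ainvM.
  by apply: ainvZ => //; exists 1; rewrite mulr1.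
have hs z : z \in s -> root q z.
  by rewrite qs rootZ// root_prod_XsubC.
elim: s hs {qs} => [|z s IH] hs.
  by rewrite big_nil rmorph1; exists 1; rewrite mulr1.
rewrite big_cons rmorphM; apply: ainvM; last first.
  by apply: IH => w ws; apply: hs; rewrite inE ws orbT.
rewrite rmorphB/= horner_algX horner_algC -opprB; apply: ainvN.
by apply: contrapT => h; apply: hn; exists z => //; apply: hs; rewrite inE eqxx.
Qed.

Lemma spectrum_pev a p r : star a = a -> spectrum (pev p a) r%:C ->
  exists2 t, spectrum a t%:C & p.[t] = r.
Proof.
move=> sa hr; pose q := map_poly (real_complex R) (p - r%:P).
have hq : ~ ainv (horner_alg a q).
  rewrite -[horner_alg a q]/(pev (p - r%:P) a) pevB pevC => /ainvN.
  by rewrite opprB; exact: hr.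
have [q0|q0] := eqVneq q 0; last first.
  have [z rz sz] := spectrum_horner_alg q0 hq.
  have ze := spectrum_sa_real sa sz; exists (complex.Re z); first by rewrite -ze.
  move: rz; rewrite ze /q /root horner_map /= fmorph_eq0 !hornerE subr_eq0.
  by move=> /eqP.
(* Here p is the constant r, and any point of the spectrum serves; [spectrum_nrm] supplies one. *)
have /eqP : p - r%:P = 0 by apply/eqP; rewrite -(map_poly_eq0 (real_complex R)) -/q q0.
rewrite subr_eq0 => /eqP ->.
have [h|h] := spectrum_nrm sa; [exists (nrm a)|exists (- nrm a)] => //; exact: hornerC.
Qed.

Lemma spectrum_le a r : spectrum a r%:C -> `|r| <= nrm a.
Proof.
move=> hr; rewrite leNgt; apply/negP => ar; apply: hr.
have r0 : r != 0.
  by apply: contraTneq ar => ->; rewrite normr0 -leNgt nrm_ge0.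
have -> : r%:C%:A - a = r%:C *: (1 - r^-1%:C *: a).
  by rewrite scalerBr scaleRA mulfV// scale1r.
apply: ainvZ; first by rewrite eq_complex /= eqxx andbT.
apply: neumann; rewrite nrmZr normfV ltr_pdivrMl ?normr_gt0//.
by rewrite mulr1.
Qed.

(** Up to sign the norm of the self-adjoint p(a) is in its spectrum, hence a value of p on the
    spectrum of a. *)
Lemma pev_nrm_le a p M : star a = a ->
  (forall t, spectrum a t%:C -> `|p.[t]| <= M) -> nrm (pev p a) <= M.
Proof.
move=> sa hM; have [] := spectrum_nrm (pev_sa p sa).
  by move=> /(spectrum_pev sa)[t /hM ht <-]; rewrite (le_trans (ler_norm _)).
by move=> /(spectrum_pev sa)[t /hM ht pt]; rewrite -[nrm _]opprK -pt (le_trans _ ht)// -normrN ler_norm.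
Qed.

(** The property by which [cfc f a] is selected; existence and uniqueness below show that the choice
    is determined. *)
Definition is_cfc f a b := forall e, 0 < e -> exists p,
  (forall t, spectrum a t%:C -> `|p.[t] - f t| <= e) /\ nrm (pev p a - b) <= e.

Lemma is_cfc_nrmB f g a b c M : star a = a -> is_cfc f a b -> is_cfc g a c ->
  (forall t, spectrum a t%:C -> `|f t - g t| <= M) -> nrm (b - c) <= M.
Proof.
move=> sa hf hg hM; apply/ler_addgt0Pr => e e0.
have e40 : 0 < e / 4 by rewrite divr_gt0.
have [p [p1 p2]] := hf _ e40; have [q [q1 q2]] := hg _ e40.
have pq : nrm (pev (p - q) a) <= M + e / 2.
  apply: pev_nrm_le => // t ht; rewrite hornerD hornerN.
  have -> : p.[t] - q.[t] = (f t - g t) + ((p.[t] - f t) - (q.[t] - g t)) by ring.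
  rewrite (le_trans (ler_normD _ _))// lerD ?hM// (le_trans (ler_normB _ _))//.
  by have := p1 t ht; have := q1 t ht; lra.
have -> : b - c = pev (p - q) a - ((pev p a - b) - (pev q a - c)).
  by rewrite pevB opprB addrA [pev p a - _ + _]addrA addrNK subr_sub2.
rewrite (le_trans (nrmB _ _))//; have := nrmB (pev p a - b) (pev q a - c); lra.
Qed.

Lemma is_cfc_unique f a b c : star a = a -> is_cfc f a b -> is_cfc f a c -> b = c.
Proof.
move=> sa hb hc; apply/eqP; rewrite -subr_eq0; apply/eqP/nrm_eq0/eqP.
rewrite eq_le nrm_ge0 andbT; apply: (is_cfc_nrmB sa hb hc) => t _.
by rewrite subrr normr0.
Qed.

Lemma is_cfc_ex f a : star a = a -> continuous f -> exists b, is_cfc f a b.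
Proof.
move=> sa cf.
have hp n : exists p, forall t, `|t| <= nrm a -> `|p.[t] - f t| <= n.+1%:R^-1.
  by apply: weierstrass => //; exact: nrm_ge0.
have [p hpn] := choice hp.
have pn n t : spectrum a t%:C -> `|(p n).[t] - f t| <= n.+1%:R^-1.
  by move=> /spectrum_le; exact: hpn.
have [b hb] : exists b, ncvg (@nrm R A) (fun n => pev (p n) a) b.
  apply: ncauchy_nrm_cvg => e e0; have e20 : 0 < e / 2 by rewrite divr_gt0.
  have [n0 h0] := @inv_nat_small R 1 _ e20; exists n0 => m n hm hn.
  rewrite -pevB; apply: pev_nrm_le => // t ht; rewrite hornerD hornerN.
  have -> : (p m).[t] - (p n).[t] = ((p m).[t] - f t) - ((p n).[t] - f t) by ring.
  rewrite (le_trans (ler_normB _ _))// [leRHS]splitr.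
  have := h0 _ hm; have := h0 _ hn; rewrite !div1r => h1 h2.
  by rewrite lerD// (le_trans (pn _ _ ht)).
exists b => e e0; have [n1 h1] := hb _ e0; have [n2 h2] := @inv_nat_small R 1 _ e0.
exists (p (maxn n1 n2)); split; last by apply: h1; rewrite leq_maxl.
move=> t /(pn (maxn n1 n2)) h; rewrite (le_trans h)// -div1r; apply: h2.
exact: leq_maxr.
Qed.

Lemma cfcP f a : star a = a -> continuous f -> is_cfc f a (cfc f a).
Proof. by move=> sa cf; have [b hb] := is_cfc_ex sa cf; apply: (@xgetPex _ 0 (is_cfc f a)); exists b. Qed.

Lemma cfc_eq f a b : star a = a -> continuous f -> is_cfc f a b -> cfc f a = b.
Proof. by move=> sa cf; apply: is_cfc_unique => //; exact: cfcP. Qed.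

Lemma cfc_ext f g a : star a = a -> continuous f -> continuous g ->
  (forall t, spectrum a t%:C -> f t = g t) -> cfc f a = cfc g a.
Proof.
move=> sa cf cg fg; apply: cfc_eq => // e e0.
have [p [h1 h2]] := cfcP sa cg e0; exists p; split => // t ht.
by rewrite fg// h1.
Qed.

Lemma continuous_horner p : continuous (fun t : R => p.[t]).
Proof. by move=> t; apply: continuous_horner. Qed.

Lemma cfc_horner p a : star a = a -> cfc (fun t => p.[t]) a = pev p a.
Proof.
move=> sa; apply: cfc_eq => //; first exact: continuous_horner.
move=> e e0; exists p; rewrite subrr nrm0 (ltW e0); split => // t _.
by rewrite subrr normr0 ltW.
Qed.

Lemma cfc_nrm_le f a M : star a = a -> continuous f ->
  (forall t, spectrum a t%:C -> `|f t| <= M) -> nrm (cfc f a) <= M.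
Proof.
move=> sa cf hM; have h0 : is_cfc (fun=> 0) a 0.
  move=> e e0; exists 0; rewrite -[pev 0 a]/(pev 0%:P a) pevC scale0r subrr nrm0.
  by split=> [t _|]; rewrite ?hornerC ?subrr ?normr0 ltW.
rewrite -[cfc f a]subr0; apply: (is_cfc_nrmB sa (cfcP sa cf) h0) => t /hM.
by rewrite subr0.
Qed.

Lemma cfcM f g a : star a = a -> continuous f -> continuous g ->
  cfc (fun t => f t * g t) a = cfc f a * cfc g a.
Proof.
move=> sa cf cg; apply: cfc_eq => //; first by move=> t; apply: cvgM; [exact: cf|exact: cg].
move=> e e0.
have [C C0 hC] := bounded_segment (- nrm a) (nrm a) cf.
have [D D0 hD] := bounded_segment (- nrm a) (nrm a) cg.
have {}hC t : spectrum a t%:C -> `|f t| <= C.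
  by move=> /spectrum_le; rewrite ler_norml; exact: hC.
have {}hD t : spectrum a t%:C -> `|g t| <= D.
  by move=> /spectrum_le; rewrite ler_norml; exact: hD.
set b := cfc f a; set c := cfc g a.
pose L := C + D + nrm b + nrm c + 1.
have [nb nc] := (nrm_ge0 b, nrm_ge0 c).
have L1 : 1 <= L by rewrite /L; lra.
have L0 : 0 < L by lra.
pose d := Num.min 1 (e / (2 * L)).
have d0 : 0 < d by rewrite lt_min ltr01 divr_gt0// mulr_gt0.
have d1 : d <= 1 by rewrite ge_min lexx.
have dL : d * (2 * L) <= e by rewrite -ler_pdivlMr ?mulr_gt0// ge_min lexx orbT.
have [p [p1 p2]] := cfcP sa cf d0; have [q [q1 q2]] := cfcP sa cg d0.
have bnd (x y z w : R) : 0 <= x -> 0 <= y -> 0 <= z -> 0 <= w -> x <= d -> y <= d ->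
    z + w + 1 <= L -> x * y + (x * w + z * y) <= e.
  move=> x0 y0 z0 w0 xd yd zw.
  have h1 : x * y <= d by rewrite (le_trans (ler_pM x0 y0 xd (le_trans yd d1)))// mulr1.
  have h2 : x * w <= d * w by rewrite ler_wpM2r.
  have h3 : z * y <= d * z by rewrite mulrC ler_wpM2r.
  have : d * (z + w + 1) <= d * L by rewrite ler_wpM2l// ltW.
  have : 0 <= d * L by rewrite mulr_ge0// ltW.
  lra.
exists (p * q); split.
  move=> t ht; rewrite hornerM.
  have -> : p.[t] * q.[t] - f t * g t = (p.[t] - f t) * (q.[t] - g t) +
     ((p.[t] - f t) * g t + f t * (q.[t] - g t)) by ring.
  rewrite (le_trans (ler_normD _ _))//.
  rewrite (le_trans (lerD (lexx _) (ler_normD _ _)))// !normrM.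
  apply: bnd; rewrite ?p1 ?q1//.
  by have := hC _ ht; have := hD _ ht; rewrite /L; lra.
rewrite pevM -/b -/c.
have -> : pev p a * pev q a - b * c = (pev p a - b) * (pev q a - c) +
     ((pev p a - b) * c + b * (pev q a - c)).
  by rewrite addrA -mulrDr addrNK mulrBl mulrBr addrA addrNK.
rewrite (le_trans (nrmD _ _))// (le_trans (lerD (nrmM _ _) (nrmD _ _)))//.
rewrite (le_trans (lerD (lexx _) (lerD (nrmM _ _) (nrmM _ _))))//.
by apply: bnd; rewrite ?nrm_ge0//; rewrite /L; lra.
Qed.

Lemma cfc_id a : star a = a -> cfc id a = a.
Proof.
move=> sa; rewrite -{2}[a]pevX -cfc_horner//; congr (cfc _ a).
by apply/funext => t; rewrite hornerX.
Qed.

Lemma cfc_clim (S : set A) f a : star a = a -> continuous f -> clim S ->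
  (forall p, S (pev p a)) -> S (cfc f a).
Proof.
move=> sa cf cS hp; apply: cS => e e0.
have [p [_ h]] := cfcP sa cf (divr_gt0 e0 (ltr0Sn _ 1)).
exists (pev p a) => //; rewrite nrmBC (le_lt_trans h)//.
by rewrite ltr_pdivrMr// mulr_natr mulr2n ltrDl.
Qed.

Lemma clim_eq (u v : A -> A) (K : R) : 
  (forall x y, nrm (u x - u y) <= K * nrm (x - y)) ->
  (forall x y, nrm (v x - v y) <= K * nrm (x - y)) ->
  clim [set x | u x = v x].
Proof.
move=> hu hv l hl; apply/eqP; rewrite -subr_eq0; apply/eqP/nrm_eq0/eqP.
rewrite eq_le nrm_ge0 andbT; apply/ler_addgt0Pr => e e0; rewrite add0r.
have K0 : 0 < `|K| + 1 by rewrite ltr_wpDl.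
have [s us hs] := hl (e / (2 * (`|K| + 1))) (divr_gt0 e0 (mulr_gt0 (ltr0Sn _ 1) K0)).
have {}hs : nrm (l - s) * (2 * (`|K| + 1)) <= e.
  by rewrite -ler_pdivlMr ?mulr_gt0// ltW.
rewrite (le_trans (nrm_tri (u s) _ _))// {2}us.
have := hu l s; have := hv s l; rewrite [nrm (s - l)]nrmBC.
have : K * nrm (l - s) <= (`|K| + 1) * nrm (l - s).
  by rewrite ler_wpM2r ?nrm_ge0// (le_trans (ler_norm _))// lerDl.
lra.
Qed.

Lemma cfc_sa f a : star a = a -> continuous f -> star (cfc f a) = cfc f a.
Proof.
move=> sa cf; apply: (@cfc_clim [set x | star x = x]) => //; last by move=> p; exact: pev_sa.
by apply: (@clim_eq _ _ 1) => x y; rewrite mul1r// -starB nrm_star.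
Qed.

Lemma continuous_sqrt_comp f : continuous f -> continuous (fun t => Num.sqrt (f t)).
Proof. by move=> cf t; apply: continuous_comp; [exact: cf|exact: sqrt_continuous]. Qed.

Lemma cfc_psd f a : star a = a -> continuous f ->
  (forall t, spectrum a t%:C -> 0 <= f t) -> psd (cfc f a).
Proof.
move=> sa cf f0; have cs := continuous_sqrt_comp cf.
exists (cfc (fun t => Num.sqrt (f t)) a); first exact: cfc_sa.
rewrite -cfcM//; apply: cfc_ext => //.
  by move=> t; apply: cvgM; exact: cs.
by move=> t /f0 h; rewrite sqrtrM_self.
Qed.

End FunctionalCalculus.

(** * Positivity of star squares *)

Section StarSquares.
Variables (R : realType) (A : cstarAlgType R).
Implicit Types (a b c h k x y : A) (e r t M : R) (f g : R -> R).

Lemma cfcD f g a : star a = a -> continuous f -> continuous g ->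
  cfc (fun t => f t + g t) a = cfc f a + cfc g a.
Proof.
move=> sa cf cg; apply: cfc_eq => //; first by move=> t; apply: cvgD; [exact: cf|exact: cg].
move=> e e0; have e20 : 0 < e / 2 by rewrite divr_gt0.
have [p [p1 p2]] := cfcP sa cf e20; have [q [q1 q2]] := cfcP sa cg e20.
exists (p + q); split.
  move=> t ht; rewrite hornerD opprD addrACA (le_trans (ler_normD _ _))//.
  by rewrite [leRHS]splitr lerD ?p1 ?q1.
by rewrite pevD opprD addrACA (le_trans (nrmD _ _))// [leRHS]splitr lerD.
Qed.

Lemma continuous_fmax f g : continuous f -> continuous g ->
  continuous (fun t => Num.max (f t) (g t)).
Proof. by move=> cf cg t; apply: continuous_max; [exact: cf|exact: cg]. Qed.

(* With n the negative part of [h = b^* b] and [c = b n] one has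
   [c^* c = - n^3 <= 0], hence [c c^* = (c c^* + c^* c) - c^* c >= 0]; as
   [c c^*] and [c^* c] have the same nonzero spectrum, [n^3 = 0]. *)
Lemma psd_starM b : psd (star b * b).
Proof.
set h := star b * b; have sh : star h = h by rewrite starM starK.
have cN : continuous (fun t : R => Num.max 0 (- t)).
  by apply: continuous_fmax => t; [exact: cvg_cst|exact: cvgN].
have cP : continuous (fun t : R => Num.max 0 t).
  by apply: continuous_fmax => t; [exact: cvg_cst|exact: cvg_id].
have c2 : continuous (fun t : R => Num.max 0 (- t) * Num.max 0 (- t)).
  by move=> t; apply: cvgM; exact: cN.
have cid : continuous (@id R) by move=> t; exact: cvg_id.
set n := cfc (fun t => Num.max 0 (- t)) h.
have sn : star n = n by exact: cfc_sa.
have pn : psd n by apply: cfc_psd => // t _; rewrite le_max lexx.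
have nh : n * h = - (n * n).
  apply/eqP; rewrite -addr_eq0 (_ : n * h = n * cfc id h); last by rewrite cfc_id.
  rewrite /n -!cfcM// -cfcD//; last first.
    by move=> t; apply: cvgM; [exact: cN|exact: cid].
  rewrite (_ : (fun t => _) = (fun=> 0)); last first.
    apply/funext => t; rewrite maxEle; case: ifP => [|_]; first by rewrite oppr_ge0; lra.
    by rewrite mul0r add0r mul0r.
  by rewrite -(_ : (fun t => (0 : {poly R}).[t]) = (fun=> 0)) ?cfc_horner// ?pevE ?rmorph0//;
     apply/funext => t; rewrite horner0.
have hn : h + n = cfc (fun t => Num.max 0 t) h.
  rewrite (_ : h + n = cfc id h + n); last by rewrite cfc_id.
  rewrite /n -cfcD//; congr (cfc _ h); apply/funext => t.
  by rewrite !maxEle; do 2 case: ifP => //; lra.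
pose q := n * n * n; pose c := b * n.
have pq : psd q by apply: psdM_comm => //; [exact: psd_sqr|rewrite mulrA].
have cc : star c * c = - q.
  by rewrite /c starM sn -mulrA [star b * (b * n)]mulrA -/h mulrA nh mulNr.
have pcc : psd (c * star c).
  have -> : c * star c = (c * star c + star c * c) + q by rewrite cc addrNK.
  apply: psdD => //.
  pose z : R[i] := 0 +i* 1; have zz : z * z = -1 by rewrite /z; simpc.
  have cz : conjc z = - z by rewrite /z; simpc.
  have -> : c * star c + star c * c = (2^-1)%:C *: ((c + star c) * (c + star c) +
      (z *: (c - star c)) * (z *: (c - star c))).
    rewrite scalerMM zz scaleN1r !mulrDr !mulrDl !mulrN !mulNr opprK.
    rewrite !opprD !opprK.
    have -> (x1 x2 x3 x4 : A) : x1 + x2 + (x3 + x4) + (- x1 + x2 + (x3 - x4)) = (x2 + x3) + (x2 + x3).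
      rewrite addrACA [x1 + x2 + _]addrACA subrr add0r.
      by rewrite [x3 + x4 + _]addrACA subrr addr0 addrACA.
    by rewrite addr_scale2 scaleRA mulVf// scale1r addrC.
  apply: psdZ; first by rewrite invr_ge0.
  apply: psdD; apply: psd_sqr; first by rewrite starD starK addrC.
  by rewrite starZ starB starK cz scaleNr -scalerN opprB.
suff q0 : nrm q = 0.
  have n0 : n = 0.
    apply: nrm_eq0; apply/eqP.
    have : nrm n ^+ 4 == 0.
      rewrite (exprM _ 2 2) -!nrm_sa_sqr ?starM ?sn//.
      by rewrite mulrA -/q (nrm_eq0 q0) mul0r nrm0.
    by rewrite expf_eq0.
  rewrite -[h]addr0 -n0 hn; apply: cfc_psd => // t _; by rewrite le_max lexx.
apply/eqP; apply: contrapT => /negP q0; have {q0} q0 : 0 < nrm q by rewrite lt_neqAle eq_sym q0 nrm_ge0.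
have := spectrum_psd_nrm pq; apply; set l := nrm q.
have [z [z1 z2]] : ainv (l%:C%:A + c * star c).
  by apply: (@psd_ge_ainv _ _ _ l) => //; rewrite addrC addrA addNr add0r.
have e1 : l%:C%:A - q = l%:C%:A + star c * c by rewrite cc.
rewrite e1.
have l0 : l%:C != 0 by rewrite eq_complex /= gt_eqF.
(* The inverse of l + c^* c, computed from the inverse z of l + c c^* : this is how the two nonzero
   spectra are compared. *)
exists (l%:C^-1 *: (1 - star c * z * c)).
have k1 : star c * z * c * (star c * c) = star c * c - l%:C *: (star c * z * c).
  have -> : star c * z * c * (star c * c) = star c * (z * (c * star c)) * c.
    by rewrite !mulrA.
  have -> : z * (c * star c) = 1 - l%:C *: z.
    by rewrite -z1 mulrDr -scalerAr mulr1 addrAC subrr add0r.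
  by rewrite mulrBr mulrBl mulr1 -scalerAr -scalerAl.
have k2 : star c * c * (star c * z * c) = star c * c - l%:C *: (star c * z * c).
  have -> : star c * c * (star c * z * c) = star c * ((c * star c) * z) * c.
    by rewrite !mulrA.
  have -> : c * star c * z = 1 - l%:C *: z.
    by rewrite -z2 mulrDl -scalerAl mul1r addrAC subrr add0r.
  by rewrite mulrBr mulrBl mulr1 -scalerAr -scalerAl.
split.
  rewrite -scalerAl mulrBl mul1r mulrDr -scalerAr mulr1 k1.
  by rewrite [_ *: _ + (_ - _)]addrC subrK addrK scalerA mulVf// scale1r.
rewrite -scalerAr mulrBr mulr1 mulrDl -scalerAl mul1r k2.
by rewrite [_ *: _ + (_ - _)]addrC subrK addrK scalerA mulVf// scale1r.
Qed.

End StarSquares.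

(** * Conjugation of positive elements and the operator Cauchy-Schwarz inequality *)

Section CauchySchwarz.
Variables (R : realType) (A : cstarAlgType R).
Implicit Types (a b c h k x y : A) (e r t M : R).

Lemma psd_conj x h : psd h -> psd (star x * h * x).
Proof.
move=> [s ss ->]; have -> : star x * (s * s) * x = star (s * x) * (s * x).
  by rewrite starM ss !mulrA.
exact: psd_starM.
Qed.

Lemma pos_psd (B : set A) a : pos B a -> psd a.
Proof. by move=> [b _ ->]; exact: psd_starM. Qed.

Lemma nrm_sqr_le b M : 0 <= M -> psd ((M ^+ 2)%:C%:A - star b * b) -> nrm b <= M.
Proof.
move=> M0 /(psd_nrm_le (psd_starM b)); rewrite nrm_starM.
by rewrite ler_pXn2r ?nnegrE ?nrm_ge0.
Qed.

Lemma psd_nrm_starM b : psd ((nrm b ^+ 2)%:C%:A - star b * b).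
Proof.
by apply: psd_sqrt_le; rewrite ?nrm_starM// starM starK.
Qed.

(** The positive sum of the squares of the M y_i - x_i T is M^2 Q - 2 M T^* T + T^* P T. Adding T^*
    (M - P) T >= 0 leaves M (M Q - T^* T). *)
Lemma psd_cauchy_schwarz (I : finType) (x y : I -> A) M : 0 < M ->
  nrm (\sum_i star (x i) * x i) <= M ->
  psd (M%:C *: (\sum_i star (y i) * y i) -
    star (\sum_i star (x i) * y i) * (\sum_i star (x i) * y i)).
Proof.
set P := \sum_i star (x i) * x i; set Q := \sum_i star (y i) * y i.
set T := \sum_i star (x i) * y i => M0 PM.
have sP : star P = P by rewrite star_sum; apply: eq_bigr => i _; rewrite starM starK.
have sT : star T = \sum_i star (y i) * x i.
  by rewrite star_sum; apply: eq_bigr => i _; rewrite starM starK.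
have h1 : psd (\sum_i star (M%:C *: y i - x i * T) * (M%:C *: y i - x i * T)).
  by apply: psd_sum => i _; exact: psd_starM.
have h2 : psd (star T * (M%:C%:A - P) * T).
  by apply/psd_conj/psd_sqrt_le.
have := psdD h1 h2.
have -> : \sum_i star (M%:C *: y i - x i * T) * (M%:C *: y i - x i * T) =
    (M * M)%:C *: Q - M%:C *: (star T * T) - (M%:C *: (star T * T) - star T * P * T).
  rewrite {1}/Q -mulrA /P mulr_suml mulr_sumr.
  have e1 : M%:C *: (star T * T) = \sum_i M%:C *: (star (y i) * (x i * T)).
    by rewrite {1}sT mulr_suml scaler_sumr; apply: eq_bigr => i _; rewrite mulrA.
  have e2 : M%:C *: (star T * T) = \sum_i M%:C *: (star T * (star (x i) * y i)).
    by rewrite {2}/T mulr_sumr scaler_sumr.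
  rewrite {1}e1 {1}e2 scaler_sumr -!sumrB; apply: eq_bigr => i _.
  rewrite starB starZr starM mulrBl !mulrBr scaleRMM -!scalerAl -!scalerAr !mulrA.
  by [].
have -> : (M * M)%:C *: Q - M%:C *: (star T * T) -
    (M%:C *: (star T * T) - star T * P * T) + star T * (M%:C%:A - P) * T =
    M%:C *: (M%:C *: Q - star T * T).
  have -> : star T * (M%:C%:A - P) * T = M%:C *: (star T * T) - star T * P * T.
    by rewrite mulrBr mulrBl -scalerAr mulr1 -scalerAl.
  by rewrite subrK scalerBr scaleRA.
move=> /(@psdZ _ _ M^-1); rewrite scaleRA mulVf ?gt_eqF// scale1r; apply.
by rewrite invr_ge0 ltW.
Qed.

Lemma cauchy_schwarz (I : finType) (x y : I -> A) :
  nrm (\sum_i star (x i) * y i) ^+ 2 <=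
  nrm (\sum_i star (x i) * x i) * nrm (\sum_i star (y i) * y i).
Proof.
set P := \sum_i star (x i) * x i; set Q := \sum_i star (y i) * y i.
have key M : 0 < M -> nrm P <= M -> nrm (\sum_i star (x i) * y i) ^+ 2 <= M * nrm Q.
  move=> M0 /(@psd_cauchy_schwarz _ _ y _ M0) /(psd_mono (psd_starM _)).
  by rewrite nrm_starM nrmZp// ltW.
(* M is taken slightly above |P|, as |P| itself may vanish. *)
apply/ler_addgt0Pr => e e0.
have Q0 : 0 < nrm Q + 1 by rewrite ltr_wpDl ?nrm_ge0.
have d0 : 0 < e / (nrm Q + 1) by rewrite divr_gt0.
apply: (le_trans (key (nrm P + e / (nrm Q + 1)) _ _)).
- by rewrite ltr_wpDl ?nrm_ge0.
- by rewrite lerDl ltW.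
rewrite mulrDl lerD2l mulrAC ler_pdivrMr// ler_wpM2l ?(ltW e0)//.
by rewrite lerDl.
Qed.

End CauchySchwarz.

(** * Subalgebras and actions *)

Section Subalgebras.
Variables (R : realType) (A : cstarAlgType R).
Implicit Types (a b c d h k x y : A) (e r t M : R) (B S : set A).

Lemma clim_closure S : clim (closure S).
Proof.
move=> l hl; apply/closure_nrmP => e e0.
have e20 : 0 < e / 2 by rewrite divr_gt0.
have [s /closure_nrmP/(_ _ e20)[s' Ss' h1] h2] := hl _ e20; exists s' => //.
by rewrite (le_lt_trans (nrm_tri s _ _))// [ltRHS]splitr ltrD.
Qed.

Lemma closure_sub_clim S T : S `<=` T -> clim T -> closure S `<=` T.
Proof.
move=> ST cT l /closure_nrmP h; apply: cT => e /h[s /ST Ts hs]; by exists s.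
Qed.

Lemma clim_preim (u : A -> A) (K : R) S :
  (forall x y, nrm (u x - u y) <= K * nrm (x - y)) -> clim S -> clim (u @^-1` S).
Proof.
move=> hu cS l hl; apply: cS => e e0.
have K0 : 0 < `|K| + 1 by rewrite ltr_wpDl.
have [s us hs] := hl _ (divr_gt0 e0 K0); exists (u s) => //.
move: hs; rewrite ltr_pdivlMr// => h; apply: le_lt_trans h.
rewrite (le_trans (hu _ _))// mulrC ler_wpM2l ?nrm_ge0//.
by rewrite (le_trans (ler_norm _))// lerDl.
Qed.

(** C*-subalgebras, possibly without the unit of A: the corners are among them. *)
Record csub B : Prop := {
  csub0 : B 0;
  csubD : forall a b, B a -> B b -> B (a + b);
  csubZ : forall (z : R[i]) a, B a -> B (z *: a);
  csubM : forall a b, B a -> B b -> B (a * b);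
  csubS : forall a, B a -> B (star a);
  csubL : clim B
}.

Lemma csubN B a : csub B -> B a -> B (- a).
Proof. by move=> hB Ba; rewrite -scaleN1r; exact: csubZ. Qed.

Lemma csubB B a b : csub B -> B a -> B b -> B (a - b).
Proof. by move=> hB Ba Bb; apply: csubD => //; exact: csubN. Qed.

Lemma csub_sum B (I : Type) (s : seq I) (P : pred I) (F : I -> A) : csub B ->
  (forall i, P i -> B (F i)) -> B (\sum_(i <- s | P i) F i).
Proof. by move=> hB h; elim/big_rec: _ => [|i x Pi hx]; [exact: csub0|apply: csubD => //; exact: h]. Qed.

Lemma csub_pev B p a : csub B -> B 1 -> B a -> B (pev p a).
Proof.
move=> hB B1 Ba; apply: (@pev_ind _ _ B) => [r|b r Bb]; first exact: csubZ.
by apply: csubD => //; [exact: csubM|exact: csubZ].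
Qed.

Lemma csub_cfc B f a : csub B -> B 1 -> star a = a -> continuous f -> B a -> B (cfc f a).
Proof.
move=> hB B1 sa cf Ba; apply: cfc_clim => //; first exact: csubL.
by move=> p; exact: csub_pev.
Qed.

(** The operations are Lipschitz in each variable, so closure properties of the d b d pass to limits
    one variable at a time. *)
Lemma csub_corner B d : csub B -> B d -> star d = d -> csub (corner B d).
Proof.
move=> hB Bd sd; rewrite /corner; set S := [set d * b * d | b in B].
have SM a b : S a -> S b -> S (a * b).
  move=> [a' Ba <-] [b' Bb <-]; exists (a' * (d * d) * b').
    by apply: csubM => //; apply: csubM => //; exact: csubM.
  by rewrite !mulrA.
split.
- by apply: subset_closure; exists 0; [exact: csub0|rewrite mulr0 mul0r].
- move=> a b ha hb.
  have h1 s : S s -> (closure S) `<=` [set l | closure S (s + l)].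
    move=> Ss; apply: closure_sub_clim.
      move=> _ [l Bl <-]; apply: subset_closure; case: Ss => [s' Bs <-].
      by exists (s' + l); [exact: csubD|rewrite mulrDr mulrDl].
    apply: (@clim_preim (fun l => s + l) 1); last exact: clim_closure.
    by move=> x y; rewrite opprD addrACA subrr add0r mul1r.
  have : (closure S) `<=` [set l | closure S (l + b)].
    apply: closure_sub_clim; first by move=> s Ss; exact: (h1 s Ss b hb).
    apply: (@clim_preim (fun l => l + b) 1); last exact: clim_closure.
    by move=> x y; rewrite opprD addrACA subrr addr0 mul1r.
  exact.
- move=> z a; suff: (closure S) `<=` [set l | closure S (z *: l)] by apply.
  apply: closure_sub_clim.
    move=> _ [l Bl <-]; apply: subset_closure; exists (z *: l); first exact: csubZ.
    by rewrite -scalerAr -scalerAl.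
  apply: (@clim_preim (fun l => z *: l) (complex.Re `|z|)); last exact: clim_closure.
  by move=> x y; rewrite -scalerBr nrmZ.
- move=> a b ha hb.
  have h1 s : S s -> (closure S) `<=` [set l | closure S (s * l)].
    move=> Ss; apply: closure_sub_clim; first by move=> l Sl; apply/subset_closure/SM.
    apply: (@clim_preim (fun l => s * l) (nrm s)); last exact: clim_closure.
    by move=> x y; rewrite -mulrBr nrmM.
  have : (closure S) `<=` [set l | closure S (l * b)].
    apply: closure_sub_clim; first by move=> s Ss; exact: (h1 s Ss b hb).
    apply: (@clim_preim (fun l => l * b) (nrm b)); last exact: clim_closure.
    by move=> x y; rewrite -mulrBl mulrC nrmM.
  exact.
- move=> a; suff: (closure S) `<=` [set l | closure S (star l)] by apply.
  apply: closure_sub_clim.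
    move=> _ [l Bl <-]; apply: subset_closure; exists (star l); first exact: csubS.
    by rewrite !starM sd mulrA.
  apply: (@clim_preim star 1); last exact: clim_closure.
  by move=> x y; rewrite -starB nrm_star mul1r.
- exact: clim_closure.
Qed.

End Subalgebras.

(** * Actions by isometries and their fixed point algebra *)

Section Actions.
Variables (R : realType) (G : topologicalGroupType) (A : cstarAlgType R).
Variable al : G -> A -> A.
Hypothesis alP : is_action al.

Lemma alD g a b : al g (a + b) = al g a + al g b.
Proof. by have := act_lin alP g 1 a b; rewrite !scale1r. Qed.

Lemma al0 g : al g 0 = 0.
Proof. by apply: (addrI (al g 0)); rewrite -alD !addr0. Qed.

Lemma alZ g (z : R[i]) a : al g (z *: a) = z *: al g a.
Proof. by have := act_lin alP g z a 0; rewrite al0 !addr0. Qed.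

Lemma alN g a : al g (- a) = - al g a.
Proof. by apply: (addrI (al g a)); rewrite -alD !subrr al0. Qed.

Lemma alB g a b : al g (a - b) = al g a - al g b.
Proof. by rewrite alD alN. Qed.

Lemma al_sum g (I : Type) (s : seq I) (P : pred I) (F : I -> A) :
  al g (\sum_(i <- s | P i) F i) = \sum_(i <- s | P i) al g (F i).
Proof. exact: (big_morph _ (alD g) (al0 g)). Qed.

Lemma alK g a : al g^-1%g (al g a) = a.
Proof. by rewrite -(act_M alP) mulVg (act_1 alP). Qed.

Lemma alKV g a : al g (al g^-1%g a) = a.
Proof. by rewrite -(act_M alP) mulgV (act_1 alP). Qed.

Lemma al_one g : al g 1 = 1.
Proof. by rewrite -{2}(alKV g 1) -[in RHS](mul1r (al _ 1)) (act_mul alP) alKV mulr1. Qed.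

Lemma al_psd g h : psd h -> psd (al g h).
Proof.
by move=> [s ss ->]; exists (al g s); rewrite -?(act_star alP) ?ss// (act_mul alP).
Qed.

(** An automorphism preserves order and unit, hence sends |a|^2 - a^* a >= 0 to a positive element
    and does not increase the norm; the same holds for its inverse. *)
Lemma nrm_al g a : nrm (al g a) = nrm a.
Proof.
have h k b : nrm (al k b) <= nrm b.
  apply: nrm_sqr_le; first exact: nrm_ge0.
  rewrite -(act_star alP) -(act_mul alP) -[X in _ *: X](al_one k) -alZ -alB.
  exact/al_psd/psd_nrm_starM.
by apply/eqP; rewrite eq_le h -{1}(alK g a) h.
Qed.

Lemma csub_fixed : csub (fixed_alg al).
Proof.
split.
- by move=> g; exact: al0.
- by move=> a b ha hb g; rewrite alD ha hb.
- by move=> z a ha g; rewrite alZ ha.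
- by move=> a b ha hb g; rewrite (act_mul alP) ha hb.
- by move=> a ha g; rewrite (act_star alP) ha.
- move=> l hl g.
  apply: (@clim_eq _ _ (al g) id 1) => [x y|x y|e /hl[s hs h]].
  + by rewrite -alB nrm_al mul1r.
  + by rewrite mul1r.
  + by exists s => //; exact: hs.
Qed.

Lemma fixed_one : fixed_alg al 1.
Proof. by move=> g; exact: al_one. Qed.

End Actions.

(** * Square roots of matrices *)

Section MatrixSquareRoot.
Variables (R : realType) (A : cstarAlgType R).
Implicit Types (a b c u v : A) (r : R).

Definition adj m n (X : 'M[A]_(m, n)) : 'M[A]_(n, m) := (map_mx star X)^T.

Lemma adjE m n (X : 'M[A]_(m, n)) i j : adj X i j = star (X j i).
Proof. by rewrite !mxE. Qed.

Lemma adjM m n p (X : 'M[A]_(m, n)) (Y : 'M[A]_(n, p)) :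
  adj (X *m Y) = adj Y *m adj X.
Proof.
apply/matrixP => i j; rewrite adjE !mxE star_sum; apply: eq_bigr => k _.
by rewrite !adjE starM.
Qed.

Lemma adjD m n (X Y : 'M[A]_(m, n)) : adj (X + Y) = adj X + adj Y.
Proof. by apply/matrixP => i j; rewrite adjE !mxE starD. Qed.

Lemma adjN m n (X : 'M[A]_(m, n)) : adj (- X) = - adj X.
Proof. by apply/matrixP => i j; rewrite adjE !mxE starN. Qed.

(** Real scalars as central matrices, since the [hf] of the iteration has to be a ring element. *)
Definition scm n r : 'M[A]_n := (r%:C%:A)%:M.

Lemma scmE m n r (X : 'M[A]_(m, n)) i j : (scm m r *m X) i j = r%:C *: X i j.
Proof. by rewrite mul_scalar_mx mxE -scalerAl mul1r. Qed.

Lemma scmC m n r (X : 'M[A]_(m, n)) : scm m r *m X = X *m scm n r.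
Proof.
apply/matrixP => i j; rewrite scmE mxE (bigD1 j)//= big1 => [|k kj].
  by rewrite mxE eqxx mulr1n -scalerAr mulr1 addr0.
by rewrite mxE (negbTE kj) mulr0n mulr0.
Qed.

Lemma scmD n r r' : scm n (r + r') = scm n r + scm n r'.
Proof. by rewrite /scm rmorphD/= scalerDl raddfD. Qed.

Lemma scmM n r r' : scm n r *m scm n r' = scm n (r * r').
Proof. by rewrite /scm -scalar_mxM scaleRMM mulr1. Qed.

Lemma scm1 n : scm n 1 = 1%:M.
Proof. by rewrite /scm rmorph1 scale1r. Qed.

Lemma adj_scm n r : adj (scm n r) = scm n r.
Proof.
apply/matrixP => i j; rewrite adjE !mxE eq_sym; case: eqP => _.
  by rewrite !mulr1n starZr star1.
by rewrite !mulr0n star0.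
Qed.

Definition mform n (X : 'M[A]_n) (w : 'cV[A]_n) : A := (adj w *m X *m w) 0 0.

(** Positivity of the A-valued form on A^n, in the role of positivity in the C*-algebra M_n(A). *)
Definition fpos n (X : 'M[A]_n) : Prop := forall w : 'cV[A]_n, psd (mform X w).

Lemma mformE n (X : 'M[A]_n) w :
  mform X w = \sum_i \sum_j star (w i 0) * X i j * w j 0.
Proof.
rewrite /mform mxE exchange_big /=; apply: eq_bigr => j _.
by rewrite mxE mulr_suml; apply: eq_bigr => i _; rewrite adjE.
Qed.

Lemma mformD n (X Y : 'M[A]_n) w : mform (X + Y) w = mform X w + mform Y w.
Proof. by rewrite /mform mulmxDr mulmxDl mxE. Qed.

Lemma mformN n (X : 'M[A]_n) w : mform (- X) w = - mform X w.
Proof. by rewrite /mform mulmxN mulNmx mxE. Qed.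

Lemma mform_scm n r (X : 'M[A]_n) w : mform (scm n r *m X) w = r%:C *: mform X w.
Proof. by rewrite /mform mulmxA -scmC -!mulmxA scmE. Qed.

Lemma fposD n (X Y : 'M[A]_n) : fpos X -> fpos Y -> fpos (X + Y).
Proof. by move=> hX hY w; rewrite mformD; apply: psdD. Qed.

Lemma fpos_conj n (X Z : 'M[A]_n) : fpos X -> fpos (adj Z *m X *m Z).
Proof.
move=> hX w; have := hX (Z *m w); congr psd.
by rewrite /mform adjM !mulmxA.
Qed.

(** r times the element is |c v - r u|^2 + v^* (r^2 - c^* c) v, where |b|^2 stands for b^* b. *)
Lemma psd_two_term u v c r : 0 < r -> nrm c <= r ->
  psd (r%:C *: (star u * u + star v * v) - (star u * c * v + star v * star c * u)).
Proof.
move=> r0 cr; have h1 := psd_starM (c * v - r%:C *: u).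
have h2 : psd (star v * ((r ^+ 2)%:C%:A - star c * c) * v).
  apply/psd_conj/psd_sqrt_le; first by rewrite starM starK.
  by rewrite nrm_starM lerXn2r// ?nnegrE ?nrm_ge0// ltW.
have := @psdZ _ _ r^-1 _ _ (psdD h1 h2); rewrite invr_ge0 (ltW r0) => /(_ isT).
congr psd.
have -> : star (c * v - r%:C *: u) * (c * v - r%:C *: u) =
    star v * star c * c * v - r%:C *: (star v * star c * u) -
    (r%:C *: (star u * c * v) - (r * r)%:C *: (star u * u)).
  by rewrite starB starM starZr mulrBl !mulrBr scaleRMM -!scalerAl -!scalerAr !mulrA.
have -> : star v * ((r ^+ 2)%:C%:A - star c * c) * v =
    (r * r)%:C *: (star v * v) - star v * star c * c * v.
  by rewrite mulrBr mulrBl -scalerAr mulr1 -scalerAl !mulrA expr2.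
move: (star v * star c * c * v) (star v * star c * u) (star u * c * v) => x1 x2 x3.
move: (star u * u) (star v * v) => x4 x5.
have -> : x1 - r%:C *: x2 - (r%:C *: x3 - (r * r)%:C *: x4) + ((r * r)%:C *: x5 - x1) =
    r%:C *: (r%:C *: (x4 + x5) - (x3 + x2)).
  rewrite scalerBr scaleRA !scalerDr.
  move: (r%:C *: x2) (r%:C *: x3) (_ *: x4) (_ *: x5) => b c' d' e.
  by rewrite opprB addrC addrA [e - x1 + _]addrA subrK addrACA [e + d']addrC -opprD [b + c']addrC.
by rewrite scaleRA mulVf ?gt_eqF// scale1r.
Qed.

(* Only the square root of [1 - K] needs the powers of K to be bounded
   entrywise, and as forms they are dominated by 1. *)
Lemma fpos_powers n (K : 'M[A]_n) j : adj K = K -> fpos K -> fpos (1%:M - K) ->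
  fpos (1%:M - adj (K ^+ j) *m K ^+ j) /\ adj (K ^+ j) = K ^+ j.
Proof.
move=> sK pK p1.
have aX i : adj (K ^+ i) = K ^+ i.
  elim: i => [|i IH]; first by rewrite expr0 -[1]/(1%:M) -scm1 adj_scm.
  by rewrite {1}exprS -[K * _]/(K *m _) adjM IH sK exprSr.
split=> //; rewrite aX.
have p2 : fpos (1%:M - K *m K).
  (* The last two terms add up to K - K^2, in a shape in which each is a conjugate of a positive
     form. *)
  have -> : 1%:M - K *m K = (1%:M - K) + (adj K *m (1%:M - K) *m K +
       adj (1%:M - K) *m K *m (1%:M - K)).
    have -> : adj (1%:M - K) = 1%:M - K by rewrite adjD adjN sK -scm1 adj_scm.
    have e : K *m (1%:M - K) = K - K *m K by rewrite mulmxBr mulmx1.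
    have e' : (1%:M - K) *m K = K - K *m K by rewrite mulmxBl mul1mx.
    rewrite sK e e' [X in _ + (_ + X)]mulmxBr mulmx1.
    by rewrite [(_ - _) *m K + _]addrC subrK addrA subrK.
  by apply: fposD => //; apply: fposD; exact: fpos_conj.
elim: j => [|j IH].
  move=> w; rewrite (_ : K ^+ 0 = 1%:M)// mulmx1 subrr.
  by rewrite /mform mulmx0 mul0mx mxE; exact: psd0.
have -> : 1%:M - K ^+ j.+1 *m K ^+ j.+1 =
    (1%:M - K *m K) + adj K *m (1%:M - K ^+ j *m K ^+ j) *m K.
  rewrite sK mulmxBr mulmx1 mulmxBl addrA addrNK {1}exprS exprSr.
  by rewrite -![_ * _]/(_ *m _) !mulmxA.
by apply: fposD => //; exact: fpos_conj.
Qed.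

(** On the j-th basis vector the form is 1 minus the sum of the squares of the j-th column. *)
Lemma fpos_entry n (Z : 'M[A]_n) i j : fpos (1%:M - adj Z *m Z) -> nrm (Z i j) <= 1.
Proof.
move=> /(_ (delta_mx j 0)); set w := delta_mx j 0.
have -> : mform (1%:M - adj Z *m Z) w = 1 - \sum_k star (Z k j) * Z k j.
  have ad (M : nat) (X : 'M[A]_(M, n)) k : (X *m w) k 0 = X k j.
    rewrite mxE (bigD1 j)//= mxE !eqxx mulr1 big1 ?addr0// => l lj.
    by rewrite mxE (negbTE lj) mulr0.
  rewrite mformD mformN; congr (_ - _).
    rewrite /mform mulmx1 ad adjE mxE !eqxx /=.
    by rewrite star1.
  rewrite /mform mulmxA -adjM -mulmxA mxE; apply: eq_bigr => k _.
  by rewrite adjE ad.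
move=> h; have : psd (1 - star (Z i j) * Z i j).
  move: h; rewrite (bigD1 i)//= opprD addrA => h.
  have hs : psd (\sum_(k | k != i) star (Z k j) * Z k j).
    by apply: psd_sum => k _; exact: psd_starM.
  by have := psdD h hs; rewrite addrNK.
by move=> h1; apply: nrm_sqr_le => //; rewrite expr1n rmorph1 scale1r.
Qed.

(** A complete submultiplicative norm for the iteration. It is not a C*-norm; the powers of K are
    bounded for it because [fpos_powers] bounds their entries. *)
Definition mxN m n (X : 'M[A]_(m, n)) : R := \sum_i \sum_j nrm (X i j).

Lemma mxN_entry m n (X : 'M[A]_(m, n)) i j : nrm (X i j) <= mxN X.
Proof.
rewrite /mxN (bigD1 i)//= (bigD1 j)//= -addrA lerDl addr_ge0//.
  by apply: sumr_ge0 => *; exact: nrm_ge0.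
by apply: sumr_ge0 => *; apply: sumr_ge0 => *; exact: nrm_ge0.
Qed.

Lemma mxN_ge0 m n (X : 'M[A]_(m, n)) : 0 <= mxN X.
Proof. by apply: sumr_ge0 => i _; apply: sumr_ge0 => j _; exact: nrm_ge0. Qed.

Lemma mxN_eq0 m n (X : 'M[A]_(m, n)) : mxN X = 0 -> X = 0.
Proof.
move=> X0; apply/matrixP => i j; rewrite mxE; apply: nrm_eq0; apply/eqP.
by rewrite eq_le nrm_ge0 andbT -X0 mxN_entry.
Qed.

Lemma mxND m n (X Y : 'M[A]_(m, n)) : mxN (X + Y) <= mxN X + mxN Y.
Proof.
rewrite /mxN -big_split /=; apply: ler_sum => i _; rewrite -big_split /=.
by apply: ler_sum => j _; rewrite mxE nrmD.
Qed.

Lemma mxNN m n (X : 'M[A]_(m, n)) : mxN (- X) = mxN X.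
Proof. by apply: eq_bigr => i _; apply: eq_bigr => j _; rewrite mxE nrmN. Qed.

Lemma mxNM n (X Y : 'M[A]_n) : mxN (X *m Y) <= mxN X * mxN Y.
Proof.
apply: (@le_trans _ _ (\sum_i \sum_k \sum_j nrm (X i j) * nrm (Y j k))).
  apply: ler_sum => i _; apply: ler_sum => k _; rewrite mxE.
  by apply: (le_trans (nrm_sum _ _ _)); apply: ler_sum => j _; exact: nrmM.
rewrite /mxN mulr_suml; apply: ler_sum => i _; rewrite exchange_big mulr_suml /=.
apply: ler_sum => j _; rewrite -mulr_sumr ler_wpM2l ?nrm_ge0//.
rewrite [leRHS](bigD1 j)//= lerDl.
by apply: sumr_ge0 => *; apply: sumr_ge0 => *; exact: nrm_ge0.
Qed.

Lemma mxN_scm n r (X : 'M[A]_n) : 0 <= r -> mxN (scm n r *m X) = r * mxN X.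
Proof.
move=> r0; rewrite /mxN mulr_sumr; apply: eq_bigr => i _; rewrite mulr_sumr.
by apply: eq_bigr => j _; rewrite scmE nrmZp.
Qed.

Lemma mxN_adj n (X : 'M[A]_n) : mxN (adj X) = mxN X.
Proof.
rewrite /mxN exchange_big; apply: eq_bigr => i _; apply: eq_bigr => j _.
by rewrite adjE nrm_star.
Qed.

Lemma mxN_complete n (u : nat -> 'M[A]_n) :
  ncauchy (@mxN n n) u -> exists l, ncvg (@mxN n n) u l.
Proof.
move=> cu.
have h (ij : 'I_n * 'I_n) : exists l, ncvg (@nrm R A) (fun m => u m ij.1 ij.2) l.
  apply: ncauchy_nrm_cvg => e /cu[n0 h]; exists n0 => k m hk hm.
  apply: le_trans (h k m hk hm).
  by have := mxN_entry (u k - u m) ij.1 ij.2; rewrite !mxE.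
have [l hl] := choice h; exists (\matrix_(i, j) l (i, j)) => e e0.
pose d := e / (n * n).+1%:R.
have d0 : 0 < d by rewrite divr_gt0.
have [N hN] := choice (fun ij => hl ij d d0).
exists (\max_ij N ij) => m hm.
apply: (@le_trans _ _ (\sum_(i < n) \sum_(j < n) d)).
  apply: ler_sum => i _; apply: ler_sum => j _; rewrite !mxE.
  apply: (hN (i, j)); apply: leq_trans hm; exact: leq_bigmax.
rewrite !sumr_const !card_ord -mulrnA -mulr_natr /d mulrAC ler_pdivrMr//.
by rewrite ler_wpM2l ?(ltW e0)// ler_nat.
Qed.

End MatrixSquareRoot.

(** * Square roots of form-positive matrices with entries in a subalgebra *)

Section FormPositive.
Variables (R : realType) (A : cstarAlgType R).
Implicit Types (a b c : A) (r : R).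

Lemma addr_scaleN a n : a *+ n = (n%:R : R)%:C *: a.
Proof.
elim: n => [|n IH]; first by rewrite scale0r.
by rewrite mulrSr IH -natr1 rmorphD/= rmorph1 scalerDl scale1r.
Qed.

(** By [psd_two_term] the cross terms of i and j are at most m (|w_i|^2 + |w_j|^2); summing over all
    pairs and halving gives n m. The factor n + 1 keeps the bound positive for n = 0. *)
Lemma fpos_bound n (X : 'M[A]_n) : adj X = X ->
  exists2 r, 0 < r & fpos (scm A n r - X).
Proof.
move=> sX; pose m := mxN X + 1.
have m0 : 0 < m by rewrite ltr_wpDl ?mxN_ge0.
exists (n.+1%:R * m); first by rewrite mulr_gt0.
move=> w; rewrite mformD mformN -[scm A n _]mulmx1 mform_scm.
pose a i := star (w i 0) * w i 0; pose P := \sum_i a i.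
pose t i j := star (w i 0) * X i j * w j 0.
have pP : psd P by apply: psd_sum => i _; exact: psd_starM.
have -> : mform 1%:M w = P.
  by rewrite /mform mulmx1 mxE; apply: eq_bigr => i _; rewrite adjE.
have -> : mform X w = \sum_i \sum_j t i j by rewrite mformE.
have dsumD (f g : 'I_n -> 'I_n -> A) : \sum_i \sum_j (f i j + g i j) =
    \sum_i \sum_j f i j + \sum_i \sum_j g i j.
  by rewrite -big_split /=; apply: eq_bigr => i _; rewrite big_split.
have h : psd (\sum_i \sum_j ((m%:C *: a i + m%:C *: a j) + (- t i j - t j i))).
  apply: psd_sum => i _; apply: psd_sum => j _.
  rewrite -opprD -scalerDr.
  have -> : t j i = star (w j 0) * star (X i j) * w i 0 by rewrite -(adjE X) sX.
  apply: psd_two_term => //.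
  by rewrite (le_trans (mxN_entry X i j))// lerDl.
have e1 : \sum_(i < n) \sum_(j < n) m%:C *: a i = (n%:R * m)%:C *: P.
  rewrite /P scaler_sumr; apply: eq_bigr => i _.
  by rewrite sumr_const card_ord addr_scaleN scaleRA.
have e2 : \sum_(i < n) \sum_(j < n) m%:C *: a j = (n%:R * m)%:C *: P.
  by rewrite exchange_big.
have e3 : \sum_i \sum_j - t i j = - \sum_i \sum_j t i j.
  by rewrite -sumrN; apply: eq_bigr => i _; rewrite sumrN.
have e4 : \sum_i \sum_j - t j i = - \sum_i \sum_j t i j.
  by rewrite exchange_big.
move: h; rewrite !dsumD e1 e2 e3 e4; set S := \sum_i \sum_j t i j.
rewrite addrACA addr_scale2 => /(@psdZ _ _ 2^-1); rewrite scaleRA mulVf// scale1r.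
rewrite invr_ge0 => /(_ (ler0n _ _)) h; have := psdD h (psdZ (ltW m0) pP).
by rewrite addrAC -scalerDl -rmorphD/= -natr1 mulrDl mul1r.
Qed.

Lemma adj1 n : adj (1%:M : 'M[A]_n) = 1%:M.
Proof. by rewrite -scm1 adj_scm. Qed.

(** X = r (1 - K) with 0 <= K <= 1 as forms, so r^(1/2) (1 - y) is a root, y being the limit of the
    iteration. *)
Lemma mx_sqrt (E : set A) n (X : 'M[A]_n) : csub E -> (forall i j, E (X i j)) ->
  adj X = X -> fpos X -> exists2 Y : 'M[A]_n, (forall i j, E (Y i j)) & X = adj Y *m Y.
Proof.
move=> hE EX sX pX; have [r r0 pr] := fpos_bound sX.
pose K : 'M[A]_n := 1%:M - scm A n r^-1 *m X.
have rI : scm A n r^-1 *m scm A n r = 1%:M by rewrite scmM mulVf ?gt_eqF// scm1.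
have sK : adj K = K.
  by rewrite adjD adjN adjM sX adj_scm adj1 -scmC.
have fscm (Z : 'M[A]_n) : fpos Z -> fpos (scm A n r^-1 *m Z).
  by move=> hZ w; rewrite mform_scm; apply: psdZ => //; rewrite invr_ge0 ltW.
have pK : fpos K by have := fscm _ pr; rewrite mulmxBr rI.
have p1K : fpos (1%:M - K).
  by rewrite /K opprB addrC addrNK; exact: fscm.
have NK j : mxN (K ^+ j) <= (n * n)%:R.
  have [h _] := fpos_powers j sK pK p1K.
  apply: (@le_trans _ _ (\sum_(i < n) \sum_(k < n) 1)).
    by apply: ler_sum => i _; apply: ler_sum => k _; exact: fpos_entry.
  by rewrite !sumr_const !card_ord -mulrnA.
pose hf := scm A n 2^-1.
have hf2 : hf + hf = 1 :> 'M[A]_n.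
  by rewrite -scmD (_ : 2^-1 + 2^-1 = 1) ?scm1//; lra.
have [||||||||||y yy yl] := @sqrt_iteration R 'M[A]_n (@mxN R A n n) hf K (n * n)%:R.
- exact: mxN_eq0.
- exact: mxN_ge0.
- exact: mxND.
- exact: mxNN.
- exact: mxNM.
- by move=> x; exact: scmC.
- by move=> x; rewrite [X in mxN X]/(hf *m x) mxN_scm ?invr_ge0// mulrC.
- exact: hf2.
- exact: mxN_complete.
- exact: NK.
pose EM (Z : 'M[A]_n) := forall i j, E (Z i j).
have EM_s q Z : EM Z -> EM (scm A n q *m Z).
  by move=> hZ i j; rewrite scmE; exact: csubZ.
have EM_D Z Z' : EM Z -> EM Z' -> EM (Z + Z').
  by move=> hZ hZ' i j; rewrite mxE; exact: csubD.
have EM_N Z : EM Z -> EM (- Z).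
  by move=> hZ i j; rewrite mxE; exact: csubN.
have EM_M Z Z' : EM Z -> EM Z' -> EM (Z *m Z').
  by move=> hZ hZ' i j; rewrite mxE; apply: csub_sum => // k _; exact: csubM.
(* E need not contain 1, so the iterates themselves may leave the matrices over E. Up to a scalar
   tending to 1 they are in it, and hence 1 - y is a limit of matrices over E. *)
have it m : exists2 Z, EM Z & sqit hf K m = scm A n (sqitR R m) - Z.
  elim: m => [|m [Z EZ IH]] /=.
    exists 0; first by move=> i j; rewrite mxE; exact: csub0.
    by rewrite subr0 /scm scale0r raddf0.
  set u := sqitR R m in IH *.
  exists (hf *m (scm A n r^-1 *m X + scm A n u *m Z + scm A n u *m Z - Z *m Z)).
    apply: (EM_s); apply: (EM_D); last by apply: (EM_N); exact: (EM_M).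
    by apply: (EM_D); [apply: (EM_D)|]; exact: EM_s.
  rewrite IH -[_ * (scm A n u - Z)]/(_ *m (scm A n u - Z)) -[hf * _]/(hf *m _).
  rewrite mulmxBr !mulmxBl scmM -scmC /K.
  have -> : (1 + u ^+ 2) / 2 = 2^-1 * (1 + u * u) by rewrite mulrC expr2.
  rewrite -(scmM A n 2^-1 (1 + u * u)) -mulmxBr scmD scm1; congr (hf *m _).
  move: (scm A n r^-1 *m X) (scm A n u *m Z) (Z *m Z) (scm A n (u * u)) => x1 x2 x3 x4.
  by rewrite -[x4 - x2 - _]addrA -opprD addrACA -opprD !addrA.
have sy : adj y = y.
  apply: (@ncvg_unique R _ (@mxN R A n n) _ _ _ _ (fun m => sqit hf K m)).
  - exact: mxN_eq0.
  - exact: mxN_ge0.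
  - exact: mxND.
  - exact: mxNN.
  - move=> e /yl[n0 h]; exists n0 => m /h; rewrite -mxN_adj adjD adjN.
    suff -> : adj (sqit hf K m) = sqit hf K m by [].
    elim: m => [|m IH] /=; first by apply/matrixP => i j; rewrite adjE !mxE star0.
    rewrite -[hf * _]/(hf *m _) -[sqit hf K m * _]/(sqit hf K m *m _).
    by rewrite adjM adj_scm -scmC adjD sK adjM IH.
  - exact: yl.
pose Y := scm A n (Num.sqrt r) *m (1%:M - y).
have sY : adj Y = Y.
  by rewrite adjM adj_scm adjD adjN sy adj1 -scmC.
exists Y.
  apply: (EM_s) => i j; apply: (csubL hE) => e e0.
  have e20 : 0 < e / 4 by rewrite divr_gt0.
  have [n0 h0] := yl _ e20; have [n1 h1] := @inv_nat_small R 2 _ e20.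
  pose m := maxn n0 n1; have [Z EZ hZ] := it m; exists (Z i j) => //.
  have [/andP[u0 u1] u2] := sqitR_bound R m.
  have -> : (1%:M - y) i j - Z i j =
     (1 - sqitR R m)%:C *: (1%:M : 'M[A]_n) i j + (sqit hf K m - y) i j.
    have -> : (1 - sqitR R m)%:C *: (1%:M : 'M[A]_n) i j = (1%:M - scm A n (sqitR R m)) i j.
      by rewrite -scmE mulmx1 /scm rmorphB/= scalerBl raddfB /= rmorph1 scale1r.
    have mxD (X' Y' : 'M[A]_n) : (X' + Y') i j = X' i j + Y' i j by rewrite mxE.
    have -> : - Z i j = (- Z) i j by rewrite mxE.
    rewrite -!mxD hZ; congr (fun_of_matrix _ i j).
    by rewrite -[_ - Z - y]addrA [X in _ = X]addrA subrK -addrA [- y - Z]addrC.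
  have k1 : nrm ((1 - sqitR R m)%:C *: (1%:M : 'M[A]_n) i j) <= e / 4.
    rewrite nrmZp ?subr_ge0//; apply: (@le_trans _ _ (1 - sqitR R m)).
      rewrite ler_piMr ?subr_ge0// mxE; case: eqP => _; first by rewrite nrm1.
      by rewrite nrm0.
    by apply: (le_trans u2); apply: h1; exact: leq_maxr.
  have k2 : nrm ((sqit hf K m - y) i j) <= e / 4.
    by rewrite (le_trans (mxN_entry _ i j))// h0// leq_maxl.
  by rewrite (le_lt_trans (nrmD _ _))//; lra.
rewrite sY /Y -mulmxA [(1%:M - y) *m _]mulmxA -[(1%:M - y) *m scm _ _ _]scmC.
rewrite -!mulmxA [(1%:M - y) *m (1%:M - y)]yy mulmxA scmM sqrtrM_self ?(ltW r0)//.
rewrite (_ : 1 - K = scm A n r^-1 *m X); last by rewrite /K opprB addrC addrNK.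
by rewrite mulmxA scmM mulfV ?gt_eqF// scm1 mul1mx.
Qed.

End FormPositive.

(** * Completely positive maps *)

Section CompletelyPositive.
Variables (R : realType) (A : cstarAlgType R).
Implicit Types (a b c d h t : A) (r : R) (B : set A).

(** The form criterion for complete positivity. It asks for no root in a target algebra, and is
    easily checked for averages and limits of maps. *)
Definition cpform (phi : A -> A) : Prop := forall n (y x : 'I_n -> A),
  psd (\sum_i \sum_j star (x i) * phi (star (y i) * y j) * x j).

Section OneMap.
Variable phi : A -> A.
Hypothesis phiL : linear phi.
Hypothesis phiP : cpform phi.

Lemma lin_D a b : phi (a + b) = phi a + phi b.
Proof. by have := phiL 1 a b; rewrite !scale1r. Qed.

Lemma lin_0 : phi 0 = 0.
Proof. by apply: (addrI (phi 0)); rewrite -lin_D !addr0. Qed.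

Lemma lin_Z (z : R[i]) a : phi (z *: a) = z *: phi a.
Proof. by have := phiL z a 0; rewrite lin_0 !addr0. Qed.

Lemma lin_N a : phi (- a) = - phi a.
Proof. by rewrite -scaleN1r lin_Z scaleN1r. Qed.

Lemma lin_B a b : phi (a - b) = phi a - phi b.
Proof. by rewrite lin_D lin_N. Qed.

Lemma lin_sum (I : Type) (s : seq I) (P : pred I) (F : I -> A) :
  phi (\sum_(i <- s | P i) F i) = \sum_(i <- s | P i) phi (F i).
Proof. exact: (big_morph _ lin_D lin_0). Qed.

Lemma cp_psd h : psd h -> psd (phi h).
Proof.
move=> [s ss ->]; have := phiP (fun _ : 'I_1 => s) (fun=> 1).
by rewrite !big_ord1 star1 mul1r mulr1 ss.
Qed.

(** 4 h = (1 + h)^2 - (1 - h)^2, and images of positive elements are self-adjoint. *)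
Lemma cp_sa h : star h = h -> star (phi h) = phi h.
Proof.
move=> sh; have e : (2 : R)%:C *: ((2 : R)%:C *: h) = (1 + h) * (1 + h) - (1 - h) * (1 - h).
  rewrite [X in _ = X - _]mulrDl mul1r mulrDr mulr1 mulrBl mul1r mulrBr mulr1.
  rewrite -!addr_scale2; move: (h * h) => k.
  have -> : 1 + h + (h + k) = h + h + (k + 1).
    by rewrite [1 + h]addrC addrACA [1 + k]addrC.
  have -> : 1 - h - (h - k) = k + 1 - (h + h).
    by rewrite opprB addrACA -opprD [1 + k]addrC.
  by rewrite opprB [RHS]addrACA subrr addr0.
have h1 : star (phi ((2 : R)%:C *: ((2 : R)%:C *: h))) = phi ((2 : R)%:C *: ((2 : R)%:C *: h)).
  rewrite e lin_B starB !(psd_sa (cp_psd (psd_sqr _)))//.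
    by rewrite starB star1 sh.
  by rewrite starD star1 sh.
have n2 : (2 : R)%:C != 0 :> R[i] by rewrite eq_complex /= pnatr_eq0.
by move: h1; rewrite !lin_Z !starZr => /(scalerI n2)/(scalerI n2).
Qed.

Lemma cp_star a : phi (star a) = star (phi a).
Proof.
pose z : R[i] := 0 +i* 1; have zz : z * z = -1 by rewrite /z; simpc.
have cz : conjc z = - z by rewrite /z; simpc.
pose u := a + star a; pose w := z *: (a - star a).
have su : star u = u by rewrite starD starK addrC.
have sw : star w = w by rewrite starZ starB starK cz scaleNr -scalerN opprB.
have zw : z *: w = star a - a by rewrite scalerA zz scaleN1r opprB.
have e1 : (2 : R)%:C *: a = u - z *: w.
  by rewrite zw opprB /u addrC [a + star a]addrC addrA subrK addr_scale2.
have e2 : (2 : R)%:C *: star a = u + z *: w.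
  by rewrite zw /u addrC addrA subrK addr_scale2.
have n2 : (2 : R)%:C != 0 :> R[i] by rewrite eq_complex /= pnatr_eq0.
have r1 : (2 : R)%:C *: phi (star a) = phi u + z *: phi w.
  by rewrite -lin_Z e2 lin_D lin_Z.
have r2 : (2 : R)%:C *: phi a = phi u - z *: phi w.
  by rewrite -lin_Z e1 lin_B lin_Z.
apply: (scalerI n2); rewrite r1 -starZr r2.
by rewrite starB starZ !cp_sa// cz scaleNr opprK.
Qed.

(** X is a sum over the rows of Y of matrices with entries Y_ki^* Y_kj, and the criterion applies to
    each; [mx_sqrt] then gives a root over E. *)
Lemma cpform_completely_positive (E : set A) : csub E -> (forall a, E (phi a)) ->
  completely_positive star star setT E phi.
Proof.
move=> hE Ephi n X [Y _ XY].
have Xij i j : X i j = \sum_k star (Y k i) * Y k j.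
  by rewrite XY mxE; apply: eq_bigr => k _; rewrite !mxE.
have [|||V EV hV] := @mx_sqrt R A E n (map_mx phi X) hE.
- by move=> i j; rewrite mxE.
- apply/matrixP => i j; rewrite adjE !mxE -cp_star; congr phi.
  by rewrite !Xij star_sum; apply: eq_bigr => k _; rewrite starM starK.
- move=> w; rewrite mformE.
  have -> : \sum_i \sum_j star (w i 0) * map_mx phi X i j * w j 0 =
      \sum_k \sum_i \sum_j star (w i 0) * phi (star (Y k i) * Y k j) * w j 0.
    rewrite [RHS]exchange_big; apply: eq_bigr => i _ /=.
    rewrite [RHS]exchange_big; apply: eq_bigr => j _ /=.
    by rewrite mxE Xij lin_sum mulr_sumr mulr_suml.
  by apply: psd_sum => k _; exact: (phiP (fun i => Y k i) (fun i => w i 0)).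
by exists V.
Qed.

(** The criterion for y = (1, b) and x = (- phi(b), 1), to which the conjugate of 1 - phi(1) by
    phi(b) is added. This is the Kadison-Schwarz inequality. *)
Lemma cp_schwarz b : psd (1 - phi 1) -> psd (phi (star b * b) - star (phi b) * phi b).
Proof.
move=> p1; pose y (i : 'I_2) : A := if i == ord0 then 1 else b.
pose x (i : 'I_2) : A := if i == ord0 then - phi b else 1.
have := phiP y x; rewrite !big_ord_recl !big_ord0 /x /y /= !addr0.
rewrite !star1 !mul1r !mulr1 starN cp_star !mulrN !mulNr opprK => h.
have := psdD h (psd_conj (phi b) p1).
rewrite mulrBr mulrBl mulr1; congr psd.
move: (_ * phi 1 * _) (star (phi b) * phi b) (phi (star b * b)) => p q k.
by rewrite addrAC -[q - p]opprB subrr add0r addrC.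
Qed.

Lemma cp_sqr_bound b : psd (1 - phi 1) ->
  psd ((nrm b ^+ 2)%:C *: phi 1 - star (phi b) * phi b).
Proof.
move=> p1; apply: psd_trans (cp_schwarz b p1) _.
by rewrite -lin_Z -lin_B; apply/cp_psd/psd_nrm_starM.
Qed.

Lemma cp_contractive b : psd (1 - phi 1) -> nrm (phi b) <= nrm b.
Proof.
move=> p1; apply: nrm_sqr_le; first exact: nrm_ge0.
apply: psd_trans (cp_sqr_bound b p1) _; rewrite -scalerBr.
by apply: psdZ => //; rewrite exprn_ge0// nrm_ge0.
Qed.

End OneMap.

(** The left side is one term in the binomial expansion of (t + (1 - t))^(m+1). The induction keeps
    the term (1 - t)^(m+1) as well. *)
Lemma pow_mul_le (t : R) m : 0 <= t <= 1 -> m.+1%:R * (t * (1 - t) ^+ m) <= 1.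
Proof.
move=> /andP[t0 t1]; have s0 : 0 <= 1 - t by rewrite subr_ge0.
suff : m.+1%:R * (t * (1 - t) ^+ m) + (1 - t) ^+ m.+1 <= 1.
  by apply: le_trans; rewrite lerDl exprn_ge0.
elim: m => [|m IH]; first by rewrite expr0 expr1; lra.
apply: le_trans IH; rewrite -[m.+2%:R]natr1 mulrDl mul1r -addrA.
have -> : t * (1 - t) ^+ m.+1 + (1 - t) ^+ m.+2 = (1 - t) ^+ m.+1.
  by rewrite [_ ^+ m.+2]exprS; ring.
rewrite lerD2r ler_wpM2l// ler_wpM2l// exprS ler_piMl ?exprn_ge0//.
by rewrite gerBl.
Qed.

Lemma psd_cut_small d m : psd d -> psd (1 - d) ->
  nrm ((1 - d) ^+ m * d * (1 - d) ^+ m) <= m.+1%:R^-1.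
Proof.
move=> pd p1; have sd := psd_sa pd.
have d1 : nrm d <= 1 by apply: psd_nrm_le => //; rewrite scale1r.
have p1E : pev (1 - 'X) d = 1 - d.
  by rewrite pevB pevX -[1]/(1%:P) pevC scale1r.
have pXE k : pev ((1 - 'X) ^+ k) d = (1 - d) ^+ k.
  by elim: k => [|k IH]; rewrite ?expr0 -?[1]/(1%:P) ?pevC ?scale1r// !exprS pevM p1E IH.
rewrite -pXE -{2}(pevX d) -!pevM; apply: pev_nrm_le => // t ht.
have t0 := spectrum_psd_ge0 pd ht.
have t1 : t <= 1 by rewrite (le_trans _ d1)// (le_trans (ler_norm _))// spectrum_le.
have s0 : 0 <= 1 - t by rewrite subr_ge0.
rewrite !hornerM !horner_exp hornerD hornerN hornerX hornerC.
have e0 : 0 <= (1 - t) ^+ m by rewrite exprn_ge0.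
have e1 : (1 - t) ^+ m <= 1 by rewrite exprn_ile1// gerBl.
rewrite ger0_norm ?mulr_ge0// -[leRHS]mul1r ler_pdivlMr ?ltr0Sn//.
have := @pow_mul_le t m; rewrite t0 t1 => /(_ isT) h.
have : 0 <= m.+1%:R * (t * (1 - t) ^+ m) by rewrite !mulr_ge0.
move: h; set q := _ * (t * _) => h q0.
have -> : (1 - t) ^+ m * t * (1 - t) ^+ m * m.+1%:R = (1 - t) ^+ m * q.
  by rewrite /q; ring.
by rewrite mulr_ile1.
Qed.

(* [1 - (1 - d)^m = d (sum_(i < m) (1 - d)^i)] is an approximate unit of the
   hereditary subalgebra generated by d. *)
Lemma corner_mem B d t M : csub B -> B 1 -> B d -> B t -> psd d -> psd (1 - d) ->
  psd (M%:C *: d - star t * t) -> psd (M%:C *: d - t * star t) -> corner B d t.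
Proof.
move=> hB B1 Bd Bt pd p1 h1 h2.
have sd := psd_sa pd; have sc : star (1 - d) = 1 - d := psd_sa p1.
have c1 : nrm (1 - d) <= 1.
  by apply: psd_nrm_le => //; rewrite scale1r opprB addrC subrK.
have key m s : psd (M%:C *: d - star s * s) ->
    nrm (s * (1 - d) ^+ m) ^+ 2 <= `|M| / m.+1%:R.
  move=> hs; rewrite -nrm_starM; set c := (1 - d) ^+ m.
  have sc' : star c = c by rewrite starX sc.
  have /psd_mono := psd_conj c hs; rewrite mulrBr mulrBl => hh.
  have p0 : psd (star (s * c) * (s * c)) by exact: psd_starM.
  have e1 : star (s * c) * (s * c) = star c * (star s * s) * c.
    by rewrite starM !mulrA.
  have := psd_conj c hs; rewrite mulrBr mulrBl -e1 => /(psd_mono p0) h.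
  apply: (le_trans h); rewrite -scalerAr -scalerAl nrmZr sc'.
  by rewrite ler_wpM2l// psd_cut_small.
apply/closure_nrmP => e e0.
have e20 : 0 < (e / 4) ^+ 2 by rewrite exprn_gt0// divr_gt0.
have [m hm] := @inv_nat_small R `|M| _ e20; have {}hm := hm m (leqnn m).
have bnd s : psd (M%:C *: d - star s * s) -> nrm (s * (1 - d) ^+ m) <= e / 4.
  move=> /(key m) h; have := le_trans h hm.
  by rewrite ler_pXn2r ?nnegrE ?nrm_ge0// ltW// divr_gt0.
set c := (1 - d) ^+ m in bnd; pose q := \sum_(i < m) (1 - d) ^+ i.
have sc' : star c = c by rewrite starX sc.
have k1 := bnd _ h1.
have k2 : nrm (c * t) <= e / 4.
  by rewrite -nrm_star starM sc'; apply: bnd; rewrite starK.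
have dq : d * q = 1 - c.
  have := subrX1 (1 - d) m; rewrite -/c -/q [1 - d - 1]addrAC subrr sub0r mulNr.
  by move=> /(congr1 -%R); rewrite opprB opprK => ->.
have qd : q * d = 1 - c.
  rewrite -dq; apply/commr_sym/commr_sum => i _; apply/commrX/commrB => //.
  exact: commr1.
have Bc : B (1 - d) by exact: csubB.
have BX i : B ((1 - d) ^+ i).
  by elim: i => [|i IH]; rewrite ?expr0// exprS; apply: csubM.
have Bq : B q by apply: csub_sum => // i _.
exists (d * (q * t * q) * d).
  by exists (q * t * q) => //; apply: csubM => //; exact: csubM.
(* As d q = q d = 1 - c, the approximant is (1 - c) t (1 - c), and both c t and t c are small by
   [key]. *)
have -> : t - d * (q * t * q) * d = c * t + (1 - c) * (t * c).
  have wE : (1 - c) * t = t - c * t by rewrite mulrBl mul1r.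
  rewrite !mulrA dq -[_ * q * d]mulrA qd [X in t - X]mulrBr mulr1 opprB [RHS]addrC.
  by rewrite addrCA; congr (_ + _); rewrite wE opprB addrC subrK.
have nc : nrm c <= 1 by exact: nrmX.
have n2 : nrm (1 - c) <= 2 by rewrite (le_trans (nrmB _ _))// nrm1; lra.
rewrite (le_lt_trans (nrmD _ _))//.
have := nrmM (1 - c) (t * c).
have : nrm (1 - c) * nrm (t * c) <= 2 * (e / 4) by rewrite ler_pM// nrm_ge0.
lra.
Qed.

(** By the Schwarz inequality phi(a)^* phi(a) and phi(a) phi(a)^* are at most |a|^2 d, so
    [corner_mem] places all values in the corner, and the matrix roots can be taken there. *)
Lemma cpform_cpc B d phi : csub B -> B 1 -> B d -> psd d -> psd (1 - d) ->
  linear phi -> cpform phi -> phi 1 = d -> (forall a, B (phi a)) ->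
  cpc (corner B d) phi.
Proof.
move=> hB B1 Bd pd p1 phiL phiP phi1 Bphi.
have p1' : psd (1 - phi 1) by rewrite phi1.
have mem a : corner B d (phi a).
  apply: (@corner_mem _ _ _ (nrm a ^+ 2)) => //.
    by rewrite -phi1; exact: cp_sqr_bound.
  have := cp_sqr_bound phiL phiP (star a) p1'.
  by rewrite cp_star// starK phi1 nrm_star.
split=> //.
- by apply: cpform_completely_positive => //; apply: csub_corner => //; exact: psd_sa.
- by move=> a; exact: cp_contractive.
Qed.

End CompletelyPositive.

Lemma compact_net (T : topologicalType) (K : set T) (U : T -> set T) : compact K ->
  (forall x, K x -> nbhs x (U x)) ->
  exists s : seq T, (forall x, x \in s -> K x) /\
    forall g, K g -> exists2 x, x \in s & U x g.
Proof.
move=> /compact_near_coveringP cK hU.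
(* The filter of all lists containing a given list: a near covering along it yields one finite list
   good for every point of K. *)
pose F : set_system (seq T) := [set P : set (seq T) | exists s0 : seq T, forall s : seq T, {subset s0 <= s} -> P s].
have FF : Filter F.
  split; first by exists [::].
    move=> P Q [s hs] [t ht]; exists (s ++ t) => r hr; split.
      by apply: hs => x xs; apply: hr; rewrite mem_cat xs.
    by apply: ht => x xt; apply: hr; rewrite mem_cat xt orbT.
  by move=> P Q PQ [s hs]; exists s => t /hs/PQ.
have [] := cK _ F (fun s g => exists2 x, x \in s & K x /\ U x g) FF.
  move=> x Kx; exists (U x, [set s : seq T | x \in s]).
    split; first exact: hU.
    by exists [:: x] => s; apply; rewrite inE.
  by move=> [g s] [/= Ug xs]; exists x.
move=> s /(_ s (fun=> id)) hs.
exists [seq x <- s | `[< K x >]]; split.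
  by move=> x; rewrite mem_filter => /andP[/asboolP].
move=> g /hs[x xs [Kx Ux]]; exists x => //.
by rewrite mem_filter xs andbT; apply/asboolP.
Qed.

(** * The conditional expectation onto the fixed point algebra *)

Section Averaging.
Variables (R : realType) (G : topologicalGroupType) (A : cstarAlgType R).
Variable al : G -> A -> A.
Hypothesis alP : is_action al.
Hypothesis compG : compact [set: G].
Implicit Types (g h x y l : G) (a b : A) (X Y : seq G) (L : seq A) (e r : R).

Lemma near_orbit L e g : 0 < e ->
  nbhs g [set h | forall a, a \in L -> nrm (al h a - al g a) < e].
Proof.
move=> e0; elim: L => [|b L IH].
  by apply: filterS filterT => h _ a; rewrite in_nil.
have hb : nbhs g [set h | nrm (al g b - al h b) < e].
  have h : nbhs (al g b) [set w | nrm (al g b - w) < e].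
    by apply/nbhs_nrmP; exists e.
  exact: (act_continuous alP h).
apply: filterS (filterI IH hb) => h [h1 h2] a; rewrite inE => /orP[/eqP ->|aL].
  by rewrite nrmBC.
exact: h1.
Qed.

Lemma orbit_net L e : 0 < e -> exists X, forall g, exists2 x, x \in X &
  forall a, a \in L -> nrm (al g a - al x a) <= e.
Proof.
move=> e0.
have [X [_ hX]] := compact_net compG (fun g _ => near_orbit L g e0).
exists X => g; have [x xX hx] := hX g I; exists x => // a /hx; exact: ltW.
Qed.

(** Averages of a are built from translates of a, so the net must serve the whole orbits. They are
    approximated by finitely many translates, to which [orbit_net] applies. *)
Lemma orbit_net2 L e : 0 < e -> exists X, forall g, exists2 x, x \in X &
  forall a l, a \in L -> nrm (al g (al l a) - al x (al l a)) <= e.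
Proof.
move=> e0; have e30 : 0 < e / 3 by rewrite divr_gt0.
have [Y hY] := orbit_net L e30.
have [X hX] := orbit_net [seq al y a | y <- Y, a <- L] e30.
exists X => g; have [x xX hx] := hX g; exists x => // a l aL.
have [y yY hy] := hY l; have {}hx := hx (al y a) (allpairs_f _ yY aL).
have {}hy := hy a aL.
rewrite (le_trans (nrm_tri (al g (al y a)) _ _))//.
have := nrm_tri (al x (al y a)) (al g (al y a)) (al x (al l a)).
rewrite -[al g (al l a) - _](alB alP) -[al x (al y a) - al x (al l a)](alB alP) !(nrm_al alP).
rewrite [nrm (al y a - _)]nrmBC; lra.
Qed.

Definition mean (F : G -> A) X : A := ((size X)%:R^-1 : R)%:C *: \sum_(x <- X) F x.

Lemma mean_lin (F F' : G -> A) X (z : R[i]) :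
  mean (fun x => z *: F x + F' x) X = z *: mean F X + mean F' X.
Proof.
rewrite /mean big_split /= scalerDr; congr (_ + _).
by rewrite -scaler_sumr !scalerA mulrC.
Qed.

Lemma mean_morph (u : A -> A) (F : G -> A) X : linear u ->
  u (mean F X) = mean (fun x => u (F x)) X.
Proof. by move=> uL; rewrite /mean (lin_Z uL) (lin_sum uL). Qed.

Lemma meanB (F F' : G -> A) X : mean F X - mean F' X = mean (fun x => F x - F' x) X.
Proof. by rewrite /mean -scalerBr -sumrB. Qed.

Lemma size_gt0R X : X != [::] -> 0 < (size X)%:R :> R.
Proof. by case: X. Qed.

Lemma nrm_mean (F : G -> A) X r : X != [::] ->
  (forall x, x \in X -> nrm (F x) <= r) -> nrm (mean F X) <= r.
Proof.
move=> X0 hF; have s0 := size_gt0R X0.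
rewrite nrmZp ?invr_ge0// ler_pdivrMl// (le_trans (nrm_sum _ _ _))//.
have -> : (size X)%:R * r = \sum_(x <- X) r.
  by rewrite big_const_seq count_predT iter_addr_0 mulr_natl.
rewrite big_seq [leRHS]big_seq.
exact: ler_sum.
Qed.

Lemma mean_cst a X : X != [::] -> mean (fun=> a) X = a.
Proof.
move=> X0; rewrite /mean big_const_seq count_predT iter_addr_0 addr_scaleN scaleRA.
by rewrite mulVf ?scale1r// gt_eqF// size_gt0R.
Qed.

Lemma nrm_sum_dist (F F' : G -> A) r (s t : seq G) : size s = size t ->
  (forall x y, nrm (F x - F' y) <= r) ->
  nrm (\sum_(x <- s) F x - \sum_(y <- t) F' y) <= (size s)%:R * r.
Proof.
move=> st hr; elim: s t st => [|x s IH] [|y t]//=.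
  by move=> _; rewrite !big_nil subrr nrm0 mul0r.
move=> [/IH h]; rewrite !big_cons opprD addrACA (le_trans (nrmD _ _))//.
by rewrite -natr1 mulrDl mul1r [leRHS]addrC lerD ?hr.
Qed.

(* One matched pair of points is enough for the average to contract. *)
Lemma mean_contract (F F' : G -> A) X x0 x1 r e : x0 \in X -> x1 \in X ->
  nrm (F x0 - F' x1) <= e -> (forall x y, nrm (F x - F' y) <= r) ->
  nrm (mean F X - mean F' X) <= (e + ((size X)%:R - 1) * r) / (size X)%:R.
Proof.
move=> h0 h1 he hr.
have X0 : X != [::] by case: (X) h0.
have s0 := size_gt0R X0.
rewrite /mean -scalerBr nrmZp ?invr_ge0// mulrC ler_pM2r ?invr_gt0//.
rewrite (perm_big _ (perm_to_rem h0)) [X in nrm (_ - X)](perm_big _ (perm_to_rem h1)) /=.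
rewrite !big_cons opprD addrACA (le_trans (nrmD _ _))// lerD//.
have sz : size (rem x0 X) = size (rem x1 X) by rewrite !size_rem.
apply: (le_trans (nrm_sum_dist sz hr)); rewrite size_rem// -subn1 natrB//.
by case: (X) X0.
Qed.

Definition avg (T : A -> A) : Prop :=
  exists2 X, X != [::] & T = fun a => mean (fun x => al x a) X.

Lemma avg_lin T : avg T -> linear T.
Proof.
move=> [X _ ->] z a b /=; rewrite -mean_lin; congr mean.
by apply/funext => x; rewrite (act_lin alP).
Qed.

Lemma avg_id : avg id.
Proof.
exists [:: 1%g] => //; apply/funext => a.
by rewrite /mean big_seq1 invr1 scale1r (act_1 alP).
Qed.

Lemma avg_comp T T' : avg T -> avg T' -> avg (T \o T').
Proof.
move=> aT [Y Y0 ->]; have TL := avg_lin aT; move: aT TL => [X X0 ->] TL.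
exists [seq (x * y)%g | x <- X, y <- Y].
  by case: X X0 {TL} => // x X _; case: Y Y0.
apply/funext => a; rewrite /= /mean size_allpairs big_allpairs_dep natrM invfM -scaleRA.
congr (_ *: _); rewrite [RHS]scaler_sumr; apply: eq_bigr => x _.
rewrite (alZ alP) (al_sum alP); congr (_ *: _); apply: eq_bigr => y _.
by rewrite (act_M alP).
Qed.

Lemma avg_nrm T a : avg T -> nrm (T a) <= nrm a.
Proof. by move=> [X X0 ->]; apply: nrm_mean => // x _; rewrite (nrm_al alP). Qed.

Lemma avg_dist T a b r : avg T -> (forall x, nrm (al x a - b) <= r) -> nrm (T a - b) <= r.
Proof.
move=> [X X0 ->] h; rewrite -{1}(mean_cst b X0) meanB; exact: nrm_mean.
Qed.

Lemma avg_swap_dist T T' a b r : linear T -> avg T' ->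
  (forall x, nrm (T (al x a) - b) <= r) -> nrm (T (T' a) - b) <= r.
Proof.
move=> TL [X X0 ->] h; rewrite (mean_morph _ _ TL) -{1}(mean_cst b X0) meanB.
exact: nrm_mean.
Qed.

(** T a is almost invariant, and T is almost constant on the orbit of a. The two clauses play the
    roles of left and right invariant means, which must agree. *)
Definition good T a e : Prop :=
  (forall g h, nrm (al g (T a) - al h (T a)) <= e) /\
  (forall g h, nrm (T (al g a) - T (al h a)) <= e).

(** If x1 is a net point for h^-1 g x0, the summand of x0 moved by g and that of x1 moved by h
    differ by at most e. All other pairs differ by at most r, and averaging gives r'. The second
    clause is the mirror image, with a net point for x0 g h^-1. *)
Lemma good_step L e X T a r :
  (forall g, exists2 x, x \in X &
    forall a l, a \in L -> nrm (al g (al l a) - al x (al l a)) <= e) ->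
  X != [::] -> a \in L -> avg T -> good T a r ->
  let M := fun a => mean (fun x => al x a) X in
  let r' := (e + ((size X)%:R - 1) * r) / (size X)%:R in
  (forall g h, nrm (al g (M (T a)) - al h (M (T a))) <= r') /\
  (forall g h, nrm (T (M (al g a)) - T (M (al h a))) <= r').
Proof.
move=> net X0 aL aT [r1 r2] M r'; have TL := avg_lin aT.
have alL g : linear (al g) by move=> z b c; exact: (act_lin alP).
have [x0 x0X] : exists x, x \in X by case: (X) X0 => // x X' _; exists x; rewrite inE eqxx.
split=> g h; rewrite /M.
  rewrite !(mean_morph _ _ (alL _)).
  have [x1 x1X hx1] := net (h^-1 * g * x0)%g.
  apply: (@mean_contract _ _ _ x0 x1) => //; last first.
    by move=> x y; rewrite -!(act_M alP).
  rewrite -(nrm_al alP h^-1%g) (alB alP) (alK alP) -!(act_M alP) ?mulgA.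
  move: aT => [Y Y0 ->]; rewrite !(mean_morph _ _ (alL _)) meanB.
  by apply: nrm_mean => // y _; exact: hx1.
rewrite !(mean_morph _ _ TL).
have [x1 x1X hx1] := net (x0 * g * h^-1)%g.
apply: (@mean_contract _ _ _ x0 x1) => //; last first.
  by move=> x y; rewrite -!(act_M alP).
rewrite -(lin_B TL) (le_trans (avg_nrm _ aT))//.
by have := hx1 a h aL; rewrite -!(act_M alP) mulgVK.
Qed.

(** Iteration of the contraction r -> (e/2 + (N - 1) r) / N, where N is the size of X: its fixed
    point is e/2, its factor q = 1 - 1/N, and D bounds the initial spread of every a in L. *)
Lemma good_ex L e : 0 < e -> exists2 T, avg T & forall a, a \in L -> good T a e.
Proof.
move=> e0; have e20 : 0 < e / 2 by rewrite divr_gt0.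
have [X net] := orbit_net2 L e20.
have X0 : X != [::] by have [x] := net 1%g; case: (X).
pose M := fun a => mean (fun x => al x a) X.
have aM : avg M by exists X.
pose D := \sum_(a <- L) 2 * nrm a.
have D0 : 0 <= D by apply: sumr_ge0 => a _; rewrite mulr_ge0// nrm_ge0.
have aD a : a \in L -> 2 * nrm a <= D.
  move=> aL; rewrite /D (perm_big _ (perm_to_rem aL)) big_cons /= lerDl.
  by apply: sumr_ge0 => b _; rewrite mulr_ge0// nrm_ge0.
have s0 := size_gt0R X0; set n := (size X)%:R in s0.
have n1 : 1 <= n by rewrite ler1n; case: (X) X0.
pose q := 1 - n^-1.
have q0 : 0 <= q by rewrite subr_ge0 invf_le1.
have q1 : q < 1 by rewrite ltrBlDr ltrDl invr_gt0.
have aI k : avg (iter k M).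
  elim: k => [|k IH]; first by have := avg_id; congr avg; apply/funext.
  by have := avg_comp aM IH; congr avg; apply/funext.
have gI a k : a \in L -> good (iter k M) a (e / 2 + q ^+ k * D).
  move=> aL; elim: k => [|k IH].
    rewrite expr0 mul1r; have h1 g h : nrm (al g a - al h a) <= e / 2 + D.
      rewrite (le_trans (nrmB _ _))// !(nrm_al alP).
      by have := aD a aL; have := ltW e20; lra.
    by split => g h; exact: h1.
  have [h1 h2] := good_step net X0 aL (aI k) IH.
  have E : (e / 2 + (n - 1) * (e / 2 + q ^+ k * D)) / n = e / 2 + q ^+ k.+1 * D.
    by rewrite exprS /q; field; rewrite gt_eqF.
  rewrite -/n E in h1 h2.
  by split => g h; [exact: h1|rewrite !iterSr; exact: h2].
have [k hk] : exists k, q ^+ k * D <= e / 2.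
  have D1 : 0 < D + 1 by rewrite ltr_wpDl.
  have d0 : 0 < e / 2 / (D + 1) by rewrite divr_gt0.
  have /cvgrPdist_le/(_ _ d0)[k _ h] : (q ^+ n @[n --> \oo] --> 0).
    by apply: cvg_expr; rewrite ger0_norm.
  exists k; have := h k (leqnn k); rewrite sub0r normrN ger0_norm ?exprn_ge0//.
  rewrite ler_pdivlMr//; apply: le_trans; rewrite ler_wpM2l ?exprn_ge0//.
  by rewrite lerDl.
exists (iter k M) => // a aL; have [h1 h2] := gI a k aL.
have hh : e / 2 + q ^+ k * D <= e by rewrite [leRHS]splitr lerD2l.
by split => g h; [exact: le_trans (h1 g h) hh|exact: le_trans (h2 g h) hh].
Qed.

(** Both are compared with T (T' a): it is near T a as T is almost constant on the orbit, and near
    T' a as T' a is almost invariant. *)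
Lemma good_close T T' a e e' : avg T -> avg T' -> good T a e -> good T' a e' ->
  nrm (T a - T' a) <= e + e'.
Proof.
move=> aT aT' [_ h] [h' _]; rewrite (le_trans (nrm_tri (T (T' a)) _ _))// lerD//.
  rewrite nrmBC; apply: (@avg_swap_dist T T' a (T a) e) => //; first exact: avg_lin.
  by move=> x; have := h x 1%g; rewrite (act_1 alP).
by apply: avg_dist => // x; have := h' x 1%g; rewrite (act_1 alP).
Qed.

Lemma expectation_ex : exists E : A -> A, forall a T e, 0 < e ->
  avg T -> good T a e -> nrm (T a - E a) <= e.
Proof.
suff h a : exists l : A, forall T e, 0 < e -> avg T -> good T a e -> nrm (T a - l) <= e.
  by have [E hE] := choice h; exists E.
have hT n : exists T, avg T /\ good T a (n.+1%:R^-1).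
  have [|T aT gT] := @good_ex [:: a] n.+1%:R^-1; first by rewrite invr_gt0.
  by exists T; split => //; apply: gT; rewrite inE.
have [T hTn] := choice hT.
have [l hl] : exists l : A, ncvg (@nrm R A) (fun n => T n a) l.
  apply: ncauchy_nrm_cvg => e e0; have e20 : 0 < e / 2 by rewrite divr_gt0.
  have [n0 h0] := @inv_nat_small R 1 _ e20; exists n0 => m n hm hn.
  have [[aT gT] [aT' gT']] := (hTn m, hTn n).
  rewrite (le_trans (good_close aT aT' gT gT'))// [leRHS]splitr lerD//.
    by have := h0 m hm; rewrite div1r.
  by have := h0 n hn; rewrite div1r.
exists l => S e e0 aS gS; apply/ler_addgt0Pr => d d0.
have d20 : 0 < d / 2 by rewrite divr_gt0.
have [n0 h0] := @inv_nat_small R 1 _ d20; have [n1 h1] := hl _ d20.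
pose n := maxn n0 n1; have [aT gT] := hTn n.
rewrite (le_trans (nrm_tri (T n a) _ _))//.
have k1 : nrm (S a - T n a) <= e + d / 2.
  rewrite (le_trans (good_close aS aT gS gT))// lerD2l -div1r.
  exact: h0 (leq_maxl _ _).
have := h1 n (leq_maxr _ _); lra.
Qed.

End Averaging.

(** * Invariance, linearity and complete positivity of the expectation *)

Section Expectation.
Variables (R : realType) (G : topologicalGroupType) (A : cstarAlgType R).
Variable al : G -> A -> A.
Hypothesis alP : is_action al.
Hypothesis compG : compact [set: G].
Variable E : A -> A.
Hypothesis hE : forall a T (e : R), 0 < e -> avg al T -> good al T a e -> nrm (T a - E a) <= e.
Implicit Types (g h x y : G) (a b : A) (L : seq A) (e r : R).

Lemma eq0_small a (C : R) : (forall e, 0 < e -> nrm a <= C * e) -> a = 0.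
Proof.
move=> h; apply: nrm_eq0; apply/eqP; rewrite eq_le nrm_ge0 andbT.
apply/ler_addgt0Pr => e e0; rewrite add0r.
have C0 : 0 < `|C| + 1 by rewrite ltr_wpDl.
have d0 : 0 < e / (`|C| + 1) by rewrite divr_gt0.
apply: (le_trans (h _ d0)); rewrite mulrA ler_pdivrMr// mulrC ler_pM2l//.
by rewrite (le_trans (ler_norm _))// lerDl.
Qed.

(** One average serves finitely many elements at once, and through it the properties of averages are
    transferred to E. *)
Lemma expect_apx L e : 0 < e ->
  exists2 T, avg al T & forall a, a \in L -> good al T a e /\ nrm (T a - E a) <= e.
Proof.
move=> e0; have [T aT gT] := good_ex alP compG L e0; exists T => // a /gT ga.
by split => //; exact: hE.
Qed.

Lemma expect_fixed a : fixed_alg al (E a).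
Proof.
move=> g; apply/eqP; rewrite -subr_eq0; apply/eqP.
apply: (@eq0_small _ 3) => e e0.
have [T aT /(_ a)[]] := expect_apx [:: a] e0; first by rewrite inE.
move=> [h _] k; have {}h := h g 1%g; rewrite (act_1 alP) in h.
rewrite (le_trans (nrm_tri (al g (T a)) _ _))// -(alB alP) (nrm_al alP) [nrm (E a - T a)]nrmBC.
have := nrm_tri (T a) (al g (T a)) (E a); lra.
Qed.

Lemma expect_linear : linear E.
Proof.
move=> z a b; apply/eqP; rewrite -subr_eq0; apply/eqP.
apply: (@eq0_small _ (2 + complex.Re `|z|)) => e e0.
have [T aT hT] := expect_apx [:: z *: a + b; a; b] e0.
have [_ h1] := hT (z *: a + b) (mem_head _ _).
have [_ h2] : good al T a e /\ nrm (T a - E a) <= e by apply: hT; rewrite !inE eqxx orbT.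
have [_ h3] : good al T b e /\ nrm (T b - E b) <= e by apply: hT; rewrite !inE eqxx !orbT.
rewrite (le_trans (nrm_tri (T (z *: a + b)) _ _))// nrmBC.
have -> : T (z *: a + b) - (z *: E a + E b) = z *: (T a - E a) + (T b - E b).
  by rewrite (avg_lin alP aT) opprD addrACA scalerBr.
have := nrmD (z *: (T a - E a)) (T b - E b); rewrite nrmZ => h4.
have : complex.Re `|z| * nrm (T a - E a) <= complex.Re `|z| * e.
  by apply: ler_wpM2l => //; rewrite -ler0c RRe_real// ger0_real.
lra.
Qed.

Lemma expect_dist b r : (forall g, nrm (al g b - b) <= r) -> nrm (E b - b) <= r.
Proof.
move=> hb; apply/ler_addgt0Pr => e e0.
have [T aT /(_ b)[]] := expect_apx [:: b] e0; first by rewrite inE.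
move=> _ h; rewrite [leRHS]addrC (le_trans (nrm_tri (T b) _ _))// lerD ?[nrm (E b - _)]nrmBC//.
exact: (avg_dist aT).

Qed.

Lemma expect_id a : fixed_alg al a -> E a = a.
Proof.
move=> fa; apply/eqP; rewrite -subr_eq0; apply/eqP; apply: nrm_eq0; apply/eqP.
rewrite eq_le nrm_ge0 andbT; apply: expect_dist => g.
by rewrite fa subrr nrm0.
Qed.

Lemma avg_cpform T phi : avg al T -> cpform phi -> cpform (T \o phi).
Proof.
move=> [X X0 ->] cphi n y x.
have alx g : psd (\sum_i \sum_j star (x i) * al g (phi (star (y i) * y j)) * x j).
  have := al_psd alP g (cphi n y (fun i => al g^-1%g (x i))); congr psd.
  rewrite (al_sum alP); apply: eq_bigr => i _; rewrite (al_sum alP).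
  apply: eq_bigr => j _; rewrite !(act_mul alP) (act_star alP).
  by rewrite !(alKV alP).
have -> : \sum_i \sum_j star (x i) * ((fun a => mean (fun x => al x a) X) \o phi) (star (y i) * y j) * x j =
    ((size X)%:R^-1)%:C *: \sum_(g <- X) \sum_i \sum_j star (x i) * al g (phi (star (y i) * y j)) * x j.
  rewrite [in RHS]exchange_big [in RHS]scaler_sumr; apply: eq_bigr => i _ /=.
  rewrite [in RHS]exchange_big [in RHS]scaler_sumr; apply: eq_bigr => j _ /=.
  by rewrite /mean -scalerAr -scalerAl mulr_sumr mulr_suml.
apply: psdZ; first by rewrite invr_ge0.
by apply: psd_sum => g _; exact: alx.
Qed.

(** For given x and y the form involves only the n^2 elements phi(y_i^* y_j); an average close to E
    on all of them gives a positive form, and the cone is closed. *)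
Lemma expect_cpform phi : cpform phi -> cpform (E \o phi).
Proof.
move=> cphi n y x; apply: psd_clim => e e0.
pose C := \sum_i \sum_j nrm (x i) * nrm (x j).
have C0 : 0 <= C by apply: sumr_ge0 => i _; apply: sumr_ge0 => j _; rewrite mulr_ge0 ?nrm_ge0.
have d0 : 0 < e / (C + 1) by rewrite divr_gt0// ltr_wpDl.
have [T aT hT] := expect_apx [seq phi (star (y ij.1) * y ij.2) | ij <- enum {: 'I_n * 'I_n}] d0.
exists (\sum_i \sum_j star (x i) * (T \o phi) (star (y i) * y j) * x j).
  exact: avg_cpform.
apply: (@le_lt_trans _ _ (C * (e / (C + 1)))); last first.
  by rewrite mulrA ltr_pdivrMr ?ltr_wpDl// mulrC ltr_pM2l// ltrDl.
rewrite -sumrB (le_trans (nrm_sum _ _ _))// /C mulr_suml; apply: ler_sum => i _.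
rewrite -sumrB (le_trans (nrm_sum _ _ _))// mulr_suml; apply: ler_sum => j _.
rewrite -mulrBl -mulrBr (le_trans (nrmM _ _))// mulrAC.
rewrite ler_wpM2r ?nrm_ge0// (le_trans (nrmM _ _))// nrm_star ler_wpM2l ?nrm_ge0//.
rewrite nrmBC /=; apply: (hT _ _).2; apply/mapP; exists (i, j) => //.
by rewrite mem_enum.
Qed.

End Expectation.

(** * Asymptotics *)

Section Eventually.
Variable R : realType.
Implicit Types (u v : nat -> R) (r s e c : R).

(** The upper limit of u is at most r. *)
Definition rle u r : Prop :=
  forall e, 0 < e -> exists N, forall n, (N <= n)%N -> u n <= r + e.

Lemma rleD u v r s : rle u r -> rle v s -> rle (fun n => u n + v n) (r + s).
Proof.
move=> hu hv e e0; have e20 : 0 < e / 2 by rewrite divr_gt0.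
have [N hN] := hu _ e20; have [M hM] := hv _ e20; exists (maxn N M) => n.
rewrite geq_max => /andP[/hN h1 /hM h2]; lra.
Qed.

Lemma rle_le u v r s : (forall n, u n <= v n) -> r <= s -> rle v r -> rle u s.
Proof.
move=> uv rs hv e /hv[N hN]; exists N => n /hN h.
by rewrite (le_trans (uv n))// (le_trans h)// lerD2r.
Qed.

Lemma rleM c u r : 0 <= c -> rle u r -> rle (fun n => c * u n) (c * r).
Proof.
move=> c0 hu e e0; have c1 : 0 < c + 1 by rewrite ltr_wpDl.
have [N hN] := hu _ (divr_gt0 e0 c1); exists N => n /hN h.
apply: (le_trans (ler_wpM2l c0 h)); rewrite mulrDr lerD2l mulrA ler_pdivrMr//.
by rewrite mulrC ler_wpM2l ?(ltW e0)// lerDl.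
Qed.

Lemma rle_cst c : rle (fun=> c) c.
Proof. by move=> e e0; exists 0%N => n _; rewrite lerDl ltW. Qed.

Lemma rle_sum (I : Type) (s : seq I) (P : pred I) (u : I -> nat -> R) (r : I -> R) :
  (forall i, P i -> rle (u i) (r i)) ->
  rle (fun n => \sum_(i <- s | P i) u i n) (\sum_(i <- s | P i) r i).
Proof.
move=> h; elim: s => [|i s IH].
  by apply: (rle_le _ _ (rle_cst 0)) => [n|]; rewrite big_nil.
rewrite big_cons; case: ifP => Pi.
  by apply: (rle_le _ _ (rleD (h i Pi) IH)) => // n; rewrite big_cons Pi.
by apply: (rle_le _ _ IH) => // n; rewrite big_cons Pi.
Qed.

Lemma rle_inv_nat : rle (fun n => n.+1%:R^-1) 0.
Proof.
move=> e e0; have [N hN] := @inv_nat_small R 1 _ e0; exists N => n /hN.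
by rewrite div1r add0r.
Qed.

Lemma rle_seq (I : eqType) (s : seq I) (u : I -> nat -> R) r e : 0 < e ->
  (forall i, i \in s -> rle (u i) r) ->
  exists N, forall n, (N <= n)%N -> forall i, i \in s -> u i n <= r + e.
Proof.
move=> e0; elim: s => [|i s IH] h; first by exists 0%N => n _ i; rewrite in_nil.
have [|N hN] := IH; first by move=> j js; apply: h; rewrite inE js orbT.
have [M hM] := h i (mem_head _ _) e e0; exists (maxn N M) => n.
rewrite geq_max => /andP[/hN h1 /hM h2] j; rewrite inE => /orP[/eqP ->//|].
exact: h1.
Qed.

End Eventually.

(** * Null sequences and commutators with square roots *)

Section SqrtCommutator.
Variables (R : realType) (A : cstarAlgType R).
Implicit Types (a b c : A) (p u v : nat -> A) (C e r : R).

Definition null u : Prop := rle (fun n => nrm (u n)) 0.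

Lemma null_le u (w : nat -> R) : (forall n, nrm (u n) <= w n) -> rle w 0 -> null u.
Proof. by move=> h; apply: rle_le. Qed.

Lemma nullD u v : null u -> null v -> null (fun n => u n + v n).
Proof.
move=> hu hv; apply: null_le (fun n => nrmD (u n) (v n)) _.
by have := rleD hu hv; rewrite addr0.
Qed.

Lemma null_sum (I : Type) (s : seq I) (P : pred I) (u : I -> nat -> A) :
  (forall i, P i -> null (u i)) -> null (fun n => \sum_(i <- s | P i) u i n).
Proof.
move=> h; apply: null_le (fun n => nrm_sum s P (fun i => u i n)) _.
by have := @rle_sum R I s P _ (fun=> 0) h; rewrite big1.
Qed.

Lemma null_mull C u v : 0 <= C -> (forall n, nrm (v n) <= C) -> null u -> null (fun n => v n * u n).
Proof.
move=> C0 hv hu; apply: (@null_le _ (fun n => C * nrm (u n))).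
  by move=> n; rewrite (le_trans (nrmM _ _))// ler_wpM2r ?nrm_ge0.
by have := rleM C0 hu; rewrite mulr0.
Qed.

Lemma null_mulr C u v : 0 <= C -> (forall n, nrm (v n) <= C) -> null u -> null (fun n => u n * v n).
Proof.
move=> C0 hv hu; apply: (@null_le _ (fun n => C * nrm (u n))).
  by move=> n; rewrite (le_trans (nrmM _ _))// mulrC ler_wpM2r ?nrm_ge0.
by have := rleM C0 hu; rewrite mulr0.
Qed.

Lemma null_ext u v : (forall n, u n = v n) -> null u -> null v.
Proof. by move=> uv; apply: rle_le => // n; rewrite uv. Qed.

(** Commutators with a fixed polynomial in p_n vanish asymptotically by induction on the polynomial;
    one polynomial approximates the square root on [0, 1], uniformly in n. *)
Lemma sqrt_commutator p b : (forall n, psd (p n)) -> (forall n, nrm (p n) <= 1) ->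
  null (fun n => p n * b - b * p n) ->
  null (fun n => cfc Num.sqrt (p n) * b - b * cfc Num.sqrt (p n)).
Proof.
move=> pp p1 pb.
have hpoly (q : {poly R}) : (exists2 C, 0 <= C & forall n, nrm (pev q (p n)) <= C) /\
    null (fun n => pev q (p n) * b - b * pev q (p n)).
  elim/poly_ind: q => [|q r [[C C0 hC] IH]].
    split; first by exists 0 => // n; rewrite -[0]/(0%:P) pevC scale0r nrm0.
    apply: (null_ext (u := fun=> 0)).
      by move=> n; rewrite -[0 : {poly R}]/(0%:P) pevC scale0r mul0r mulr0 subrr.
    by apply: (rle_le _ _ (rle_cst 0)) => // n; rewrite nrm0.
  split.
    exists (C + `|r|); first by rewrite addr_ge0.
    move=> n; rewrite pevD pevM pevX pevC (le_trans (nrmD _ _))// nrm_one_scale lerD2r.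
    by rewrite (le_trans (nrmM _ _))// -[leRHS]mulr1 ler_pM ?nrm_ge0.
  apply: (null_ext _ (nullD (null_mull C0 hC pb) (null_mulr ler01 p1 IH))) => n.
  rewrite pevD pevM pevX pevC [in RHS]mulrDl [in RHS]mulrDr oner_scale_comm.
  rewrite [in RHS]opprD [in RHS]addrACA subrr addr0 mulrBr mulrBl !mulrA.
  by rewrite addrA subrK.
have sa n := psd_sa (pp n).
move=> e e0; rewrite add0r.
have b1 : 0 < nrm b + 1 by rewrite ltr_wpDl ?nrm_ge0.
have d0 : 0 < e / (4 * (nrm b + 1)) by rewrite divr_gt0// mulr_gt0.
set d := e / _ in d0.
have csq : continuous (@Num.sqrt R) := @sqrt_continuous R.
have [q hq] := weierstrass csq d0 ler01.
have near_q n : nrm (cfc Num.sqrt (p n) - pev q (p n)) <= d.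
  apply: (is_cfc_nrmB (sa n) (cfcP (sa n) csq) (g := fun t => q.[t])).
    by move=> e' e'0; exists q; rewrite subrr nrm0 (ltW e'0); split => // t _; rewrite subrr normr0 ltW.
  move=> t ht; rewrite distrC; apply: hq.
  by rewrite (le_trans (spectrum_le ht)).
have [_ hn] := hpoly q.
have e20 : 0 < e / 2 by rewrite divr_gt0.
have [N hN] := hn _ e20; exists N => n /hN; rewrite add0r => h.
set s := cfc _ _; set Q := pev q (p n) in h.
have -> : s * b - b * s = (Q * b - b * Q) + ((s - Q) * b - b * (s - Q)).
  rewrite mulrBl mulrBr opprB addrACA [Q * b + _]addrC subrK; congr (_ + _).
  by rewrite addKr.
have hs : nrm (s - Q) * nrm b <= d * (nrm b + 1).
  by rewrite ler_pM ?nrm_ge0 ?near_q// lerDl.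
have dE : d * (nrm b + 1) = e / 4 by rewrite /d; field; rewrite gt_eqF.
rewrite dE in hs.
rewrite (le_trans (nrmD _ _))//; have := nrmB ((s - Q) * b) (b * (s - Q)).
have := nrmM (s - Q) b; have := nrmM b (s - Q); rewrite [nrm b * _]mulrC.
lra.
Qed.

End SqrtCommutator.

(** * Positive maps on C(G) *)

Section FunctionMaps.
Variables (R : realType) (G : topologicalGroupType) (A : cstarAlgType R).
Variables (d : A) (psi : (G -> R[i]) -> A).
Hypothesis psiP : cpc_CG (corner setT d) psi.
Implicit Types (f h : G -> R) (r : R).

Definition rc f : G -> R[i] := fun g => (f g)%:C.

Lemma CG_rc f : continuous (f : G -> R) -> CG (rc f).
Proof.
move=> cf g B /(@nbhs_nrmP R R[i]^o)[e e0 hB].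
have hg : nbhs (f g) [set t | `|f g - t| < e] by exact: nbhsx_ballx.
have hn : nbhs g [set h | `|f g - f h| < e] := cf g _ hg.
apply: filterS hn => h /= fh; apply: hB.
by rewrite /rc -rmorphB /nrm /= expr0n addr0 sqrtr_sqr.
Qed.

Lemma rcD f h : rc (fun g => f g + h g) = rc f + rc h.
Proof. by apply/funext => g; rewrite /rc rmorphD. Qed.

Lemma rcM f h : rc (fun g => f g * h g) = rc f * rc h.
Proof. by apply/funext => g; rewrite /rc rmorphM. Qed.

Lemma rc1 : rc (fun=> 1) = 1.
Proof. by apply/funext => g; rewrite /rc rmorph1. Qed.

Lemma psi_rcD f h : continuous f -> continuous h ->
  psi (rc (fun g => f g + h g)) = psi (rc f) + psi (rc h).
Proof.
move=> cf ch; case: psiP => pl _ _ _; have := pl 1 _ _ (CG_rc cf) (CG_rc ch).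
by rewrite !scale1r -rcD.
Qed.

Lemma psi_rc0 : psi (rc (fun=> 0)) = 0.
Proof.
have c0 : continuous ((fun=> 0) : G -> R) by move=> g; exact: cvg_cst.
apply: (addrI (psi (rc (fun=> 0)))); by rewrite -psi_rcD// !addr0.
Qed.

Lemma psi_rcB f h : continuous f -> continuous h ->
  psi (rc (fun g => f g - h g)) = psi (rc f) - psi (rc h).
Proof.
move=> cf ch; apply/eqP; rewrite eq_sym subr_eq -psi_rcD//.
  by apply/eqP; congr (psi _); apply/funext => g; rewrite /rc subrK.
by move=> g; apply: cvgB; [exact: cf|exact: ch].
Qed.

Lemma continuous_sum (I : Type) (s : seq I) (f : I -> G -> R) :
  (forall i, continuous (f i)) -> continuous (fun g => \sum_(i <- s) f i g).
Proof.
move=> cf; elim: s => [|i s IH].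
  rewrite (_ : (fun g => _) = fun=> 0); first by move=> g; exact: cvg_cst.
  by apply/funext => g; rewrite big_nil.
rewrite (_ : (fun g => _) = fun g => f i g + \sum_(j <- s) f j g).
  by move=> g; apply: cvgD; [exact: cf|exact: IH].
by apply/funext => g; rewrite big_cons.
Qed.

Lemma psi_rc_sum (I : Type) (s : seq I) (f : I -> G -> R) :
  (forall i, continuous (f i)) ->
  psi (rc (fun g => \sum_(i <- s) f i g)) = \sum_(i <- s) psi (rc (f i)).
Proof.
move=> cf; elim: s => [|i s IH].
  by rewrite big_nil -psi_rc0; congr (psi _); apply/funext => g; rewrite /rc big_nil.
rewrite big_cons -IH -psi_rcD//; last exact: continuous_sum.
by congr (psi _); apply/funext => g; rewrite /rc big_cons.
Qed.

Lemma psi_psd f : continuous f -> (forall g, 0 <= f g) -> psd (psi (rc f)).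
Proof.
move=> cf f0; case: psiP => _ cp _ _.
have cs : continuous (fun g => Num.sqrt (f g)).
  by move=> g; apply: continuous_comp; [exact: cf|exact: sqrt_continuous].
have [|Y _ hY] := cp 1%N (const_mx (rc f)).
  exists (const_mx (rc (fun g => Num.sqrt (f g)))).
    by move=> i j; rewrite mxE; exact: CG_rc.
  apply/matrixP => i j; rewrite !mxE big_ord1 !mxE; apply/funext => g.
  rewrite -[RHS]/(conjc (Num.sqrt (f g))%:C * (Num.sqrt (f g))%:C).
  by rewrite conjc_real -rmorphM/= sqrtrM_self.
have := congr1 (fun M : 'M[A]_1 => M 0 0) hY; rewrite !mxE big_ord1 !mxE => ->.
exact: psd_starM.
Qed.

Lemma psi_nrm f r : continuous f -> (forall g, `|f g| <= r) -> nrm (psi (rc f)) <= r.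
Proof.
move=> cf fr; case: psiP => _ _ hn _; rewrite -lee_fin.
apply: (le_trans (hn _ (CG_rc cf))); apply: ub_ereal_sup => _ [g _ <-].
by rewrite lee_fin /rc /nrm /= expr0n addr0 sqrtr_sqr.
Qed.

End FunctionMaps.

(** * Sums weighted by images of a partition of unity *)

Section WeightedSums.
Variables (R : realType) (A : cstarAlgType R).
Implicit Types (a b c : A) (e r : R).

(** Cauchy-Schwarz for the families s_i and b_i s_i, where the sum of the s_i b_i^* b_i s_i is at
    most r^2 times the sum of the s_i^2. *)
Lemma sandwich_nrm (I : finType) (s b : I -> A) r : 0 <= r ->
  (forall i, star (s i) = s i) -> nrm (\sum_i s i * s i) <= 1 ->
  (forall i, nrm (b i) <= r) -> nrm (\sum_i s i * b i * s i) <= r.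
Proof.
move=> r0 ss s1 br.
have e1 : \sum_i star (s i) * (b i * s i) = \sum_i s i * b i * s i.
  by apply: eq_bigr => i _; rewrite ss mulrA.
have e2 : \sum_i star (s i) * s i = \sum_i s i * s i.
  by apply: eq_bigr => i _; rewrite ss.
have := cauchy_schwarz s (fun i => b i * s i); rewrite e1 e2.
set Q := \sum_i star (b i * s i) * _ => h.
have Qr : nrm Q <= r ^+ 2.
  apply: (@le_trans _ _ (nrm ((r ^+ 2)%:C *: \sum_i s i * s i))).
    apply: psd_mono; first by apply: psd_sum => i _; exact: psd_starM.
    rewrite scaler_sumr -sumrB; apply: psd_sum => i _.
    have -> : (r ^+ 2)%:C *: (s i * s i) - star (b i * s i) * (b i * s i) =
        star (s i) * ((r ^+ 2)%:C%:A - star (b i) * b i) * s i.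
      by rewrite starM mulrBr mulrBl ss -scalerAr mulr1 -scalerAl !mulrA.
    apply/psd_conj/psd_sqrt_le; first by rewrite starM starK.
    by rewrite nrm_starM lerXn2r ?nnegrE ?nrm_ge0.
  by rewrite nrmZp ?exprn_ge0// ler_piMr// exprn_ge0.
have : nrm (\sum_i s i * b i * s i) ^+ 2 <= r ^+ 2.
  apply: (le_trans h); apply: le_trans Qr.
  by rewrite ler_piMl// nrm_ge0.
by rewrite ler_pXn2r ?nnegrE ?nrm_ge0.
Qed.

Lemma nrm_sqrt_le1 (d : A) :
  psd d -> nrm d <= 1 -> nrm (cfc Num.sqrt d) <= 1.
Proof.
move=> pd d1; have sd := psd_sa pd.
have cs : continuous (@Num.sqrt R) := @sqrt_continuous R.
apply: cfc_nrm_le => // t ht; rewrite ger0_norm ?sqrtr_ge0//.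
by rewrite -sqrtr1 ler_sqrt// (le_trans (ler_norm _))// (le_trans (spectrum_le ht)).
Qed.

(** With s a root of p, p b - s b s = s (s b - b s). *)
Lemma sandwich_null (I : finType) (p : I -> nat -> A) (b : I -> A) :
  (forall i n, psd (p i n)) -> (forall i n, nrm (p i n) <= 1) ->
  (forall i, null (fun n => p i n * b i - b i * p i n)) ->
  null (fun n => \sum_i p i n * b i -
    \sum_i cfc Num.sqrt (p i n) * b i * cfc Num.sqrt (p i n)).
Proof.
move=> pp p1 pb.
have sa i n := psd_sa (pp i n).
have csq : continuous (@Num.sqrt R) := @sqrt_continuous R.
have ss i n : cfc Num.sqrt (p i n) * cfc Num.sqrt (p i n) = p i n.
  rewrite -cfcM// -[RHS](cfc_id (sa i n)); apply: cfc_ext => //.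
  - by move=> t; apply: cvgM; exact: csq.
  - by move=> t; exact: cvg_id.
  - by move=> t /(spectrum_psd_ge0 (pp i n)) t0; rewrite sqrtrM_self.
have s1 i n := nrm_sqrt_le1 (pp i n) (p1 i n).
apply: (null_ext _ (null_sum (index_enum I) (P := predT) (fun i _ => null_mull ler01 (s1 i)
   (sqrt_commutator (pp i) (p1 i) (pb i))))) => n.
rewrite -sumrB; apply: eq_bigr => i _.
by rewrite mulrBr !mulrA ss.
Qed.

(** The sum is asymptotically a sandwich by roots whose squares sum to [psi n 1], so its norm is
    controlled by the largest relevant b_i, independently of the number of terms. *)
Lemma weighted_sum (G : topologicalGroupType) (d : nat -> A)
    (psi : nat -> (G -> R[i]) -> A) (I : finType) (h : I -> G -> R) (b : I -> A) r :
  (forall n, cpc_CG (corner setT (d n)) (psi n)) -> 0 <= r ->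
  (forall i, continuous (h i)) -> (forall i g, 0 <= h i g) ->
  (forall g, \sum_i h i g = 1) ->
  (forall i, (forall g, h i g = 0) \/ nrm (b i) <= r) ->
  (forall i, null (fun n => psi n (rc (h i)) * b i - b i * psi n (rc (h i)))) ->
  rle (fun n => nrm (\sum_i psi n (rc (h i)) * b i)) r.
Proof.
move=> psiP r0 ch h0 h1 hb hc.
have hle i g : `|h i g| <= 1.
  rewrite ger0_norm// -(h1 g) (bigD1 i)//= lerDl; apply: sumr_ge0 => *; exact: h0.
pose p i n := psi n (rc (h i)).
have pp i n : psd (p i n) by apply: (psi_psd (psiP n)).
have p1 i n : nrm (p i n) <= 1 by apply: (psi_nrm (psiP n)).
(* Nothing is known of b_i if h_i vanishes, but then the term is 0 and b_i may be replaced by 0. *)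
pose b' i := if `[< forall g, h i g = 0 >] then 0 else b i.
have b'r i : nrm (b' i) <= r.
  rewrite /b'; case: asboolP => hi; first by rewrite nrm0.
  by case: (hb i).
have pb i n : p i n * b i = p i n * b' i.
  rewrite /b'; case: asboolP => // hi; rewrite /p (_ : h i = fun=> 0); last exact/funext.
  by rewrite (psi_rc0 (psiP n)) !mul0r.
have hc' i : null (fun n => p i n * b' i - b' i * p i n).
  rewrite /b'; case: asboolP => hi; last exact: hc.
  apply: (rle_le _ _ (rle_cst 0)) => // n; by rewrite mulr0 mul0r subrr nrm0.
have key := sandwich_null pp p1 hc'.
have csq : continuous (@Num.sqrt R) := @sqrt_continuous R.
have ss i n : cfc Num.sqrt (p i n) * cfc Num.sqrt (p i n) = p i n.
  have sa := psd_sa (pp i n).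
  rewrite -cfcM// -[RHS](cfc_id sa); apply: cfc_ext => //.
  - by move=> t; apply: cvgM; exact: csq.
  - by move=> t; exact: cvg_id.
  - by move=> t /(spectrum_psd_ge0 (pp i n)) t0; rewrite sqrtrM_self.
apply: (rle_le _ _ (rleD (rle_cst r) key)); last by rewrite addr0.
move=> n /=; rewrite (eq_bigr (fun i => p i n * b' i)); last by move=> i _; exact: pb.
rewrite (le_trans (nrm_dist _ (\sum_i cfc Num.sqrt (p i n) * b' i * cfc Num.sqrt (p i n))))//.
rewrite lerD2r; apply: sandwich_nrm => //.
  by move=> i; apply: cfc_sa => //; exact: psd_sa.
rewrite (eq_bigr (fun i => p i n)); last by move=> i _; exact: ss.
rewrite -(psi_rc_sum (psiP n))//; apply: (psi_nrm (psiP n)).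
  exact: continuous_sum.
by move=> g; rewrite h1 normr1.
Qed.

End WeightedSums.

Lemma subr_subr (V : zmodType) (x y z : V) : (x - z) - (y - z) = x - y.
Proof. by rewrite opprB addrA subrK. Qed.

(** * Partitions of unity adapted to orbits, and nets of translates *)

Section Partition.
Variables (R : realType) (G : topologicalGroupType) (A : cstarAlgType R).
Variable al : G -> A -> A.
Hypothesis alP : is_action al.
Hypothesis compG : compact [set: G].
Implicit Types (g h x y : G) (a b : A) (L : seq A) (e r : R).

Lemma continuous_nrm_orbit a b : continuous (fun g => nrm (al g a - b) : R).
Proof.
move=> g B /nbhs_ballP[e /= e0 hB].
have hg : nbhs (al g a) [set w | nrm (al g a - w) < e] by apply/nbhs_nrmP; exists e.
have hn : nbhs g [set h | nrm (al g a - al h a) < e] := act_continuous alP hg.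
apply: filterS hn => h /= gh; apply: hB; rewrite /ball /=.
rewrite (le_lt_trans _ gh)//.
have h1 := nrm_dist (al g a - b) (al h a - b); have h2 := nrm_dist (al h a - b) (al g a - b).
rewrite subr_subr in h1; rewrite subr_subr [nrm (al h a - al g a)]nrmBC in h2.
by rewrite ler_norml; apply/andP; split; lra.
Qed.

(** The normalized functions (e - sum_a |alpha_g(a) - alpha_x(a)|)_+ for x in a net: where one does
    not vanish, every distance in its sum is below e. *)
Lemma partition_unity L e : 0 < e -> exists (m : nat) (c : 'I_m -> G) (f : 'I_m -> G -> R),
  [/\ forall j, continuous (f j), forall j g, 0 <= f j g, forall g, \sum_j f j g = 1 &
    forall j g a, a \in L -> f j g != 0 -> nrm (al g a - al (c j) a) <= e].
Proof.
(* At a net point for g the sum of distances is at most |L| e / k < e, so the normalizing sum D is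
   positive everywhere. *)
move=> e0; pose k : R := (2 * (size L).+1)%:R.
have k0 : 0 < k by rewrite ltr0n.
have [X hX] := orbit_net alP compG L (divr_gt0 e0 k0).
pose rho x g : R := \sum_(a <- L) nrm (al g a - al x a).
pose t x g : R := Num.max 0 (e - rho x g).
pose c (j : 'I_(size X)) := tnth (in_tuple X) j.
pose D g := \sum_j t (c j) g.
have t0 x g : 0 <= t x g by rewrite le_max lexx.
have D0 g : 0 < D g.
  have [x xX hx] := hX g; have [j jx] : exists j, c j = x.
    by have /tnthP[j ->] : x \in in_tuple X; [|exists j].
  rewrite /D (bigD1 j)//= ltr_pwDl//; last by apply: sumr_ge0 => *; exact: t0.
  rewrite lt_max jx; apply/orP; right; rewrite subr_gt0.
  apply: (@le_lt_trans _ _ (\sum_(a <- L) e / k)).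
    by rewrite /rho big_seq [leRHS]big_seq; apply: ler_sum => a aL; exact: hx.
  rewrite big_const_seq count_predT iter_addr_0 -mulr_natr mulrAC ltr_pdivrMr//.
  rewrite ltr_pM2l// ltr_nat; lia.
have ct x : continuous (t x).
  have cr : continuous (fun g => e - rho x g).
    move=> g; apply: cvgB; first exact: cvg_cst.
    apply: (@continuous_sum R G _ L (fun a g => nrm (al g a - al x a))) => a.
    exact: continuous_nrm_orbit.
  by move=> g; apply: (@continuous_max _ _ (fun=> 0) (fun g => e - rho x g)); [exact: cvg_cst|exact: cr].
exists (size X), c, (fun j g => t (c j) g / D g); split.
- move=> j g; apply: cvgM; first exact: ct.
  apply: cvgV; first by rewrite gt_eqF.
  by apply: (@continuous_sum R G _ (index_enum _) (fun j => t (c j))) => i; exact: ct.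
- by move=> j g; rewrite divr_ge0// ltW.
- by move=> g; rewrite -mulr_suml -/(D g) mulfV ?gt_eqF.
move=> j g a aL; rewrite mulf_eq0 invr_eq0 (gt_eqF (D0 g)) orbF => tn.
have {}tn : 0 < t (c j) g by rewrite lt_neqAle eq_sym tn t0.
move: tn; rewrite lt_max ltxx /= subr_gt0 => /ltW; apply: le_trans.
rewrite /rho (perm_big _ (perm_to_rem aL)) big_cons /= lerDl.
by apply: sumr_ge0 => *; exact: nrm_ge0.
Qed.

(** Compactness of G makes the estimate uniform in h. The net reduces the invariance under all g to
    finitely many test functions and test elements. *)
Lemma translate_net m (f : 'I_m -> G -> R) L e : 0 < e -> (forall j, continuous (f j)) ->
  exists N : seq G, forall g, exists2 g', g' \in N &
    (forall j h, `|f j (g^-1 * h)%g - f j (g'^-1 * h)%g| <= e) /\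
    (forall a, a \in L -> nrm (al g a - al g' a) <= e).
Proof.
move=> e0 cf.
pose U g := [set g' | (forall j h, `|f j (g'^-1 * h)%g - f j (g^-1 * h)%g| <= e) /\
   (forall a, a \in L -> nrm (al g' a - al g a) < e)].
have hU g : nbhs g (U g).
  apply: filterI; last exact: near_orbit.
  apply: filter_forall => j.
  have e20 : 0 < e / 2 by rewrite divr_gt0.
  have nc : near_covering [set: G] by apply/compact_near_coveringP.
  suff : \forall g' \near nbhs g, [set: G] `<=`
      (fun h => `|f j (g'^-1 * h)%g - f j (g^-1 * h)%g| <= e).
    by apply: filterS => g' hg' h; exact: hg'.
  apply: nc => h _.
  have c1 : (fun p : G * G => f j (p.2^-1 * p.1)%g) @ (h, g) --> f j (g^-1 * h)%g.
    apply: (@cvg_comp _ _ _ (fun p : G * G => (p.2^-1 * p.1)%g) (f j) _ (nbhs (g^-1 * h)%g)); last exact: cf.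
    apply: (@cvg_comp _ _ _ (fun p : G * G => (p.2^-1%g, p.1)) (fun p : G * G => (p.1 * p.2)%g) _ (nbhs (g^-1%g, h))); last exact: (@mulg_continuous G (g^-1%g, h)).
    apply: cvg_pair; last exact: cvg_fst.
    apply: (@cvg_comp _ _ _ snd (fun x : G => x^-1%g) _ (nbhs g)); first exact: cvg_snd.
    exact: invg_continuous.
  have c2 : (fun p : G * G => f j (g^-1 * p.1)%g) @ (h, g) --> f j (g^-1 * h)%g.
    apply: (@cvg_comp _ _ _ (fun p : G * G => (g^-1 * p.1)%g) (f j) _ (nbhs (g^-1 * h)%g)); last exact: cf.
    apply: (@cvg_comp _ _ _ (fun p : G * G => (g^-1%g, p.1)) (fun p : G * G => (p.1 * p.2)%g) _ (nbhs (g^-1%g, h))); last exact: (@mulg_continuous G (g^-1%g, h)).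
    by apply: cvg_pair; [exact: cvg_cst|exact: cvg_fst].
  have /cvgrPdist_le/(_ _ e20) k1 := c1; have /cvgrPdist_le/(_ _ e20) k2 := c2.
  apply: filterS (filterI k1 k2) => -[h' g'] /= [l1 l2].
  rewrite -(subrK (f j (g^-1 * h)%g) (f j (g'^-1 * h')%g)) -addrA (le_trans (ler_normD _ _))//.
  by rewrite [leRHS]splitr lerD// distrC.
have [N [_ hN]] := compact_net compG (fun g _ => hU g).
exists N => g; have [x xN [h1 h2]] := hN g I; exists x => //; split => // a aL.
exact/ltW/h2.
Qed.

End Partition.

(** * The approximating maps *)

Section AveragedMaps.
Variables (R : realType) (G : topologicalGroupType) (A : cstarAlgType R).
Variable al : G -> A -> A.
Hypothesis alP : is_action al.
Variables (d : nat -> A) (psi : nat -> (G -> R[i]) -> A).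
Hypothesis psiP : forall n, cpc_CG (corner setT (d n)) (psi n).
Hypothesis psi1 : forall n, psi n 1 = d n.
Variables (m : nat) (c : 'I_m -> G) (f : 'I_m -> G -> R) (r : R).
Hypothesis r0 : 0 <= r.
Hypothesis fc : forall j, continuous (f j).
Hypothesis f0 : forall j g, 0 <= f j g.
Hypothesis f1 : forall g, \sum_j f j g = 1.
Implicit Types (a b : A) (n : nat) (g h : G) (i j k : 'I_m).

Let p j n := psi n (rc (f j)).

(** The form used in computations: it is linear in the psi(f_j), and equals d a for fixed a. It is
    not visibly positive, unlike [sws], which has d as its value at 1. *)
Definition smp (n : nat) (a : A) : A := \sum_j psi n (rc (f j)) * al (c j) a.

Definition sws (n : nat) (a : A) : A :=
  \sum_j cfc Num.sqrt (psi n (rc (f j))) * al (c j) a * cfc Num.sqrt (psi n (rc (f j))).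

Lemma pu_le1 j g : `|f j g| <= 1.
Proof.
rewrite ger0_norm// -(f1 g) (bigD1 j)//= lerDl; apply: sumr_ge0 => *; exact: f0.
Qed.

Lemma p_psd j n : psd (p j n).
Proof. exact: (psi_psd (psiP n)). Qed.

Lemma p_nrm j n : nrm (p j n) <= 1.
Proof. by apply: (psi_nrm (psiP n)) => // g; exact: pu_le1. Qed.

Lemma p_sqrt j n : cfc Num.sqrt (p j n) * cfc Num.sqrt (p j n) = p j n.
Proof.
have csq : continuous (@Num.sqrt R) := @sqrt_continuous R.
have sa := psd_sa (p_psd j n).
rewrite -cfcM// -[RHS](cfc_id sa); apply: cfc_ext => //.
- by move=> t; apply: cvgM; exact: csq.
- by move=> t; exact: cvg_id.
- by move=> t /(spectrum_psd_ge0 (p_psd j n)) t0; rewrite sqrtrM_self.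
Qed.

Lemma p_sum n : \sum_j p j n = d n.
Proof.
rewrite -psi1 -(psi_rc_sum (psiP n))//; congr (psi n _).
by rewrite -rc1; congr rc; apply/funext => g; rewrite f1.
Qed.

Lemma nrm_d n : nrm (d n) <= 1.
Proof.
rewrite -psi1 -rc1; apply: (psi_nrm (psiP n)); first by move=> g; exact: cvg_cst.
by move=> g; rewrite normr1.
Qed.

Lemma sws_linear n : linear (sws n).
Proof.
move=> z a b; rewrite /sws scaler_sumr -big_split; apply: eq_bigr => j _ /=.
by rewrite (act_lin alP) mulrDr mulrDl -scalerAr -scalerAl.
Qed.

(** The form is the sum over j of v_j^* v_j, where v_j is the sum over i of alpha_(c_j)(y_i) s_j
    x_i. *)
Lemma sws_cpform n : cpform (sws n).
Proof.
move=> k y x; have csq : continuous (@Num.sqrt R) := @sqrt_continuous R.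
pose s j := cfc Num.sqrt (p j n).
have ss j : star (s j) = s j by apply: cfc_sa => //; exact/psd_sa/p_psd.
have -> : \sum_i \sum_i0 star (x i) * sws n (star (y i) * y i0) * x i0 =
    \sum_j star (\sum_i al (c j) (y i) * s j * x i) * (\sum_i al (c j) (y i) * s j * x i).
  transitivity (\sum_j \sum_i \sum_i0 star (x i) * (s j * al (c j) (star (y i) * y i0) * s j) * x i0).
    rewrite [RHS]exchange_big; apply: eq_bigr => i _ /=.
    rewrite [RHS]exchange_big; apply: eq_bigr => i0 _ /=.
    by rewrite /sws mulr_sumr mulr_suml.
  apply: eq_bigr => j _; rewrite star_sum mulr_suml; apply: eq_bigr => i _.
  rewrite mulr_sumr; apply: eq_bigr => i0 _.
  by rewrite !starM ss (act_mul alP) (act_star alP) !mulrA.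
by apply: psd_sum => j _; exact: psd_starM.
Qed.

Lemma sws_one n : sws n 1 = d n.
Proof.
rewrite -p_sum; apply: eq_bigr => j _.
by rewrite (al_one alP) mulr1; exact: p_sqrt.
Qed.

Lemma smp_fixed n a : fixed_alg al a -> smp n a = d n * a.
Proof.
move=> fa; rewrite -p_sum mulr_suml; apply: eq_bigr => j _.
by rewrite fa.
Qed.

Definition comm_null (h : G -> R) (a : A) : Prop :=
  null (fun n => psi n (rc h) * a - a * psi n (rc h)).

Lemma smp_sws a : (forall j, comm_null (f j) (al (c j) a)) ->
  null (fun n => smp n a - sws n a).
Proof. by move=> h; apply: sandwich_null => //; [exact: p_psd|exact: p_nrm]. Qed.

Lemma continuous_mulf (h h' : G -> R) : continuous h -> continuous h' ->
  continuous (fun g => h g * h' g).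
Proof. by move=> ch ch' g; apply: cvgM; [exact: ch|exact: ch']. Qed.

(** The difference is U - V + d W: U collects commutators, V the multiplicativity defects of psi,
    and W is the sum of the psi(f_j f_k) alpha_j(a) (alpha_k(b) - alpha_j(b)). Where f_j f_k does
    not vanish at g, both alpha_j(b) and alpha_k(b) are within r of alpha_g(b), and [weighted_sum]
    bounds W. *)
Lemma smp_mult a b :
  (forall j g, f j g != 0 -> nrm (al g b - al (c j) b) <= r) ->
  (forall j k, comm_null (f k) (al (c j) a)) ->
  (forall j k, comm_null (fun g => f j g * f k g)
     (al (c j) a * (al (c k) b - al (c j) b))) ->
  (forall j k, null (fun n => psi n 1 * psi n (rc (f j) * rc (f k)) - p j n * p k n)) ->
  rle (fun n => nrm (smp n a * smp n b - d n * smp n (a * b))) (nrm a * (r + r)).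
Proof.
move=> hb hc1 hc2 hm.
pose q jk n := psi n (rc (fun g => f jk.1 g * f jk.2 g)) : A.
pose W n := \sum_(jk : 'I_m * 'I_m) q jk n * (al (c jk.1) a * (al (c jk.2) b - al (c jk.1) b)).
have hW : rle (fun n => nrm (W n)) (nrm a * (r + r)).
  apply: (weighted_sum (h := fun jk : 'I_m * 'I_m => fun g => f jk.1 g * f jk.2 g) psiP).
  - by rewrite mulr_ge0 ?nrm_ge0 ?addr_ge0.
  - by move=> jk; exact: continuous_mulf.
  - by move=> jk g; rewrite mulr_ge0.
  - move=> g; rewrite -(pair_bigA _ (fun j k => f j g * f k g)) /=.
    by under eq_bigr do rewrite -mulr_sumr f1 mulr1; rewrite f1.
  - move=> [j k] /=; have [h0|/existsNP[g /eqP]] := pselect (forall g, f j g * f k g = 0).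
      by left.
    rewrite mulf_eq0 negb_or => /andP[hj hk]; right.
    rewrite (le_trans (nrmM _ _))// (nrm_al alP) ler_wpM2l ?nrm_ge0//.
    rewrite (le_trans (nrm_tri (al g b) _ _))// lerD ?hb//.
    by rewrite nrmBC hb.
  - by move=> [j k]; exact: hc2.
pose U n := \sum_j \sum_k (p j n * (al (c j) a * p k n - p k n * al (c j) a) * al (c k) b).
pose V n := \sum_j \sum_k ((psi n 1 * psi n (rc (f j) * rc (f k)) - p j n * p k n) * (al (c j) a * al (c k) b)).
have hU : null U.
  apply: null_sum => j _; apply: null_sum => k _.
  apply: (@null_mulr _ _ (nrm b)) => [|n|]; rewrite ?nrm_ge0 ?(nrm_al alP)//.
  apply: (@null_mull _ _ 1) => // [n|]; first exact: p_nrm.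
  by apply: rle_le (hc1 j k) => // n; rewrite nrmBC.
have hV : null V.
  apply: null_sum => j _; apply: null_sum => k _.
  apply: (@null_mulr _ _ (nrm a * nrm b)) => [|n|//]; first by rewrite mulr_ge0 ?nrm_ge0.
  by rewrite (le_trans (nrmM _ _))// !(nrm_al alP).
have E n : smp n a * smp n b - d n * smp n (a * b) = U n - V n + d n * W n.
  have eU : U n = smp n a * smp n b - \sum_j \sum_k p j n * p k n * (al (c j) a * al (c k) b).
    rewrite /smp mulr_suml -sumrB; apply: eq_bigr => j _; rewrite mulr_sumr -sumrB.
    by apply: eq_bigr => k _; rewrite mulrBr mulrBl !mulrA.
  have eV : V n = d n * (\sum_j \sum_k q (j, k) n * (al (c j) a * al (c k) b)) -
      \sum_j \sum_k p j n * p k n * (al (c j) a * al (c k) b).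
    rewrite mulr_sumr -sumrB; apply: eq_bigr => j _; rewrite mulr_sumr -sumrB.
    by apply: eq_bigr => k _; rewrite mulrBl psi1 -rcM !mulrA.
  have eW : W n = (\sum_j \sum_k q (j, k) n * (al (c j) a * al (c k) b)) - smp n (a * b).
    rewrite /W -(pair_bigA _ (fun j k => q (j, k) n * (al (c j) a * (al (c k) b - al (c j) b)))) /=.
    rewrite /smp -sumrB; apply: eq_bigr => j _.
    have -> : psi n (rc (f j)) = \sum_k q (j, k) n.
      rewrite /q -(psi_rc_sum (psiP n)) /=; last by move=> k; exact: continuous_mulf.
      congr (psi n (rc _)); apply/funext => g.
      by rewrite -mulr_sumr f1 mulr1.
    rewrite mulr_suml -sumrB; apply: eq_bigr => k _.
    by rewrite (act_mul alP) !mulrBr.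
  by rewrite eU eV eW mulrBr subr_subr addrA subrK.
apply: (@rle_le _ _ (fun n => nrm (U n) + nrm (V n) + nrm (W n)) (0 + 0 + nrm a * (r + r))).
- move=> n; rewrite E (le_trans (nrmD _ _))// lerD ?nrmB// (le_trans (nrmM _ _))//.
  by rewrite ler_piMl ?nrm_ge0 ?nrm_d.
- by rewrite !add0r.
- by apply: rleD => //; exact: rleD.
Qed.

Lemma continuous_translate (h : G -> R) g : continuous h ->
  continuous (fun x => h (g^-1 * x)%g).
Proof.
move=> ch x; apply: (@cvg_comp _ _ _ (fun x => (g^-1 * x)%g) h _ (nbhs (g^-1 * x)%g)); last exact: ch.
apply: (@cvg_comp _ _ _ (fun x : G => (g^-1%g, x)) (fun p : G * G => (p.1 * p.2)%g) _ (nbhs (g^-1%g, x))); last exact: (@mulg_continuous G (g^-1%g, x)).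
by apply: cvg_pair; [exact: cvg_cst|exact: cvg_id].
Qed.

(** By equivariance alpha_g([smp] a) is near Y1, the sum of the psi(Lt_g f_k) alpha_g(alpha_k(a));
    Y2 replaces g by a net point g'. Writing 1 as the sum of the f_j, or of the Lt_g' f_k, turns Y2
    - [smp] a into a sum over pairs weighted by f_j Lt_g' f_k. Where the weight is nonzero at h,
    both alpha_g'(alpha_k(a)) and alpha_j(a) are within r of alpha_h(a). *)
Lemma sws_invariant a (N : seq G) (e' : R) : 0 <= e' ->
  (forall j g, f j g != 0 -> nrm (al g a - al (c j) a) <= r) ->
  (forall j, comm_null (f j) (al (c j) a)) ->
  (forall g, exists2 g', g' \in N &
    (forall j h, `|f j (g^-1 * h)%g - f j (g'^-1 * h)%g| <= e') /\
    forall j, nrm (al g (al (c j) a) - al g' (al (c j) a)) <= e') ->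
  (forall g', g' \in N -> forall j k, comm_null (fun h => f j h * f k (g'^-1 * h)%g)
      (al g' (al (c k) a) - al (c j) a)) ->
  (forall n j g, nrm (psi n (Lt g (rc (f j))) - al g (psi n (rc (f j)))) <= n.+1%:R^-1) ->
  forall e, 0 < e -> exists n0, forall n, (n0 <= n)%N -> forall g,
    nrm (al g (sws n a) - sws n a) <= (r + r + m%:R * (e' * (1 + nrm a))) + e.
Proof.
move=> e'0 ha hc1 hN hc2 heq e e0.
pose q g j n := psi n (rc (fun h => f j (g^-1 * h)%g)) : A.
have cL g j : continuous (fun h => f j (g^-1 * h)%g) by apply: continuous_translate; exact: fc.
pose W g n := \sum_k q g k n * al g (al (c k) a) - smp n a.
have hW g : g \in N -> rle (fun n => nrm (W g n)) (r + r).
  move=> gN; pose I : finType := ('I_m * 'I_m)%type.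
  have := @weighted_sum R A G d psi I (fun jk h => f jk.1 h * f jk.2 (g^-1 * h)%g)
    (fun jk => al g (al (c jk.2) a) - al (c jk.1) a) (r + r) psiP.
  have hs : forall n, \sum_(jk : I) psi n (rc (fun h => f jk.1 h * f jk.2 (g^-1 * h)%g)) *
     (al g (al (c jk.2) a) - al (c jk.1) a) = W g n.
    move=> n; rewrite -(pair_bigA _ (fun j k => psi n (rc (fun h => f j h * f k (g^-1 * h)%g)) *
     (al g (al (c k) a) - al (c j) a))) /=.
    pose X j k := psi n (rc (fun h => f j h * f k (g^-1 * h)%g)).
    have cX j k : continuous (fun h => f j h * f k (g^-1 * h)%g) by exact: continuous_mulf.
    transitivity (\sum_j \sum_k X j k * al g (al (c k) a) - \sum_j \sum_k X j k * al (c j) a).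
      rewrite -sumrB; apply: eq_bigr => j _; rewrite -sumrB; apply: eq_bigr => k _.
      by rewrite mulrBr.
    congr (_ - _).
      rewrite exchange_big; apply: eq_bigr => k _ /=; rewrite -mulr_suml; congr (_ * _).
      rewrite /q /X -(psi_rc_sum (psiP n))//; congr (psi n (rc _)); apply/funext => h.
      by rewrite -mulr_suml f1 mul1r.
    rewrite /smp; apply: eq_bigr => j _; rewrite -mulr_suml; congr (_ * _).
    rewrite /X -(psi_rc_sum (psiP n))//; congr (psi n (rc _)); apply/funext => h.
    by rewrite -mulr_sumr f1 mulr1.
  under eq_fun do rewrite hs; apply.
  - by rewrite addr_ge0.
  - by move=> jk; exact: continuous_mulf.
  - by move=> jk h; rewrite mulr_ge0.
  - move=> h; rewrite -(pair_bigA _ (fun j k => f j h * f k (g^-1 * h)%g)) /=.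
    by under eq_bigr do rewrite -mulr_sumr f1 mulr1; rewrite f1.
  - move=> [j k] /=; have [h0|/existsNP[h /eqP]] := pselect (forall h, f j h * f k (g^-1 * h)%g = 0).
      by left.
    rewrite mulf_eq0 negb_or => /andP[hj hk]; right.
    rewrite (le_trans (nrm_tri (al h a) _ _))// lerD ?ha//.
    rewrite -(nrm_al alP g^-1%g) (alB alP) (alK alP) -(act_M alP) nrmBC.
    exact: ha.
  - by move=> [j k]; exact: hc2.
(* [sws] is exchanged for [smp] on both sides of the action, hence the factor 2; the other term is
   the equivariance defect of psi. *)
pose u n := 2 * nrm (smp n a - sws n a) + m%:R * nrm a * n.+1%:R^-1.
have hu : rle u (2 * 0 + m%:R * nrm a * 0).
  apply: rleD; first by apply: rleM => //; exact: smp_sws.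
  by apply: rleM; [rewrite mulr_ge0 ?nrm_ge0|exact: rle_inv_nat].
rewrite !mulr0 addr0 in hu.
have e20 : 0 < e / 2 by rewrite divr_gt0.
have [n1 h1] := hu _ e20; have [n2 h2] := rle_seq e20 hW.
exists (maxn n1 n2) => n; rewrite geq_max => /andP[/h1 k1 /h2 k2] g.
have [g' g'N [hg1 hg2]] := hN g; have {}k2 := k2 _ g'N.
pose T := smp n a; pose S := sws n a.
pose Y1 := \sum_j q g j n * al g (al (c j) a).
pose Y2 := \sum_j q g' j n * al g' (al (c j) a).
have d1 : nrm (al g T - Y1) <= m%:R * nrm a * n.+1%:R^-1.
  rewrite /T /smp (al_sum alP) -sumrB (le_trans (nrm_sum _ _ _))//.
  apply: (@le_trans _ _ (\sum_(j < m) n.+1%:R^-1 * nrm a)).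
    apply: ler_sum => j _; rewrite (act_mul alP) -mulrBl (le_trans (nrmM _ _))//.
    by rewrite !(nrm_al alP) ler_wpM2r ?nrm_ge0// nrmBC; exact: heq.
  by rewrite sumr_const card_ord -[_ *+ m]mulr_natl mulrA mulrAC.
have d2 : nrm (Y1 - Y2) <= m%:R * (e' * (1 + nrm a)).
  rewrite /Y1 /Y2 -sumrB (le_trans (nrm_sum _ _ _))//.
  apply: (@le_trans _ _ (\sum_(j < m) e' * (1 + nrm a))); last by rewrite sumr_const card_ord mulr_natl.
  apply: ler_sum => j _; set x1 := al g _; set x2 := al g' _.
  have -> : q g j n * x1 - q g' j n * x2 = q g j n * (x1 - x2) + (q g j n - q g' j n) * x2.
    by rewrite mulrBr mulrBl addrA subrK.
  rewrite (le_trans (nrmD _ _))// [leRHS]mulrDr mulr1 lerD//.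
    rewrite (le_trans (nrmM _ _))// (le_trans _ (hg2 j))// ler_piMl ?nrm_ge0//.
    by apply: (psi_nrm (psiP n)) => // h; exact: pu_le1.
  rewrite (le_trans (nrmM _ _))// !(nrm_al alP) ler_wpM2r ?nrm_ge0//.
  rewrite /q -(psi_rcB (psiP n))//; apply: (psi_nrm (psiP n)) => //.
  by move=> h; apply: cvgB; exact: cL.
have d3 : nrm (Y2 - T) <= r + r + e / 2 by exact: k2.
have d4 : nrm (al g S - S) <= nrm (T - S) + (nrm (al g T - Y1) + (nrm (Y1 - Y2) + (nrm (Y2 - T) + nrm (T - S)))).
  rewrite (le_trans (nrm_tri (al g T) _ _))// -(alB alP) (nrm_al alP) [nrm (S - T)]nrmBC lerD2l.
  rewrite (le_trans (nrm_tri Y1 _ _))// lerD2l (le_trans (nrm_tri Y2 _ _))// lerD2l.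
  by rewrite nrm_tri.
have k1' : 2 * nrm (T - S) + m%:R * nrm a * n.+1%:R^-1 <= 0 + e / 2 := k1.
move: d1 k1'; move: (_ * _ * n.+1%:R^-1) => z d1 k1'.
move: d2; move: (_ * (e' * _)) => z2 d2.
lra.
Qed.

End AveragedMaps.

(** * Choice of the partition, the test functions and the test elements *)

Section Core.
Variables (R : realType) (G : topologicalGroupType) (A : cstarAlgType R).
Variable al : G -> A -> A.
Hypothesis alP : is_action al.
Hypothesis compG : compact [set: G].
Hypothesis wal : wtrp_comparison al.
Implicit Types (a b : A) (g h : G) (L : seq A).

Lemma wtrp_sequence (F : seq A) (S : set (G -> R[i])) (x y : A) :
  finite_set S -> S `<=` @CG R G -> S 1 ->
  pos setT x -> nrm x = 1 -> pos (fixed_alg al) y -> y <> 0 ->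
  exists (d : nat -> A) (psi : nat -> (G -> R[i]) -> A), forall n,
    [/\ pos (fixed_alg al) (d n) /\ cpc_CG (corner setT (d n)) (psi n),
      psi n 1 = d n,
      (forall f f', S f -> S f' ->
        nrm (psi n 1 * psi n (f * f') - psi n f * psi n f') <= n.+1%:R^-1),
      (forall f a, S f -> a \in F ->
        nrm (psi n f * a - a * psi n f) <= n.+1%:R^-1) &
      (forall f g, S f -> nrm (psi n (Lt g f) - al g (psi n f)) <= n.+1%:R^-1)] /\
    [/\ cuntz_sub setT (cutdown (1 - d n) n.+1%:R^-1) x,
      cuntz_sub (fixed_alg al) (cutdown (1 - d n) n.+1%:R^-1) y,
      cuntz_sub (fixed_alg al) (cutdown (1 - d n) n.+1%:R^-1) (d n) &
      1 - n.+1%:R^-1 < nrm (d n * x * d n)].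
Proof.
move=> fS SC S1 px x1 py y0.
have h n : exists dp : A * ((G -> R[i]) -> A),
    [/\ pos (fixed_alg al) dp.1 /\ cpc_CG (corner setT dp.1) dp.2,
      dp.2 1 = dp.1,
      (forall f f', S f -> S f' ->
        nrm (dp.2 1 * dp.2 (f * f') - dp.2 f * dp.2 f') <= n.+1%:R^-1),
      (forall f a, S f -> a \in F ->
        nrm (dp.2 f * a - a * dp.2 f) <= n.+1%:R^-1) &
      (forall f g, S f -> nrm (dp.2 (Lt g f) - al g (dp.2 f)) <= n.+1%:R^-1)] /\
    [/\ cuntz_sub setT (cutdown (1 - dp.1) n.+1%:R^-1) x,
      cuntz_sub (fixed_alg al) (cutdown (1 - dp.1) n.+1%:R^-1) y,
      cuntz_sub (fixed_alg al) (cutdown (1 - dp.1) n.+1%:R^-1) dp.1 &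
      1 - n.+1%:R^-1 < nrm (dp.1 * x * dp.1)].
  have n0 : 0 < n.+1%:R^-1 :> R by rewrite invr_gt0.
  have [d [psi [[pd _] [cpsi [h1 [h2 [h3 [h4 [h5 [h6 [h7 h8]]]]]]]]]]] :=
    wal n0 (finite_seq F) fS SC px x1 py y0.
  exists (d, psi); split; split=> //=.
  - by move=> f f' Sf Sf'; rewrite ltW ?h1.
  - by move=> f a Sf aF; rewrite ltW ?h2.
  - move=> f g Sf; rewrite ltW// -lte_fin (le_lt_trans _ (h3 f Sf))//.
    by apply: ereal_sup_ubound; exists g.
have [dp hdp] := choice h.
by exists (fun n => (dp n).1), (fun n => (dp n).2).
Qed.

Lemma approximating_maps L L0 (x y : A) (e : R) : 0 < e ->
  (forall a, a \in L0 -> fixed_alg al a) ->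
  pos setT x -> nrm x = 1 -> pos (fixed_alg al) y -> y <> 0 ->
  exists (d : A) (phi : A -> A) (t : R),
    [/\ 0 < t <= e, pos (fixed_alg al) d & nrm d <= 1] /\
    [/\ linear phi, cpform phi, phi 1 = d & forall a, fixed_alg al (phi a)] /\
    [/\ forall a b, a \in L -> b \in L -> nrm (phi a * phi b - d * phi (a * b)) <= e,
      forall a, a \in L -> nrm (d * a - a * d) <= e &
      forall a, a \in L0 -> nrm (phi a - cfc Num.sqrt d * a * cfc Num.sqrt d) <= e] /\
    [/\ cuntz_sub setT (cutdown (1 - d) t) x,
      cuntz_sub (fixed_alg al) (cutdown (1 - d) t) y,
      cuntz_sub (fixed_alg al) (cutdown (1 - d) t) d &
      1 - t < nrm (d * x * d)].
Proof.
move=> e0 fL0 px x1 py y0.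
have [E hE] := expectation_ex alP compG.
(* Products are included because (2) also involves phi(ab). *)
pose L2 := [seq a * b | a <- L, b <- L].
pose L1 := L ++ L0 ++ L2.
pose M : R := 1 + \sum_(a <- L1) nrm a.
have aM a : a \in L1 -> nrm a <= M.
  move=> aL; rewrite /M (perm_big _ (perm_to_rem aL)) big_cons /= addrCA lerDl.
  by rewrite addr_ge0//; apply: sumr_ge0 => *; exact: nrm_ge0.
have M1 : 1 <= M by rewrite lerDl; apply: sumr_ge0 => *; exact: nrm_ge0.
have M0 : 0 < M by lra.
(* The errors in (2) add up to at most 31 r M. *)
pose r := Num.min 1 (e / (40 * M)).
have r0 : 0 < r by rewrite lt_min ltr01 divr_gt0// mulr_gt0.
have r1 : r <= 1 by rewrite ge_min lexx.
have rM : r * (40 * M) <= e by rewrite -ler_pdivlMr ?mulr_gt0// ge_min lexx orbT.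
have [m [c [f [fc f0 f1 fL]]]] := partition_unity alP compG L1 r0.
(* The net of translates costs m r' (1 + M), so r' is chosen after the size m of the partition. *)
pose r' := r / (m%:R * (1 + M) + 1).
have k0 : 0 < m%:R * (1 + M) + 1 by rewrite ltr_wpDl// mulr_ge0//; lra.
have r'0 : 0 < r' by rewrite divr_gt0.
have r'M : m%:R * (r' * (1 + M)) <= r.
  rewrite mulrCA /r' -mulrA ger_pMr// mulrC ler_pdivrMr// mul1r lerDl.
  exact: ler01.
pose La := [seq al (c j) a | j <- enum 'I_m, a <- L1].
have [N hN] := translate_net alP compG La r'0 fc.
pose I := 'I_m.
(* Besides 1, psi is tested on the f_j, on the products f_j f_k of [smp_mult], and on the products
   of f_j with translates of f_k of [sws_invariant]. *)
pose S1 := range (fun j : 'I_m => rc (f j)).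
pose S2 := range (fun jk : 'I_m * 'I_m => rc (fun g => f jk.1 g * f jk.2 g)).
pose S3 := range (fun z : 'I_(size N) * ('I_m * 'I_m) => rc (fun h =>
  f z.2.1 h * f z.2.2 ((tnth (in_tuple N) z.1)^-1 * h)%g)).
pose S : set (G -> R[i]) := [set 1] `|` S1 `|` S2 `|` S3.
have fS : finite_set S by rewrite !finite_setU; repeat split; try exact: finite_image; exact: finite_set1.
have SC : S `<=` @CG R G.
  move=> _ [[[->|[j _ <-]]|[jk _ <-]]|[z _ <-]].
  - by rewrite -rc1; apply: CG_rc => g; exact: cvg_cst.
  - exact: CG_rc.
  - by apply: CG_rc; exact: continuous_mulf.
  - by apply: CG_rc; apply: continuous_mulf => //; exact: continuous_translate.
have S1' : S 1 by left; left; left.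
have S1j j : S (rc (f j)) by left; left; right; exists j.
have S2j j k : S (rc (fun g => f j g * f k g)) by left; right; exists (j, k).
have S3j j k g : g \in N -> S (rc (fun h => f j h * f k (g^-1 * h)%g)).
  move=> gN; have /tnthP[i ->] : g \in in_tuple N by [].
  by right; exists (i, (j, k)).
(* The coefficients to which [weighted_sum] is applied, in [smp_mult] (Fm) and in [sws_invariant]
   (Fi), have to be asymptotically central for psi. *)
pose Fm := [seq al (c z.1.1) z.2.1 * (al (c z.1.2) z.2.2 - al (c z.1.1) z.2.2) |
  z <- [seq (jk, ab) | jk <- enum {: 'I_m * 'I_m}, ab <- [seq (a, b) | a <- L, b <- L]]].
pose Fi := [seq al z.1 (al (c z.2.1.2) z.2.2) - al (c z.2.1.1) z.2.2 |
  z <- [seq (g, w) | g <- N, w <- [seq (jk, a) | jk <- enum {: 'I_m * 'I_m}, a <- L1]]].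
have [d [psi hdp]] := @wtrp_sequence (L1 ++ La ++ Fm ++ Fi) S x y fS SC S1' px x1 py y0.
have psiP n : cpc_CG (corner setT (d n)) (psi n) by have [[[_ h]]] := hdp n.
have psi1 n : psi n 1 = d n by have [[]] := hdp n.
have fd n : pos (fixed_alg al) (d n) by have [[[h]]] := hdp n.
have comm (h : G -> R) a : S (rc h) -> a \in L1 ++ La ++ Fm ++ Fi -> comm_null psi h a.
  move=> Sh aF; apply: (null_le _ (@rle_inv_nat R)) => n.
  by have [[_ _ _ hc _] _] := hdp n; exact: hc.
have inL1 a : a \in L1 -> a \in L1 ++ La ++ Fm ++ Fi by move=> aL; rewrite mem_cat aL.
have inLa j a : a \in L1 -> al (c j) a \in L1 ++ La ++ Fm ++ Fi.
  move=> aL; rewrite !mem_cat; apply/orP; right; apply/orP; left.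
  by apply/allpairsP; exists (j, a); rewrite mem_enum.
have LL1 a : a \in L -> a \in L1 by rewrite mem_cat => ->.
have L0L1 a : a \in L0 -> a \in L1 by rewrite !mem_cat => ->; rewrite orbT.
have L2L1 a b : a \in L -> b \in L -> a * b \in L1.
  by move=> aL bL; rewrite !mem_cat allpairs_f ?orbT.
pose phi n a := E (sws al psi c f n a).
have fL1 a : a \in L1 -> forall j g, f j g != 0 -> nrm (al g a - al (c j) a) <= r.
  by move=> aL j g; exact: fL.
(* E moves [sws] a by at most its deviation from invariance, 2 r plus r for the net of translates;
   passing from [sws] to [smp] is free in the limit. *)
have hphi a : a \in L1 -> rle (fun n => nrm (phi n a - smp al psi c f n a)) (3 * r).
  move=> aL t t0; have t20 : 0 < t / 2 by rewrite divr_gt0.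
  have cj j : comm_null psi (f j) (al (c j) a) by apply: comm; [exact: S1j|exact: inLa].
  have [n1 h1] : exists n0, forall n, (n0 <= n)%N -> forall g,
    nrm (al g (sws al psi c f n a) - sws al psi c f n a) <= (r + r + m%:R * (r' * (1 + nrm a))) + t / 2.
    apply: (@sws_invariant _ _ _ _ alP _ _ psiP _ _ _ _ (ltW r0) fc f0 f1 a N r' (ltW r'0)) => //.
    - exact: fL1.
    - move=> g; have [g' g'N [h1 h2]] := hN g; exists g' => //; split => // j.
      by apply: h2; apply/allpairsP; exists (j, a); rewrite mem_enum.
    - move=> g gN j k; apply: comm; first exact: S3j.
      rewrite !mem_cat; apply/orP; right; apply/orP; right; apply/orP; right.
      apply/mapP; exists (g, ((j, k), a)) => //.
      by apply: allpairs_f => //; apply: allpairs_f => //; rewrite mem_enum.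
    - by move=> n j g; have [[_ _ _ _ he] _] := hdp n; exact: he.
  have [n2 h2] := smp_sws psiP fc f0 f1 cj t20.
  exists (maxn n1 n2) => n; rewrite geq_max => /andP[/h1 k1 /h2 k2].
  have k3 := expect_dist alP compG hE k1.
  rewrite (le_trans (nrm_tri (sws al psi c f n a) _ _))//.
  rewrite [nrm (sws _ _ _ _ _ _ - smp _ _ _ _ _ _)]nrmBC.
  have : m%:R * (r' * (1 + nrm a)) <= r.
    apply: le_trans r'M; rewrite ler_wpM2l// ler_wpM2l ?(ltW r'0)// lerD2l.
    exact: aM.
  move: k3; rewrite -/(phi n a); move: (_ * (r' * _)) => z; lra.
have hmul ab : ab \in [seq (a, b) | a <- L, b <- L] ->
    rle (fun n => nrm (smp al psi c f n ab.1 * smp al psi c f n ab.2 -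
      d n * smp al psi c f n (ab.1 * ab.2))) (2 * M * r).
  move=> /allpairsP[[a b] [/= aL bL ->]] /=.
  apply: rle_le (smp_mult alP psiP psi1 (ltW r0) fc f0 f1 _ _ _ _) => //.
  - have -> : 2 * M * r = M * (r + r) by ring.
    by rewrite ler_wpM2r ?addr_ge0 ?(ltW r0)//; apply/aM/LL1.
  - by apply/fL1/LL1.
  - by move=> j k; apply: comm; [exact: S1j|apply/inLa/LL1].
  - move=> j k; apply: comm; first exact: S2j.
    rewrite !mem_cat; apply/orP; right; apply/orP; right; apply/orP; left.
    apply/mapP; exists ((j, k), (a, b)) => //.
    by apply: allpairs_f; [rewrite mem_enum|exact: allpairs_f].
  - move=> j k; apply: (null_le _ (@rle_inv_nat R)) => n.
    by have [[_ _ hm _ _] _] := hdp n; apply: hm.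
have dpsd n : psd (d n) by exact: pos_psd (fd n).
have dn1 n : nrm (d n) <= 1 := nrm_d psiP psi1 n.
have hcomm a : a \in L1 -> null (fun n => d n * a - a * d n).
  move=> aL; apply: null_ext (comm (fun=> 1) a _ (inL1 a aL)); last by rewrite rc1.
  by move=> n; rewrite rc1 psi1.
have hsq a : a \in L0 -> null (fun n => d n * a - cfc Num.sqrt (d n) * a * cfc Num.sqrt (d n)).
  move=> aL; have := @sandwich_null R A 'I_1 (fun=> d) (fun=> a) (fun=> dpsd) (fun=> dn1)
    (fun=> hcomm a (L0L1 a aL)).
  by apply: null_ext => n; rewrite !big_ord1.
have [n1 h1] := rle_seq r0 hphi.
have [n2 h2] := rle_seq r0 hmul.
have [n3 h3] := rle_seq r0 hcomm.
have [n4 h4] := rle_seq r0 hsq.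
have [n5 h5] := @rle_inv_nat R _ e0.
pose n := maxn n1 (maxn n2 (maxn n3 (maxn n4 n5))).
have l1 : (n1 <= n)%N by rewrite leq_maxl.
have l2 : (n2 <= n)%N by rewrite /n !leq_max leqnn !orbT.
have l3 : (n3 <= n)%N by rewrite /n !leq_max leqnn !orbT.
have l4 : (n4 <= n)%N by rewrite /n !leq_max leqnn !orbT.
have l5 : (n5 <= n)%N by rewrite /n !leq_max leqnn !orbT.
have {}h1 := h1 n l1; have {}h2 := h2 n l2; have {}h3 := h3 n l3.
have {}h4 := h4 n l4; have {}h5 := h5 n l5.
have [[[_ _] _ _ _ _] [q1 q2 q3 q4]] := hdp n.
have rM1 : r <= r * M by rewrite ler_pMr.
have phiL : linear (phi n).
  by move=> z a b; rewrite /phi (sws_linear alP) (expect_linear alP compG hE).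
have phiP : cpform (phi n).
  exact: (expect_cpform alP compG hE (sws_cpform alP psiP c fc f0 n)).
have phi1 : phi n 1 = d n.
  rewrite /phi (sws_one alP psiP psi1 c fc f0 f1) (expect_id alP compG hE)//.
  have [b bf ->] := fd n; apply: (csubM (csub_fixed alP)) => //.
  exact: (csubS (csub_fixed alP)).
have p1d : psd (1 - d n).
  by have := psd_sqrt_le (psd_sa (dpsd n)) (dn1 n); rewrite scale1r.
exists (d n), (phi n), n.+1%:R^-1; split; [|split; [|split]].
- by split=> //; rewrite invr_gt0 ltr0Sn/=; rewrite add0r in h5.
- by split=> // a; exact: (expect_fixed alP compG hE).
- split.
  + move=> a b aL bL.
    have xa := h1 a (LL1 a aL); have xb := h1 b (LL1 b bL); have xab := h1 _ (L2L1 a b aL bL).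
    have xm := h2 (a, b) (allpairs_f _ aL bL); rewrite /= in xm.
    move: xa xb xab xm; set Ta := smp _ _ _ _ _ a; set Tb := smp _ _ _ _ _ b.
    set Tab := smp _ _ _ _ _ (a * b) => xa xb xab xm.
    have pM z : z \in L -> nrm (phi n z) <= M.
      move=> zL; rewrite (le_trans _ (aM z (LL1 z zL)))//.
      by apply: cp_contractive => //; rewrite phi1.
    have [pa pb] := (pM a aL, pM b bL).
    have -> : phi n a * phi n b - d n * phi n (a * b) =
       (phi n a - Ta) * phi n b + Ta * (phi n b - Tb) + (Ta * Tb - d n * Tab) -
       d n * (phi n (a * b) - Tab).
      have -> : (phi n a - Ta) * phi n b + Ta * (phi n b - Tb) = phi n a * phi n b - Ta * Tb.
        by rewrite mulrBl mulrBr addrA subrK.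
      by rewrite [d n * (_ - _)]mulrBr addrA subrK opprB addrA subrK.
    have Ta4 : nrm Ta <= M + 4 * r.
      by rewrite (le_trans (nrm_dist _ (phi n a)))// lerD// nrmBC; lra.
    have k1 : nrm ((phi n a - Ta) * phi n b) <= 4 * r * M.
      by rewrite (le_trans (nrmM _ _))// ler_pM ?nrm_ge0//; lra.
    have k2 : nrm (Ta * (phi n b - Tb)) <= (M + 4 * r) * (4 * r).
      by rewrite (le_trans (nrmM _ _))// ler_pM ?nrm_ge0//; lra.
    have k3 : nrm (d n * (phi n (a * b) - Tab)) <= 1 * (4 * r).
      by rewrite (le_trans (nrmM _ _))// ler_pM ?nrm_ge0//; lra.
    have rr : r * r <= r * M by rewrite ler_pM2l// (le_trans r1).
    have := nrmB ((phi n a - Ta) * phi n b + Ta * (phi n b - Tb) + (Ta * Tb - d n * Tab)) (d n * (phi n (a * b) - Tab)).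
    have := nrmD ((phi n a - Ta) * phi n b + Ta * (phi n b - Tb)) (Ta * Tb - d n * Tab).
    have := nrmD ((phi n a - Ta) * phi n b) (Ta * (phi n b - Tb)).
    lra.
  + move=> a aL; apply: (le_trans (h3 a (LL1 a aL))); rewrite add0r; lra.
  (* phi(a) is near [smp] a, which is d a as a is fixed, and d a is near d^(1/2) a d^(1/2) as d
     almost commutes with a. *)
  + move=> a aL; have := h1 a (L0L1 a aL); have := h4 a aL.
    rewrite (smp_fixed psiP psi1 c fc f1 n (fL0 a aL)).
    set s := cfc _ _ * _ * _ => k1 k2.
    have := nrm_tri (d n * a) (phi n a) s; lra.
- by split.
Qed.

End Core.

(** * Cuntz comparison *)

Section CuntzComparison.
Variables (R : realType) (A : cstarAlgType R).
Implicit Types (a b h : A) (B : set A) (e t k : R).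

Lemma continuous_cutfun e : continuous (fun t : R => Num.max 0 (t - e)).
Proof.
apply: continuous_fmax => t; first exact: cvg_cst.
by apply: cvgB; [exact: cvg_id|exact: cvg_cst].
Qed.

Lemma cutdown_factor B h e e' : csub B -> B 1 -> B h -> star h = h -> e' < e ->
  exists w, [/\ B w, star w = w & cutdown h e = w * cutdown h e' * w].
Proof.
move=> hB B1 Bh sh ee'.
(* This equals t - e' for t >= e, the only place where (t - e)_+ is nonzero, and stays positive, so
   that the quotient is continuous. *)
pose den (t : R) := Num.max (t - e') (e - e').
have den0 t : 0 < den t by rewrite lt_max !subr_gt0 ee' orbT.
pose g (t : R) := Num.sqrt (Num.max 0 (t - e) * (den t)^-1).
have cid s : continuous (fun t : R => t - s).
  by move=> t; apply: cvgB; [exact: cvg_id|exact: cvg_cst].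
have cg : continuous g.
  apply: continuous_sqrt_comp => t; apply: cvgM; first exact: continuous_cutfun.
  apply: cvgV; first by rewrite gt_eqF.
  have cden : continuous den by apply: continuous_fmax; [exact: cid|move=> s; exact: cvg_cst].
  exact: cden.
have cc s := @continuous_cutfun s.
exists (cfc g h); split; [exact: csub_cfc|exact: cfc_sa|].
rewrite /cutdown -cfcM// -cfcM//; last by move=> t; apply: cvgM; [exact: cg|exact: cc].
congr (cfc _ h); apply/funext => t; rewrite mulrAC.
have x0 : 0 <= Num.max 0 (t - e) * (den t)^-1.
  by rewrite mulr_ge0 ?le_max ?lexx// invr_ge0 ltW.
rewrite /g sqrtrM_self//; have [te|te] := leP (t - e) 0; first by rewrite !mul0r.
have h1 : 0 < t - e' by lra.
have -> : den t = t - e' by rewrite /den; apply/max_idPl; lra.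
have -> : Num.max 0 (t - e') = t - e' by apply/max_idPr; lra.
by rewrite mulfVK// gt_eqF.
Qed.

(** The same stabilization serves, with r_n replaced by r_n W, where W is the copy of the factor
    w. *)
Lemma cuntz_cutdown_mono B h e e' z : csub B -> B 1 -> B h -> star h = h -> e' <= e ->
  cuntz_sub B (cutdown h e') z -> cuntz_sub B (cutdown h e) z.
Proof.
move=> hB B1 Bh sh; rewrite le_eqVlt => /predU1P[->//|ee'].
have [w [Bw sw ->]] := cutdown_factor hB B1 Bh sh ee'.
move=> [S [mul [st [E [stab [r hr]]]]]]; exists S, mul, st, E; split => //.
have Bc : B (cutdown h e') by apply: csub_cfc => //; exact: continuous_cutfun.
have [algS csS _ eM eS _ _] := stab.
pose W := E 0%N 0%N w.
exists (fun n => mul (r n) W).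
have mA := alg_mulA algS.
have mB1 (a b c : S) : mul (a - b) c = mul a c - mul b c.
  have := alg_mulDl algS (-1) b a c; rewrite !scaleN1r [- b + a]addrC => ->.
  by rewrite addrC.
have mB2 (a b c : S) : mul a (b - c) = mul a b - mul a c.
  have := alg_mulDr algS (-1) a c b; rewrite !scaleN1r [- c + b]addrC => ->.
  by rewrite addrC.
have sW : st W = W by rewrite /W eS// sw.
have -> : E 0%N 0%N (w * cutdown h e' * w) = mul (mul W (E 0%N 0%N (cutdown h e'))) W.
  by rewrite !eM//; apply: csubM.
have key n : nrm (mul (mul (st (mul (r n) W)) (E 0%N 0%N z)) (mul (r n) W) -
      mul (mul W (E 0%N 0%N (cutdown h e'))) W) <= nrm W * nrm W *
    nrm (mul (mul (st (r n)) (E 0%N 0%N z)) (r n) - E 0%N 0%N (cutdown h e')).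
  have -> : mul (mul (st (mul (r n) W)) (E 0%N 0%N z)) (mul (r n) W) -
      mul (mul W (E 0%N 0%N (cutdown h e'))) W =
      mul (mul W (mul (mul (st (r n)) (E 0%N 0%N z)) (r n) - E 0%N 0%N (cutdown h e'))) W.
    by rewrite mB2 mB1 (cstar_mul csS) sW !mA.
  rewrite (le_trans (cstar_le csS _ _))// mulrAC ler_wpM2r ?nrm_ge0//.
  exact: (cstar_le csS).
apply/cvgrPdist_le => t t0.
have c0 : 0 < nrm W * nrm W + 1 by rewrite ltr_wpDl// mulr_ge0 ?nrm_ge0.
have /cvgrPdist_le/(_ _ (divr_gt0 t0 c0)) := hr.
apply: filterS => n; rewrite !sub0r !normrN !ger0_norm ?nrm_ge0// => hn.
rewrite (le_trans (key n))//; move: hn; rewrite ler_pdivlMr// => hn.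
apply: le_trans hn; rewrite mulrC ler_wpM2l ?nrm_ge0//.
by rewrite lerDl.
Qed.

End CuntzComparison.

(** * The lower bound on the norm *)

Section Simplicity.
Variables (R : realType) (A : cstarAlgType R).
Hypothesis simA : simple_cstar A.
Implicit Types (a b h x y : A) (e t k : R).

(** The closure of the algebraic ideal of x is A, so this ideal has an element at distance less than
    1 from 1. Such an element is invertible, and the ideal contains 1 without closure. *)
Lemma simple_full x : x <> 0 -> exists s : seq (A * A), \sum_(p <- s) p.1 * x * p.2 = 1.
Proof.
move=> x0; pose I0 := [set y | exists s : seq (A * A), y = \sum_(p <- s) p.1 * x * p.2].
pose I := closure I0.
have iD a b : I0 a -> I0 b -> I0 (a + b).
  by move=> [s ->] [t ->]; exists (s ++ t); rewrite big_cat.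
have iL a b : I0 b -> I0 (a * b).
  move=> [s ->]; exists [seq (a * p.1, p.2) | p <- s].
  by rewrite big_map mulr_sumr; apply: eq_bigr => p _; rewrite !mulrA.
have iR a b : I0 a -> I0 (a * b).
  move=> [s ->]; exists [seq (p.1, p.2 * b) | p <- s].
  by rewrite big_map mulr_suml; apply: eq_bigr => p _; rewrite !mulrA.
have [] := simA (I := I).
- exact: closed_closure.
- by apply: subset_closure; exists [::]; rewrite big_nil.
- move=> a b ha hb.
  have h1 s : I0 s -> I `<=` [set l | I (s + l)].
    move=> Is; apply: closure_sub_clim; first by move=> l Il; apply/subset_closure/iD.
    apply: (@clim_preim _ _ (fun l => s + l) 1); last exact: clim_closure.
    by move=> u v; rewrite opprD addrACA subrr add0r mul1r.
  have : I `<=` [set l | I (l + b)].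
    apply: closure_sub_clim; first by move=> s Is; exact: (h1 s Is b hb).
    apply: (@clim_preim _ _ (fun l => l + b) 1); last exact: clim_closure.
    by move=> u v; rewrite opprD addrACA subrr addr0 mul1r.
  exact.
- move=> a b; suff : I `<=` [set l | I (a * l)] by apply.
  apply: closure_sub_clim; first by move=> l Il; apply/subset_closure/iL.
  apply: (@clim_preim _ _ (fun l => a * l) (nrm a)); last exact: clim_closure.
  by move=> u v; rewrite -mulrBr nrmM.
- move=> a b; suff : I `<=` [set l | I (l * b)] by apply.
  apply: closure_sub_clim; first by move=> l Il; apply/subset_closure/iR.
  apply: (@clim_preim _ _ (fun l => l * b) (nrm b)); last exact: clim_closure.
  by move=> u v; rewrite -mulrBl mulrC nrmM.
- move=> I0E; exfalso; apply: x0.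
  have : I x by apply: subset_closure; exists [:: (1, 1)]; rewrite big_seq1 mul1r mulr1.
  by rewrite I0E.
move=> IT; have : I 1 by rewrite IT.
move=> /closure_nrmP/(_ 1 ltr01)[y [s ys] y1].
have [v [_ yv]] : ainv y by have := neumann y1; rewrite opprB addrC subrK.
have [s' e] : I0 1 by rewrite -yv; apply: iR; exists s.
by exists s'.
Qed.

(* The [c_i] are cut off by a function of [a^* a] concentrated near its norm. *)
Lemma simple_partition a e : 0 < e -> exists n (c : 'I_n -> A),
  \sum_i star (c i) * c i = 1 /\
  psd (\sum_i star (c i) * (star a * a) * c i - (nrm a ^+ 2 - e)%:C%:A).
Proof.
move=> e0; set u := star a * a; set k := nrm a ^+ 2 - e.
have pu : psd u by exact: psd_starM.
have su := psd_sa pu.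
have ck := @continuous_cutfun R k.
pose x := cfc (fun t => Num.max 0 (t - k)) u.
have sx : star x = x by exact: cfc_sa.
have cid : continuous (fun t : R => t - k).
  by move=> t; apply: cvgB; [exact: cvg_id|exact: cvg_cst].
have uk : u - k%:C%:A = cfc (fun t => t - k) u.
  have -> : (fun t : R => t - k) = (fun t => ('X - k%:P).[t]).
    by apply/funext => t; rewrite hornerD hornerN hornerX hornerC.
  by rewrite cfc_horner// pevB pevX pevC.
(* If x = 0 then u <= k, which gives |a|^2 <= |a|^2 - e. *)
have x0 : x <> 0.
  move=> x0; have : psd (x - (u - k%:C%:A)).
    have cN : continuous (fun t : R => - (t - k)) by move=> t; apply: cvgN; exact: cid.
    have -> : - (u - k%:C%:A) = cfc (fun t => - (t - k)) u.
      have -> : (fun t : R => - (t - k)) = (fun t => (- ('X - k%:P)).[t]).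
        by apply/funext => t; rewrite hornerN hornerD hornerN hornerX hornerC.
      by rewrite cfc_horner// -[- ('X - _)]sub0r pevB -[0]/(0%:P) pevC scale0r sub0r pevB pevX pevC.
    rewrite /x -cfcD//; apply: cfc_psd => //.
      by move=> t; apply: cvgD; [exact: ck|exact: cN].
    by move=> t _; rewrite subr_ge0 le_max lexx orbT.
  rewrite x0 sub0r opprB => /(psd_nrm_le pu).
  by rewrite nrm_starM /k lerBrDr gerDl leNgt e0.
have px : psd (x * (u - k%:C%:A) * x).
  have cxk : continuous (fun t : R => Num.max 0 (t - k) * (t - k)).
    by move=> t; apply: cvgM; [exact: ck|exact: cid].
  rewrite uk /x -!cfcM//; apply: cfc_psd => //.
    by move=> t; apply: cvgM; [exact: cxk|exact: ck].
  move=> t _; have [tk|tk] := leP (t - k) 0; first by rewrite mulr0.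
  by rewrite !mulr_ge0// ltW.
have [s es] := simple_full x0.
pose l (i : 'I_(size s)) := (tnth (in_tuple s) i).1.
pose r (i : 'I_(size s)) := (tnth (in_tuple s) i).2.
have es' : \sum_i star (star (l i)) * (x * r i) = 1.
  by rewrite -es [RHS]big_tnth; apply: eq_bigr => i _; rewrite starK mulrA.
pose z := \sum_i star (x * r i) * (x * r i).
pose M := nrm (\sum_i star (star (l i)) * star (l i)) + 1.
have M0 : 0 < M by rewrite ltr_wpDl ?nrm_ge0.
have Mi0 : 0 < M^-1 by rewrite invr_gt0.
have pz : psd z by apply: psd_sum => i _; exact: psd_starM.
have sz := psd_sa pz.
(* Cauchy-Schwarz for 1 = sum l_i (x r_i). Thus z is bounded below, and the x r_i can be normalized
   by z^(-1/2). *)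
have zM : psd (z - M^-1%:C%:A).
  have := @psd_cauchy_schwarz _ _ _ (fun i => star (l i)) (fun i => x * r i) M M0.
  rewrite lerDl ler01 es' star1 mulr1 => /(_ isT) /(@psdZ _ _ M^-1).
  by rewrite ltW// scalerBr scaleRA mulVf ?gt_eqF// scale1r; apply.
have zsp t : spectrum z t%:C -> M^-1 <= t.
  move=> ht; rewrite leNgt; apply/negP => tM; apply: ht.
  rewrite -opprB; apply/ainvN/(@psd_ge_ainv _ _ _ (M^-1 - t)); first by rewrite subr_gt0.
  by rewrite rmorphB/= scalerBl opprB addrA subrK.
(* This is t^(-1/2) on the spectrum of z; the maximum keeps it continuous on the whole line. *)
pose g (t : R) := (Num.sqrt (Num.max t M^-1))^-1.
have mx0 t : 0 < Num.max t M^-1 by rewrite lt_max Mi0 orbT.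
have cid' : continuous (@id R) by move=> t; exact: cvg_id.
have cg : continuous g.
  move=> t; apply: cvgV; first by rewrite gt_eqF// sqrtr_gt0.
  apply: (continuous_sqrt_comp (f := fun t => Num.max t M^-1)).
  by apply: continuous_fmax => // t'; exact: cvg_cst.
pose w := cfc g z; have sw : star w = w by exact: cfc_sa.
have wzw : w * z * w = 1.
  have cgi : continuous (fun t => g t * t).
    by move=> t; apply: cvgM; [exact: cg|exact: cvg_id].
  rewrite -[z]cfc_id// /w -!cfcM//.
  transitivity (cfc (fun t => (1%:P).[t]) z); last first.
    by rewrite cfc_horner// pevC scale1r.
  apply: cfc_ext => //.
  - by move=> t; apply: cvgM; [exact: cgi|exact: cg].
  - exact: continuous_horner.
  move=> t /zsp tM; rewrite hornerC mulrAC /g (max_idPl tM) -invfM sqrtrM_self.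
    by rewrite mulVf// gt_eqF// (lt_le_trans Mi0).
  by rewrite (le_trans (ltW Mi0)).
exists (size s), (fun i => x * r i * w).
have e1 : \sum_i star (x * r i * w) * (x * r i * w) = 1.
  rewrite -wzw /z mulr_sumr mulr_suml; apply: eq_bigr => i _.
  by rewrite !starM sw !mulrA.
split=> //.
have -> : \sum_i star (x * r i * w) * u * (x * r i * w) - k%:C%:A =
    \sum_i star (r i * w) * (x * (u - k%:C%:A) * x) * (r i * w).
  rewrite -[in LHS]e1 scaler_sumr -sumrB; apply: eq_bigr => i _.
  rewrite -[in star (x * _ * w)]mulrA [star (x * _)]starM sx !mulrBr !mulrBl.
  by rewrite -!scalerAr -!scalerAl mulr1 mulrBr !mulrBl -!scalerAr -!scalerAl !mulrA.
by apply: psd_sum => i _; exact: psd_conj.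
Qed.

End Simplicity.

(** * Asymptotic isometry from asymptotic multiplicativity *)

Section ApproximateIsometry.
Variables (R : realType) (A : cstarAlgType R) (d : nat -> A) (phi : nat -> A -> A).
Implicit Types (a b : A) (e k : R).
Hypothesis phiL : forall n, linear (phi n).
Hypothesis phiP : forall n, cpform (phi n).
Hypothesis phi1 : forall n, phi n 1 = d n.
Hypothesis d1 : forall n, nrm (d n) <= 1.
Hypothesis dlim : rle (fun n => 1 - nrm (d n)) 0.

Let amul a b := null (fun n => phi n a * phi n b - d n * phi n (a * b)).

Let pd n : psd (d n).
Proof. by rewrite -phi1; apply: cp_psd => //; exact: psd1. Qed.

Let phi_le n b : nrm (phi n b) <= nrm b.
Proof.
apply: cp_contractive => //; rewrite phi1.
by have := psd_sqrt_le (psd_sa (pd n)) (d1 n); rewrite scale1r.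
Qed.

Lemma null_starM (u v : nat -> A) C : 0 <= C ->
  (forall n, nrm (u n) <= C) -> (forall n, nrm (v n) <= C) ->
  null (fun n => u n - v n) -> null (fun n => star (u n) * u n - star (v n) * v n).
Proof.
move=> C0 uC vC uv.
have uv' : null (fun n => star (u n - v n)).
  by apply: (rle_le _ _ uv) => // n; rewrite nrm_star.
have uC' n : nrm (star (u n)) <= C by rewrite nrm_star.
apply: (null_ext _ (nullD (null_mull C0 uC' uv) (null_mulr C0 vC uv'))) => n.
by rewrite starB mulrBr mulrBl addrA subrK.
Qed.

(** Y, the sum of the squares of the phi(a) phi(c_i), is at most |phi(a)|^2 X, where |X| is
    asymptotically at most 1. On the other side Y is close to d^2 phi(z) d, whose norm is at least k
    |d|^8 because phi(z) >= k d. *)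
Lemma isometry_defect m (c : 'I_m -> A) a k : 0 <= k ->
  \sum_i star (c i) * c i = 1 ->
  psd (\sum_i star (c i) * (star a * a) * c i - k%:C%:A) ->
  (forall i, amul (star (c i)) (c i)) -> (forall i, amul a (c i)) ->
  (forall i, amul (star (a * c i)) (a * c i)) -> (forall i, amul (a * c i) 1) ->
  exists2 w : nat -> R, rle w 0 & forall n, k <= nrm (phi n a) ^+ 2 + w n.
Proof.
move=> k0 c1 ck m1 m2 m3 m4.
pose z := \sum_i star (c i) * (star a * a) * c i.
pose f i n := phi n (c i); pose q i n := phi n (a * c i).
pose X n := \sum_i star (f i n) * f i n.
pose p i n := phi n a * f i n.
pose Y n := \sum_i star (p i n) * p i n.
have phi_star n b : phi n (star b) = star (phi n b) by exact: cp_star.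
have nX : null (fun n => X n - d n * d n).
  apply: (null_ext _ (null_sum (index_enum 'I_m) (P := xpredT) (fun i _ => m1 i))) => n.
  by rewrite sumrB -mulr_sumr -lin_sum// c1 phi1; congr (_ - _); apply: eq_bigr => i _; rewrite phi_star.
have nW : null (fun n => \sum_i star (q i n) * q i n - d n * phi n z).
  apply: (null_ext _ (null_sum (index_enum 'I_m) (P := xpredT) (fun i _ => m3 i))) => n.
  rewrite sumrB -mulr_sumr -lin_sum//; congr (_ - _ * phi n _).
    by apply: eq_bigr => i _; rewrite phi_star.
  by apply: eq_bigr => i _; rewrite starM !mulrA.
(* The pair (a c_i, 1) expresses that d almost commutes with phi(a c_i), which moves d to the right
   of it. *)
have nq i : null (fun n => p i n - q i n * d n).
  apply: (null_ext _ (nullD (m2 i) (null_mulr ler01 (v := fun=> -1) _ (m4 i)))) => n.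
    by rewrite mulr1 phi1 mulrN1 opprB addrA subrK.
  by rewrite nrmN nrm1.
pose C := nrm a * \sum_i nrm (c i).
have ciC i : nrm a * nrm (c i) <= C.
  rewrite ler_wpM2l ?nrm_ge0// (bigD1 i)//= lerDl.
  by apply: sumr_ge0 => *; exact: nrm_ge0.
have C0 : 0 <= C by rewrite mulr_ge0 ?nrm_ge0//; apply: sumr_ge0 => *; exact: nrm_ge0.
have qC i n : nrm (q i n) <= C by rewrite (le_trans (phi_le _ _))// (le_trans (nrmM _ _)).
have nY : null (fun n => Y n - d n * (d n * phi n z) * d n).
  have h i : null (fun n => star (p i n) * p i n - star (q i n * d n) * (q i n * d n)).
    apply: (null_starM C0) => // n.
      by rewrite (le_trans (nrmM _ _))// (le_trans _ (ciC i))// ler_pM ?nrm_ge0 ?phi_le.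
    by rewrite (le_trans (nrmM _ _))// -[leRHS]mulr1 ler_pM ?nrm_ge0.
  have h2 := null_mull ler01 d1 (null_mulr ler01 d1 nW).
  apply: (null_ext _ (nullD (null_sum (index_enum 'I_m) (P := xpredT) (fun i _ => h i)) h2)) => n.
  rewrite sumrB mulrA mulrBr mulrBl addrA; congr (_ - _).
  rewrite -[RHS]addr0 -addrA; congr (_ + _); apply/eqP; rewrite addrC subr_eq0; apply/eqP.
  rewrite mulr_sumr mulr_suml; apply: eq_bigr => i _.
  by rewrite starM (psd_sa (pd n)) !mulrA.
(* The C*-identity gives |d^m| = |d|^m for powers of two, and 8 is the first one above 5; the
   surplus factors are contractions. *)
have dpow n : nrm (d n) ^+ 8 <= nrm (d n * d n * d n * d n * d n).
  have sd := psd_sa (pd n); set x := d n in sd *.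
  have s2 : star (x * x) = x * x by rewrite starM sd.
  have s4 : star (x * x * (x * x)) = x * x * (x * x) by rewrite starM s2.
  have -> : nrm x ^+ 8 = nrm (x * x * (x * x) * (x * x * (x * x))).
    by rewrite nrm_sa_sqr// nrm_sa_sqr// nrm_sa_sqr// -!exprM.
  have -> : x * x * (x * x) * (x * x * (x * x)) = x * x * x * x * x * (x * x * x) by rewrite !mulrA.
  rewrite (le_trans (nrmM _ _))// -[leRHS]mulr1 ler_wpM2l ?nrm_ge0//.
  rewrite (le_trans (nrmM _ _))// mulr_ile1 ?nrm_ge0 ?d1//.
  by rewrite (le_trans (nrmM _ _))// mulr_ile1 ?nrm_ge0 ?d1.
(* One more contraction d on the right makes the element symmetric: d^2 phi(z) d^2 >= k d^5. *)
have lowY n : k * nrm (d n) ^+ 8 <= nrm (d n * (d n * phi n z) * d n).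
  have sd := psd_sa (pd n).
  apply: (le_trans (ler_wpM2l k0 (dpow n))).
  rewrite -nrmZp//.
  have e1 : d n * (d n * phi n z) * d n * d n = star (d n * d n) * phi n z * (d n * d n).
    by rewrite starM sd !mulrA.
  have e2 : k%:C *: (d n * d n * d n * d n * d n) =
      star (d n * d n) * phi n (k%:C%:A) * (d n * d n).
    by rewrite starM sd lin_Z// phi1 -scalerAr -scalerAl !mulrA.
  have le1 : nrm (d n * (d n * phi n z) * d n * d n) <= nrm (d n * (d n * phi n z) * d n).
    by rewrite (le_trans (nrmM _ _))// -[leRHS]mulr1 ler_wpM2l ?nrm_ge0.
  apply: le_trans le1; rewrite e1 e2; apply: psd_mono.
    by apply/psd_conj/cp_psd => //; exact: psdr.
  by rewrite -mulrBl -mulrBr -lin_B//; apply/psd_conj/cp_psd.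
have upY n : nrm (Y n) <= nrm (phi n a) ^+ 2 * nrm (X n).
  rewrite -nrmZp ?exprn_ge0 ?nrm_ge0//; apply: psd_mono.
    by apply: psd_sum => i _; exact: psd_starM.
  rewrite scaler_sumr -sumrB; apply: psd_sum => i _.
  have -> : (nrm (phi n a) ^+ 2)%:C *: (star (f i n) * f i n) - star (p i n) * p i n =
      star (f i n) * ((nrm (phi n a) ^+ 2)%:C%:A - star (phi n a) * phi n a) * f i n.
    by rewrite mulrBr mulrBl -scalerAr mulr1 -scalerAl starM !mulrA.
  exact/psd_conj/psd_nrm_starM.
pose T := nrm a ^+ 2.
pose w n := nrm (Y n - d n * (d n * phi n z) * d n) + T * nrm (X n - d n * d n) +
   k * (8 * (1 - nrm (d n))).
exists w.
  have T0 : 0 <= T by rewrite exprn_ge0 ?nrm_ge0.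
  have := rleD (rleD nY (rleM T0 nX)) (rleM k0 (rleM (ler0n _ 8) dlim)).
  by rewrite !mulr0 !addr0.
move=> n.
have t0 : 0 <= nrm (phi n a) ^+ 2 by rewrite exprn_ge0 ?nrm_ge0.
have tT : nrm (phi n a) ^+ 2 <= T by rewrite ler_pXn2r ?nnegrE ?nrm_ge0.
have hX : nrm (X n) <= 1 + nrm (X n - d n * d n).
  rewrite -[X in nrm (X : A) <= _](subrK (d n * d n)) (le_trans (nrmD _ _))// addrC lerD2r.
  by rewrite (le_trans (nrmM _ _))// mulr_ile1 ?nrm_ge0.
have hY : nrm (d n * (d n * phi n z) * d n) <= nrm (Y n) + nrm (Y n - d n * (d n * phi n z) * d n).
  move: (d n * _ * d n) => V; rewrite -[X in nrm X <= _](subrK (Y n)) (le_trans (nrmD _ _))//.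
  by rewrite addrC [nrm (V - _)]nrmBC.
(* Bernoulli's inequality, from three uses of 2 x - 1 <= x^2. *)
have h8 : 1 - 8 * (1 - nrm (d n)) <= nrm (d n) ^+ 8.
  move: (d1 n) (nrm_ge0 (d n)); move: (nrm (d n)) => t t1 tt0.
  have -> : t ^+ 8 = ((t ^+ 2) ^+ 2) ^+ 2 by rewrite -!exprM.
  have b (x y : R) : 2 * x - 1 <= x ^+ 2 by have := sqr_ge0 (x - 1); rewrite sqrrB1; lra.
  have := b t 0; have := b (t ^+ 2) 0; have := b ((t ^+ 2) ^+ 2) 0; lra.
have := hY; have := lowY n; have := upY n; have := ler_wpM2l k0 h8; have := ler_wpM2l t0 hX.
have := ler_wpM2r (nrm_ge0 (X n - d n * d n)) tT.
rewrite /w; move: (nrm (d n * (d n * phi n z) * d n)) (nrm (X n - _)) (nrm (d n)) (nrm (phi n a) ^+ 2) (nrm (Y n)) (nrm (Y n - _)) (nrm (X n)) => *.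
lra.
Qed.

End ApproximateIsometry.

(** L is found before d and phi, which allows the maps to be chosen so as to be asymptotically
    multiplicative on it. *)
Lemma approx_isometry (R : realType) (A : cstarAlgType R) (a : A) (e : R) :
  simple_cstar A -> 0 < e -> exists L : seq A, forall (d : nat -> A) (phi : nat -> A -> A),
    (forall n, linear (phi n)) -> (forall n, cpform (phi n)) ->
    (forall n, phi n 1 = d n) -> (forall n, nrm (d n) <= 1) ->
    rle (fun n => 1 - nrm (d n)) 0 ->
    (forall b c, b \in L -> c \in L ->
      null (fun n => phi n b * phi n c - d n * phi n (b * c))) ->
    rle (fun n => nrm a - nrm (phi n a)) e.
Proof.
move=> simA e0.
have [ae|ea] := leP (nrm a) e.
  exists [::] => d phi _ _ _ _ _ _.
  apply: (rle_le _ ae (rle_cst (nrm a))) => n; by rewrite gerBl nrm_ge0.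
(* An error e^2 in |phi(a)|^2 suffices, as (|a| - e)^2 <= |a|^2 - e^2 for |a| >= e. Half of it is
   spent on the c_i, half on the limit. *)
have e2 : 0 < e ^+ 2 / 2 by rewrite divr_gt0// exprn_gt0.
have [m [c [c1 ck]]] := simple_partition simA a e2.
set k := nrm a ^+ 2 - _ in ck.
have eN : e ^+ 2 <= nrm a ^+ 2 by rewrite ler_pXn2r ?nnegrE ?nrm_ge0// ltW.
have k0 : 0 <= k by rewrite /k; lra.
exists (1 :: a :: codom (fun i => star (c i)) ++ codom c ++
  codom (fun i => star (a * c i)) ++ codom (fun i => a * c i)).
move=> d phi phiL phiP phi1 d1 dlim hL.
have [||||w w0 hw] := isometry_defect phiL phiP phi1 d1 dlim k0 c1 ck.
- by move=> i; apply: hL; rewrite !inE !mem_cat codom_f ?orbT.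
- by move=> i; apply: hL; rewrite !inE !mem_cat ?eqxx ?(codom_f c) ?orbT.
- by move=> i; apply: hL; rewrite !inE !mem_cat ?codom_f ?(codom_f (fun i => a * c i)) ?orbT.
- by move=> i; apply: hL; rewrite !inE !mem_cat ?(codom_f (fun i => a * c i)) ?eqxx ?orbT.
move=> r r0; have [N hN] := w0 _ e2; exists N => n /hN.
rewrite add0r => wn; have := hw n; rewrite /k => h.
have h1 : nrm a ^+ 2 - e ^+ 2 <= nrm (phi n a) ^+ 2 by lra.
have : nrm a - e <= nrm (phi n a); last lra.
rewrite leNgt; apply/negP => lt.
have : nrm (phi n a) ^+ 2 < (nrm a - e) ^+ 2.
  by rewrite ltr_pXn2r ?nnegrE ?nrm_ge0// subr_ge0 ltW.
have : 0 <= e * (nrm a - e) by rewrite mulr_ge0 ?(ltW e0)// subr_ge0 ltW.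
rewrite sqrrB; move: h1; rewrite -mulr_natr; move: (nrm (phi n a) ^+ 2) (nrm a) => u v.
nra.
Qed.

(** * Passage from finite sets to compact sets *)

Lemma nrm_net (R : realType) (A : cstarAlgType R) (F : set A) (e : R) :
  compact F -> 0 < e -> exists s : seq A, (forall a, a \in s -> F a) /\
    forall a, F a -> exists2 b, b \in s & nrm (a - b) < e.
Proof.
move=> cF e0.
have [|s [sF hs]] := compact_net (U := fun b => [set a | nrm (b - a) < e]) cF.
  by move=> b _; apply/nbhs_nrmP; exists e.
exists s; split=> // a /hs[b bs ba]; exists b => //; by rewrite nrmBC.
Qed.

Unset Implicit Arguments.
Local Close Scope complex_scope.

Theorem theorem3p16 (R : realType) (G : topologicalGroupType)
    (A : cstarAlgType R) (alpha : G -> A -> A) :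
  hausdorff_space G -> compact [set: G] -> @second_countable G ->
  simple_cstar A -> separable_space A -> infinite_dim A ->
  is_action alpha -> wtrp_comparison alpha ->
  forall (eps : R) (F1 F2 : set A) (x y : A),
    0 < eps -> compact F1 -> compact F2 -> F2 `<=` fixed_alg alpha ->
    pos setT x -> nrm x = 1 ->
    pos (fixed_alg alpha) y -> y <> 0 ->
    exists (d : A) (phi : A -> A),
      (pos (fixed_alg alpha) d /\ nrm d <= 1) /\
      cpc (corner (fixed_alg alpha) d) phi /\
      phi 1 = d /\
      (forall a b, (F1 `|` F2) a -> (F1 `|` F2) b ->
        nrm (phi a * phi b - d * phi (a * b)) < eps) /\
      (forall a, (F1 `|` F2) a -> nrm (d * a - a * d) < eps) /\
      (forall a, F2 a ->
        nrm (phi a - cfc Num.sqrt d * a * cfc Num.sqrt d) < eps) /\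
      (forall a, (F1 `|` F2) a -> nrm a - eps <= nrm (phi a)) /\
      cuntz_sub setT (cutdown (1 - d) eps) x /\
      cuntz_sub (fixed_alg alpha) (cutdown (1 - d) eps) y /\
      cuntz_sub (fixed_alg alpha) (cutdown (1 - d) eps) d /\
      1 - eps < nrm (d * x * d).
Proof.
move=> _ compG _ simA _ _ alP wal eps F1 F2 x y e0 cF1 cF2 F2fix px x1 py y0.
have cF : compact (F1 `|` F2) by exact: compactU.
have [s0 [_ hs0]] := nrm_net cF ltr01.
pose K : R := 1 + \sum_(a <- s0) nrm a.
have K1 : 1 <= K by rewrite lerDl; apply: sumr_ge0 => *; exact: nrm_ge0.
have K0 : 0 < K := lt_le_trans ltr01 K1.
have FK a : (F1 `|` F2) a -> nrm a <= K.
  move=> /hs0[b bs ba]; rewrite (le_trans (nrm_dist _ b))// addrC lerD ?(ltW ba)//.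
  by rewrite (perm_big _ (perm_to_rem bs)) big_cons lerDl; apply: sumr_ge0 => *; exact: nrm_ge0.
(* In (2), replacing a and b by net points costs at most 4 r K and the net points themselves at most
   r, together less than 8 r K. *)
pose r := eps / (8 * K).
have r0 : 0 < r by rewrite divr_gt0// mulr_gt0.
have rK : 8 * (r * K) = eps by rewrite /r; field; rewrite gt_eqF.
have rrK : r <= r * K by rewrite ler_peMr// ltW.
have [Fs [FsF hFs]] := nrm_net cF r0.
have [L0 [L0F hL0]] := nrm_net cF2 r0.
have e4 : 0 < eps / 4 by rewrite divr_gt0.
have [Lc hLc] := choice (fun a => @approx_isometry R A a (eps / 4) simA e4).
(* The net is enlarged by the elements that control (5) at each of its points; (5) then holds up to
   eps/2 on the net, and up to 2 r more on the compact sets. *)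
pose L := Fs ++ flatten [seq Lc a | a <- Fs].
have L0fix a : a \in L0 -> fixed_alg alpha a by move=> /L0F; exact: F2fix.
have inv0 n : 0 < n.+1%:R^-1 :> R by rewrite invr_gt0.
have [d /choice[phi /choice[t ht]]] :=
  choice (fun n => approximating_maps alP compG wal L (inv0 n) L0fix px x1 py y0).
have d1 n : nrm (d n) <= 1 by have [[]] := ht n.
have pd n : psd (d n) by have [[_ /pos_psd]] := ht n.
have phiL n : linear (phi n) by have [_ [[]]] := ht n.
have phiP n : cpform (phi n) by have [_ [[]]] := ht n.
have phi1 n : phi n 1 = d n by have [_ [[]]] := ht n.
(* |d x d| <= |d| since x and d are contractions, so (9) bounds |d| from below. *)
have dlim : rle (fun n => 1 - nrm (d n)) 0.
  apply: (rle_le _ _ (@rle_inv_nat R)) => // n.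
  have [[/andP[_ tn] _ _] [_ [_ [_ _ _ h]]]] := ht n.
  have : nrm (d n * x * d n) <= nrm (d n).
    rewrite (le_trans (nrmM _ _))// -[leRHS]mul1r ler_wpM2r ?nrm_ge0//.
    by rewrite (le_trans (nrmM _ _))// x1 mulr1.
  move: h tn; move: (n.+1%:R^-1) (nrm (d n * _ * _)) => u v; lra.
have mulL b c : b \in L -> c \in L -> null (fun n => phi n b * phi n c - d n * phi n (b * c)).
  move=> bL cL; apply: null_le (@rle_inv_nat R) => n.
  by have [_ [_ [[h _ _] _]]] := ht n; exact: h.
have FsL b : b \in Fs -> b \in L by move=> bs; rewrite mem_cat bs.
have isoF b : b \in Fs -> rle (fun n => nrm b - nrm (phi n b)) (eps / 4).
  move=> bs; apply: hLc => // c c' cL cL'; apply: mulL;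
    by rewrite mem_cat; apply/orP; right; apply/flatten_mapP; exists b.
have [N1 hN1] := rle_seq e4 isoF.
have [N2 hN2] := @inv_nat_small R 1 _ r0.
pose n := maxn N1 N2.
have hn1 := hN1 n (leq_maxl _ _).
have := hN2 n (leq_maxr _ _); rewrite div1r => hn2.
have [[/andP[t0 tn] pdf _] [[_ _ _ phif] [[m1 m2 m3] [q1 q2 q3 q4]]]] := ht n.
have teps : t n <= eps.
  rewrite (le_trans tn)// (le_trans hn2)// (le_trans rrK)//; lra.
have p1d : psd (1 - d n).
  by have := psd_sqrt_le (psd_sa (pd n)) (d1 n); rewrite scale1r.
have phi_le a : nrm (phi n a) <= nrm a by apply: cp_contractive => //; rewrite phi1.
have fixA := csub_fixed alP.
have fix1 : fixed_alg alpha 1 by exact: fixed_one.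
have fixd : fixed_alg alpha (d n) by rewrite -phi1.
have s1d : star (1 - d n) = 1 - d n by exact: psd_sa.
have f1d : fixed_alg alpha (1 - d n) by exact: (csubB fixA).
have csT : csub [set: A] by split.
exists (d n), (phi n); split; [|split; [|split; [|split; [|split; [|split; [|split; [|split; [|split; [|split]]]]]]]]].
- by split.
- exact: cpform_cpc.
- exact: phi1.
- move=> a b Fa Fb; have [a' a's aa] := hFs a Fa; have [b' b's bb] := hFs b Fb.
  have Ka' := FK _ (FsF _ a's); have Kb := FK _ Fb.
  have -> : phi n a * phi n b - d n * phi n (a * b) =
      (phi n a' * phi n b' - d n * phi n (a' * b')) +
      (phi n (a - a') * phi n b + phi n a' * phi n (b - b')) -
      d n * phi n ((a - a') * b + a' * (b - b')).
    have -> : (a - a') * b + a' * (b - b') = a * b - a' * b' by rewrite mulrBl mulrBr addrA subrK.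
    have -> : phi n (a - a') * phi n b + phi n a' * phi n (b - b') = phi n a * phi n b - phi n a' * phi n b'.
      by rewrite !(lin_B (phiL n)) mulrBl mulrBr addrA subrK.
    rewrite (lin_B (phiL n)) mulrBr [X in _ = X - _]addrC.
    by rewrite [in RHS]addrA subrK subr_subr.
  have k1 : nrm (phi n (a - a') * phi n b) <= r * K.
    by rewrite (le_trans (nrmM _ _))// ler_pM ?nrm_ge0// (le_trans (phi_le _))// ltW.
  have k2 : nrm (phi n a' * phi n (b - b')) <= r * K.
    by rewrite [leRHS]mulrC (le_trans (nrmM _ _))// ler_pM ?nrm_ge0// (le_trans (phi_le _))// ltW.
  have k3 : nrm (d n * phi n ((a - a') * b + a' * (b - b'))) <= r * K + r * K.
    rewrite -[leRHS]mul1r (le_trans (nrmM _ _))// ler_pM ?nrm_ge0// (le_trans (phi_le _))//.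
    rewrite (le_trans (nrmD _ _))// lerD// (le_trans (nrmM _ _))//.
      by rewrite ler_pM ?nrm_ge0// ltW.
    by rewrite mulrC ler_pM ?nrm_ge0// ltW.
  have k0 := le_trans (m1 a' b' (FsL _ a's) (FsL _ b's)) hn2.
  have := nrmB (phi n a' * phi n b' - d n * phi n (a' * b') +
      (phi n (a - a') * phi n b + phi n a' * phi n (b - b')))
      (d n * phi n ((a - a') * b + a' * (b - b'))).
  have := nrmD (phi n a' * phi n b' - d n * phi n (a' * b'))
      (phi n (a - a') * phi n b + phi n a' * phi n (b - b')).
  have := nrmD (phi n (a - a') * phi n b) (phi n a' * phi n (b - b')).
  lra.
- move=> a Fa; have [a' a's aa] := hFs a Fa.
  have -> : d n * a - a * d n = (d n * a' - a' * d n) + (d n * (a - a') - (a - a') * d n).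
    by rewrite mulrBr mulrBl opprB addrACA [d n * a' + _]addrC subrK addKr.
  have k1 := nrmM (d n) (a - a'); have k2 := nrmM (a - a') (d n).
  have k3 : nrm (d n) * nrm (a - a') <= nrm (a - a') by rewrite ler_piMl ?nrm_ge0.
  have k4 := nrmB (d n * (a - a')) ((a - a') * d n).
  have k0 := le_trans (m2 a' (FsL _ a's)) hn2.
  rewrite (le_lt_trans (nrmD _ _))//; rewrite mulrC in k2; lra.
- move=> a Fa; have [a' a's aa] := hL0 a Fa.
  set s := cfc _ _ in m3 *; have s1 : nrm s <= 1 by exact: nrm_sqrt_le1.
  have -> : phi n a - s * a * s = (phi n a' - s * a' * s) + (phi n (a - a') - s * (a - a') * s).
    by rewrite (lin_B (phiL n)) mulrBr mulrBl opprB addrACA [phi n a' + _]addrC subrK addKr.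
  have k1 : nrm (s * (a - a') * s) <= nrm (a - a').
    rewrite (le_trans (nrmM _ _))// -[leRHS]mulr1 ler_pM ?nrm_ge0//.
    by rewrite (le_trans (nrmM _ _))// ler_piMl ?nrm_ge0.
  have k2 := phi_le (a - a').
  have k4 := nrmB (phi n (a - a')) (s * (a - a') * s).
  have k0 := le_trans (m3 a' a's) hn2.
  rewrite (le_lt_trans (nrmD _ _))//; lra.
- move=> a Fa; have [a' a's aa] := hFs a Fa.
  have k1 := hn1 a' a's.
  have k2 := nrm_dist a a'.
  have k3 : nrm (phi n a') <= nrm (phi n a) + nrm (a - a').
    by rewrite (le_trans (nrm_dist _ (phi n a)))// lerD2l -(lin_B (phiL n)) nrmBC (le_trans (phi_le _)).
  lra.
- exact: cuntz_cutdown_mono q1.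
- exact: cuntz_cutdown_mono q2.
- exact: cuntz_cutdown_mono q3.
- lra.
Qed.
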